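(* Let $G$ be a countable discrete group which is non-elementary and hyperbolic relative to some collection of proper subgroups (an NPRH group). Then the amenable radical $R_a(G)$ of $G$ coincides with the maximal finite normal subgroup $E_G(G)$ of $G$, and the quotient $G/E_G(G)$ is $C^*$-simple with a unique normalized trace; that is, the reduced $C^*$-algebra $C^*_r(G/E_G(G))$ is simple and has a unique normalized trace.
   Context: Amenable radical: every countable group $G$ has a maximal normal amenable subgroup $R_a(G)\lhd G$ (containing all normal amenable subgroups), called the amenable radical of $G$. Reduced $C^*$-algebra: for a countable discrete group $Q$, $\ell^2(Q)$ is the Hilbert space of square-summable complex-valued functions on $Q$, and $\lambda(g)f(h)=f(g^{-1}h)$ for $g,h\in Q$, $f\in\ell^2(Q)$, is the left regular representation. $C^*_r(Q)$ is the operator norm closure of the linear span of $\{\lambda(g)\mid g\in Q\}$ in the algebra $B(\ell^2(Q))$ of bounded operators. $Q$ is $C^*$-simple if $C^*_r(Q)$ is simple, i.e. has no non-trivial two-sided ideals. Normalized trace: on a unital $C^*$-algebra $A$, a linear map $\sigma:A\to\mathbb C$ with $\sigma(1)=1$, $\sigma(a^*a)\ge0$ and $\sigma(ab)=\sigma(ba)$ for all $a,b\in A$. Elementary: a group is elementary if it has a cyclic subgroup of finite index (in particular finite groups are elementary); otherwise it is non-elementary. Relative hyperbolicity (Osin's definition): Let $G$ be a group, $\{H_\lambda\}_{\lambda\in\Lambda}$ a collection of subgroups of $G$ (called peripheral subgroups) and $X\subseteq G$ a subset, which for convenience is assumed to satisfy $X^{-1}=X$. $X$ is a relative generating set of $G$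 with respect to $\{H_\lambda\}_{\lambda\in\Lambda}$ if $G$ is generated by $X\cup\bigcup_{\lambda}H_\lambda$. Then $G$ is a quotient of $\mathcal F=(\ast_{\lambda\in\Lambda}H_\lambda)*F(X)$, where $F(X)$ is the free group with basis $X$. If $\mathcal R\subseteq \mathcal F$ is such that the kernel of the natural epimorphism $\mathcal F\to G$ is the normal closure of $\mathcal R$ in $\mathcal F$, one says $G$ has the relative presentation $\langle X,\{H_\lambda\}_{\lambda\in\Lambda}\mid R=1,\ R\in\mathcal R\rangle$; it is finite if $X$ and $\mathcal R$ are finite. Put $\mathcal H=\bigsqcup_{\lambda\in\Lambda}(H_\lambda\setminus\{1\})$. A finite relative presentation satisfies a linear relative isoperimetric inequality if there is $C>0$ such that every word $w$ in the alphabet $X\cup\mathcal H$ representing $1$ in $G$ can be written, with equality in $\mathcal F$, as $w=\prod_{i=1}^k f_i^{-1}R_i^{\pm1}f_i$ with $R_i\in\mathcal R$, $f_i\in \mathcal F$ and $k\le C\|w\|$, where $\|w\|$ is the length of the word $w$. The group $G$ is hyperbolic relative to $\{H_\lambda\}_{\lambda\in\Lambda}$ if it admits a finite relative presentation satisfying a linear relative isoperimetric inequality. The collection consists of proper subgroups if $H_\lambda\ne G$ for all $\lambda\in\Lambda$. Maximal finite normal subgroup: every non-elementary group $G$ that is hyperbolic relative to a collection of proper subgroups has a finite normal subgroup containing all finite normal subgroups of $G$ (a known fact); it is denoted $E_G(G)$. *)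

(* Defs.v *)
(* MathComp-Analysis; [groupType] includes infinite groups. *)
From HB Require Import structures.
From mathcomp Require Import all_boot all_order all_algebra.
From mathcomp Require Import complex ring lra.
From mathcomp Require Import all_classical all_reals all_analysis.

Set Implicit Arguments.
Unset Strict Implicit.
Unset Printing Implicit Defensive.

Import Order.TTheory GRing.Theory Num.Theory.
Import ComplexField.Normc.

Local Open Scope classical_set_scope.
Local Open Scope group_scope.

Record subgroup (G : groupType) := Subgroup {
  sg_set : set G;
  sg_closed : group_closed (fun x => x \in sg_set)
}.

Record sgType (G : groupType) (H : subgroup G) := SgElt {
  sg_val :> G;
  sg_valP : sg_val \in sg_set H
}.

Section SubgroupType.
Variables (G : groupType) (H : subgroup G).
HB.instance Definition _ := [isSub of sgType H for @sg_val G H].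
HB.instance Definition _ := [Choice of sgType H by <:].
HB.instance Definition _ :=
  SubChoice_isSubGroup.Build G _ (sgType H) (sg_closed H).
End SubgroupType.

Section SubgroupNotions.
Variable G : groupType.
Implicit Types (H N : subgroup G) (S : set G).

Definition normal N := forall g n : G, sg_set N n -> sg_set N (n ^ g).

Definition proper_subgroup H := sg_set H <> setT.

Definition generated S : set G :=
  [set x | forall H, S `<=` sg_set H -> sg_set H x].

Definition normal_closure S : set G :=
  [set x | forall N, normal N -> S `<=` sg_set N -> sg_set N x].

Definition finite_index H :=
  finite_set [set [set g * h | h in sg_set H] | g in [set: G]].

Definition cyclic_subgroup H := exists g : G, sg_set H = generated [set g].

Definition max_finite_normal N :=
  [/\ normal N, finite_set (sg_set N)
    & forall M, normal M -> finite_set (sg_set M) -> sg_set M `<=` sg_set N].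

End SubgroupNotions.

Definition elementary (G : groupType) :=
  exists2 C : subgroup G, cyclic_subgroup C & finite_index C.

(* Existence of a left-invariant finitely additive probability measure
   defined on all subsets (for a discrete group). *)
Definition amenable (R : realType) (K : groupType) :=
  exists m : set K -> R,
    [/\ forall A, (0 <= m A)%R,
        m setT = 1%R,
        forall A B, A `&` B = set0 -> m (A `|` B) = (m A + m B)%R
      & forall g A, m [set g * a | a in A] = m A].

Definition amenable_radical (R : realType) (G : groupType) (N : subgroup G) :=
  [/\ normal N, amenable R (sgType N)
    & forall M : subgroup G, normal M -> amenable R (sgType M) ->
        sg_set M `<=` sg_set N].

Record preGroup := PreGroup {
  pg_sort :> Type;
  pg_eq : pg_sort -> pg_sort -> Prop;
  pg_mul : pg_sort -> pg_sort -> pg_sort;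
  pg_one : pg_sort;
  pg_inv : pg_sort -> pg_sort;
  pg_refl : forall x, pg_eq x x;
  pg_sym : forall x y, pg_eq x y -> pg_eq y x;
  pg_trans : forall x y z, pg_eq x y -> pg_eq y z -> pg_eq x z;
  pg_mul_cong : forall x x' y y',
    pg_eq x x' -> pg_eq y y' -> pg_eq (pg_mul x y) (pg_mul x' y');
  pg_inv_cong : forall x x', pg_eq x x' -> pg_eq (pg_inv x) (pg_inv x');
  pg_mulA : forall x y z,
    pg_eq (pg_mul x (pg_mul y z)) (pg_mul (pg_mul x y) z);
  pg_mul1 : forall x, pg_eq (pg_mul pg_one x) x;
  pg_mulr1 : forall x, pg_eq (pg_mul x pg_one) x;
  pg_mulV : forall x, pg_eq (pg_mul (pg_inv x) x) pg_one;
  pg_mulrV : forall x, pg_eq (pg_mul x (pg_inv x)) pg_one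
}.

Record quot (P : preGroup) := Quot {
  quot_class : set P;
  quot_classP : exists x, quot_class = [set y | pg_eq x y]
}.

Section QuotTheory.
Variable P : preGroup.

Definition qpi (x : P) : quot P :=
  @Quot P [set y | pg_eq x y] (ex_intro _ x erefl).

Definition qrepr (u : quot P) : P := projT1 (cid (quot_classP u)).

Lemma quot_class_inj : injective (@quot_class P).
Proof.
move=> [c p] [d q] /= cd; case: _ / cd in q *.
by congr Quot; exact: Prop_irrelevance.
Qed.

Lemma qpi_eq (x y : P) : pg_eq x y -> qpi x = qpi y.
Proof.
move=> xy; apply/quot_class_inj/seteqP; split => z /=.
  exact/pg_trans/pg_sym.
exact: pg_trans.
Qed.

Lemma qpi_inj (x y : P) : qpi x = qpi y -> pg_eq x y.
Proof.
move=> /(congr1 (@quot_class P)) /= E.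
have : [set z | pg_eq y z] y by exact: pg_refl.
by rewrite -E.
Qed.

Lemma qreprK (u : quot P) : qpi (qrepr u) = u.
Proof.
by apply: quot_class_inj; rewrite /qrepr; case: cid => x /= ->.
Qed.

Lemma qpiK (x : P) : pg_eq (qrepr (qpi x)) x.
Proof. by apply: qpi_inj; rewrite qreprK. Qed.

Definition quot_mul (u v : quot P) := qpi (pg_mul (qrepr u) (qrepr v)).
Definition quot_inv (u : quot P) := qpi (pg_inv (qrepr u)).

Lemma quot_mulE (x y : P) : quot_mul (qpi x) (qpi y) = qpi (pg_mul x y).
Proof. by apply/qpi_eq/pg_mul_cong; exact: qpiK. Qed.

Lemma quot_invE (x : P) : quot_inv (qpi x) = qpi (pg_inv x).
Proof. by apply/qpi_eq/pg_inv_cong; exact: qpiK. Qed.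

Let quot_mulA : associative quot_mul.
Proof.
move=> u v w; rewrite -(qreprK u) -(qreprK v) -(qreprK w) !quot_mulE.
exact/qpi_eq/pg_mulA.
Qed.
Let quot_mul1 : left_id (qpi (pg_one P)) quot_mul.
Proof. by move=> u; rewrite -(qreprK u) quot_mulE; exact/qpi_eq/pg_mul1. Qed.
Let quot_mulr1 : right_id (qpi (pg_one P)) quot_mul.
Proof. by move=> u; rewrite -(qreprK u) quot_mulE; exact/qpi_eq/pg_mulr1. Qed.
Let quot_mulV : left_inverse (qpi (pg_one P)) quot_inv quot_mul.
Proof.
move=> u; rewrite -(qreprK u) quot_invE quot_mulE; exact/qpi_eq/pg_mulV.
Qed.
Let quot_mulrV : right_inverse (qpi (pg_one P)) quot_inv quot_mul.
Proof.
move=> u; rewrite -(qreprK u) quot_invE quot_mulE; exact/qpi_eq/pg_mulrV.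
Qed.

HB.instance Definition _ := gen_eqMixin (quot P).
HB.instance Definition _ := gen_choiceMixin (quot P).
HB.instance Definition _ := isGroup.Build (quot P)
  quot_mulA quot_mul1 quot_mulr1 quot_mulV quot_mulrV.

Lemma qpiM (x y : P) : qpi (pg_mul x y) = qpi x * qpi y.
Proof. by rewrite -quot_mulE. Qed.

End QuotTheory.

Section QuotientGroup.
Variables (G : groupType) (N : subgroup G) (nN : normal N).

Local Notation mem_N := (sg_set N).

Definition coset_eq (x y : G) := sg_set N (x^-1 * y).

Lemma sg1 : mem_N 1.
Proof. by case: N => S [/= /set_mem]. Qed.

Lemma sgM x y : mem_N x -> mem_N y -> mem_N (x * y).
Proof.
case: N => S [/= S1 SD] /= /mem_set Sx /mem_set Sy; apply: set_mem.
exact: (group_closedM (conj S1 SD)).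
Qed.

Lemma sgV x : mem_N x -> mem_N x^-1.
Proof.
case: N => S [/= S1 SD] /= /mem_set Sx; apply: set_mem.
exact: (group_closedV (conj S1 SD)).
Qed.

Lemma coset_eq_refl x : coset_eq x x.
Proof. by rewrite /coset_eq mulVg; exact: sg1. Qed.

Lemma coset_eq_sym x y : coset_eq x y -> coset_eq y x.
Proof. by move=> /sgV; rewrite invgM invgK. Qed.

Lemma coset_eq_trans x y z : coset_eq x y -> coset_eq y z -> coset_eq x z.
Proof. by move=> xy /(sgM xy); rewrite /coset_eq mulgA mulgK. Qed.

Lemma coset_eq_mul x x' y y' :
  coset_eq x x' -> coset_eq y y' -> coset_eq (x * y) (x' * y').
Proof.
move=> xx' yy'; rewrite /coset_eq.
have -> : (x * y)^-1 * (x' * y') = (x^-1 * x') ^ y * (y^-1 * y').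
  by rewrite /conjg invgM -!mulgA mulVKg.
by apply: sgM => //; exact: nN.
Qed.

Lemma coset_eq_inv x x' : coset_eq x x' -> coset_eq x^-1 x'^-1.
Proof.
move=> /sgV /(nN x^-1).
by rewrite /coset_eq /conjg invgM !invgK mulgK.
Qed.

Definition quotient_pre : preGroup.
Proof.
refine (@PreGroup G coset_eq *%g 1 (fun x => x^-1) coset_eq_refl coset_eq_sym
  coset_eq_trans coset_eq_mul coset_eq_inv _ _ _ _ _).
- by move=> x y z; rewrite mulgA; exact: coset_eq_refl.
- by move=> x; rewrite mul1g; exact: coset_eq_refl.
- by move=> x; rewrite mulg1; exact: coset_eq_refl.
- by move=> x; rewrite mulVg; exact: coset_eq_refl.
- by move=> x; rewrite mulgV; exact: coset_eq_refl.
Defined.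

Definition quotient : groupType := quot quotient_pre.

End QuotientGroup.

Section FreeProduct.
Variables (X I : Type) (K : I -> groupType).

(* [FGen x false] stands for the basis element [x] of the free group, and
   [FGen x true] for its inverse. *)
Inductive fp_letter := FGen of X & bool | FPer (i : I) of K i.

Definition fp_word := seq fp_letter.

Inductive fp_eq : fp_word -> fp_word -> Prop :=
| FpRefl u : fp_eq u u
| FpSym u v : fp_eq u v -> fp_eq v u
| FpTrans u v w : fp_eq u v -> fp_eq v w -> fp_eq u w
| FpCat u u' v v' : fp_eq u u' -> fp_eq v v' -> fp_eq (u ++ v) (u' ++ v')
| FpCancel x b : fp_eq [:: FGen x b; FGen x (~~ b)] [::]
| FpOne i : fp_eq [:: @FPer i 1] [::]
| FpMul i (g h : K i) : fp_eq [:: FPer g; FPer h] [:: FPer (g * h)].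

Definition fp_linv (a : fp_letter) :=
  match a with
  | FGen x b => FGen x (~~ b)
  | FPer i g => FPer g^-1
  end.

Definition fp_inv (w : fp_word) : fp_word := rev (map fp_linv w).

Lemma fp_linvK : involutive fp_linv.
Proof. by case=> [x b|i g] /=; rewrite ?negbK ?invgK. Qed.

Lemma fp_invK : involutive fp_inv.
Proof. by move=> w; rewrite /fp_inv map_rev revK (mapK fp_linvK). Qed.

Lemma fp_inv_cat u v : fp_inv (u ++ v) = fp_inv v ++ fp_inv u.
Proof. by rewrite /fp_inv map_cat rev_cat. Qed.

Lemma fp_mulrV w : fp_eq (w ++ fp_inv w) [::].
Proof.
elim: w => [|a w IH]; first exact: FpRefl.
rewrite -cat1s fp_inv_cat -catA (catA w).
have aa : fp_eq ([:: a] ++ fp_inv [:: a]) [::].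
  case: a {IH} => [x b|i g]; first exact: FpCancel.
  apply: FpTrans (FpMul _ _) _; rewrite mulgV; exact: FpOne.
apply: FpTrans aa; apply: FpCat; first exact: FpRefl.
exact: (FpCat IH (FpRefl _)).
Qed.

Lemma fp_mulV w : fp_eq (fp_inv w ++ w) [::].
Proof. by rewrite -{2}(fp_invK w); exact: fp_mulrV. Qed.

Lemma fp_inv_cong u v : fp_eq u v -> fp_eq (fp_inv u) (fp_inv v).
Proof.
move=> uv; have H1 : fp_eq (fp_inv u ++ (v ++ fp_inv v)) (fp_inv u).
  by rewrite -[X in fp_eq _ X]cats0; apply: FpCat (FpRefl _) (fp_mulrV v).
have H2 : fp_eq ((fp_inv u ++ v) ++ fp_inv v) (fp_inv v).
  rewrite -[X in fp_eq _ X]cat0s; apply: FpCat (FpRefl _).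
  apply: FpTrans (fp_mulV u); exact: FpCat (FpRefl _) (FpSym uv).
by apply: FpTrans (FpSym H1) _; rewrite catA.
Qed.

Definition free_product_pre : preGroup.
Proof.
refine (@PreGroup fp_word fp_eq cat [::] fp_inv FpRefl FpSym FpTrans FpCat
  fp_inv_cong _ _ _ fp_mulV fp_mulrV).
- by move=> u v w; rewrite catA; exact: FpRefl.
- by move=> u; exact: FpRefl.
- by move=> u; rewrite cats0; exact: FpRefl.
Defined.

Definition free_product : groupType := quot free_product_pre.

Definition fp_gen (x : X) : free_product :=
  @qpi free_product_pre [:: FGen x false].

Definition fp_per (i : I) (g : K i) : free_product :=
  @qpi free_product_pre [:: FPer g].

Variables (G : groupType) (f : X -> G) (phi : forall i, K i -> G).

Definition fp_leval (a : fp_letter) : G :=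
  match a with
  | FGen x b => if b then (f x)^-1 else f x
  | FPer i g => phi g
  end.

Definition fp_eval (w : fp_word) : G := \prod_(a <- w) fp_leval a.

Definition fp_lift (u : free_product) : G := fp_eval (qrepr u).

Hypothesis phiM : forall i (g h : K i), phi (g * h) = phi g * phi h.

Lemma fp_eval_eq u v : fp_eq u v -> fp_eval u = fp_eval v.
Proof.
have phi1 i : phi (1 : K i) = 1.
  by apply: (mulgI (phi (1 : K i))); rewrite mulg1 -phiM mulg1.
rewrite /fp_eval; elim=> {u v} //.
- by move=> u v w _ -> _ ->.
- by move=> u u' v v' _ Eu _ Ev; rewrite !big_cat /= Eu Ev.
- by move=> x [] /=; rewrite !big_cons big_nil /= mulg1 ?mulVg ?mulgV.
- by move=> i; rewrite !big_cons !big_nil /= mulg1 phi1.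
- by move=> i g h; rewrite !big_cons !big_nil /= !mulg1 phiM.
Qed.

Lemma fp_lift_pi (w : fp_word) :
  fp_lift (@qpi free_product_pre w) = fp_eval w.
Proof. by apply: fp_eval_eq; exact: (@qpiK free_product_pre). Qed.

Lemma fp_liftM u v : fp_lift (u * v) = fp_lift u * fp_lift v.
Proof.
rewrite -(qreprK u) -(qreprK v) -qpiM !fp_lift_pi /fp_eval /=.
by rewrite big_cat.
Qed.

Lemma fp_lift_gen x : fp_lift (fp_gen x) = f x.
Proof. by rewrite fp_lift_pi /fp_eval big_seq1. Qed.

Lemma fp_lift_per i (g : K i) : fp_lift (fp_per g) = phi g.
Proof. by rewrite fp_lift_pi /fp_eval big_seq1. Qed.

End FreeProduct.

Section RelativelyHyperbolic.
Variables (G : groupType) (L : Type) (H : L -> subgroup G) (X : set G).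

Definition rel_generating :=
  generated (X `|` \bigcup_(l in [set: L]) sg_set (H l)) = setT.

Definition rel_free : groupType :=
  free_product (set_type X) (fun l => sgType (H l)).

Definition rel_nat (u : rel_free) : G :=
  fp_lift (fun x : set_type X => val x) (fun l (h : sgType (H l)) => val h) u.

Lemma rel_natM u v : rel_nat (u * v) = rel_nat u * rel_nat v.
Proof. exact: fp_liftM. Qed.

Definition rel_presentation (rels : set rel_free) :=
  [set u | rel_nat u = 1] = normal_closure rels.

Definition rel_alphabet : Type :=
  set_type X + {l : L & {h : sgType (H l) | h <> 1}}.

Definition rel_letter (a : rel_alphabet) : rel_free :=
  match a with
  | inl x => fp_gen _ x
  | inr (existT l h) =>
      fp_per (K := fun l => sgType (H l)) (set_type X) (proj1_sig h)
  end.

Definition rel_word (w : seq rel_alphabet) : rel_free :=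
  \prod_(a <- w) rel_letter a.

(* [(f, r, b)] contributes the factor [f^-1 * r^(+-1) * f], which is [r ^ f]
   or [r^-1 ^ f]; the length of [s] is the number of factors. *)
Definition linear_rel_isoperimetric (R : realType) (rels : set rel_free) :=
  exists2 C : R, (0 < C)%R &
    forall w : seq rel_alphabet, rel_nat (rel_word w) = 1 ->
    exists s : seq (rel_free * rel_free * bool),
      [/\ forall t, t \in s -> rels t.1.2,
          rel_word w =
            \prod_(t <- s) ((if t.2 then t.1.2^-1 else t.1.2) ^ t.1.1)
        & ((size s)%:R <= C * (size w)%:R)%R].

End RelativelyHyperbolic.

(* [X] is closed under inverses, but [rel_free] is free on all of [X]: the
   letters [x] and [x^-1] of [X] are distinct basis elements, and words have
   no formal inverses of letters. *)
Definition rel_hyperbolic (R : realType) (G : groupType) (L : Type)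
    (H : L -> subgroup G) :=
  exists X : set G,
    [/\ finite_set X, (forall x, X x -> X x^-1), rel_generating H X
      & exists rels : set (rel_free H X),
        [/\ finite_set rels, rel_presentation rels
          & linear_rel_isoperimetric R rels]].

(* Non-elementary and properly relatively hyperbolic. *)
Definition NPRH (R : realType) (G : groupType) :=
  ~ elementary G /\
  exists (L : Type) (H : L -> subgroup G),
    (forall l, proper_subgroup (H l)) /\ rel_hyperbolic R H.

Local Close Scope group_scope.
Local Open Scope ring_scope.
Local Open Scope complex_scope.

Section Ell2.
Variables (R : realType) (Q : groupType).
Local Notation C := R[i].

Definition sqnorm (f : Q -> C) : \bar R :=
  (\esum_(x in [set: Q]) (normc (f x) ^+ 2)%:E)%E.

Definition sqsum : {pred Q -> C} := fun f => `[< (sqnorm f < +oo)%E >].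

Let sqrDle (a u v : R) :
  (a * u + v) ^+ 2 <= 2 * a ^+ 2 * u ^+ 2 + 2 * v ^+ 2.
Proof.
rewrite -subr_ge0; apply: (@le_trans _ _ ((a * u - v) ^+ 2)).
  exact: sqr_ge0.
by rewrite le_eqVlt; apply/orP; left; apply/eqP; ring.
Qed.

Lemma sqsum_closed : submod_closed sqsum.
Proof.
split.
  apply/asboolP; rewrite /sqnorm esum1 ?ltry// => x _ /=.
  by rewrite expr0n addr0 sqrtr0 expr0n.
move=> a f g /asboolP sf /asboolP sg; apply/asboolP.
set M := 2 * normc a ^+ 2.
have M0 : 0 <= M by rewrite mulr_ge0// sqr_ge0.
have Zesum (c : R) (h : Q -> C) : 0 <= c ->
    (\esum_(x in [set: Q]) (c * normc (h x) ^+ 2)%:E <= c%:E * sqnorm h)%E.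
  move=> c0; apply: ge_ereal_sup => _ [X [finX _] <-].
  rewrite (eq_fsbigr (fun x => c%:E * (normc (h x) ^+ 2)%:E)%E) => [|x _];
    last by rewrite EFinM.
  rewrite -ge0_mule_fsumr; last by move=> x; rewrite lee_fin sqr_ge0.
  apply: lee_wpmul2l; first by rewrite lee_fin.
  by apply: ereal_sup_ubound; exists X.
have le1 : (sqnorm (a *: f + g)%R <= \esum_(x in [set: Q])
    ((M * normc (f x) ^+ 2)%:E + (2 * normc (g x) ^+ 2)%:E))%E.
  apply: le_esum => x _; rewrite -EFinD lee_fin.
  have h : normc (a * f x + g x) <= normc a * normc (f x) + normc (g x).
    by rewrite -normcM; exact: le_normcD.
  have nn (z : C) : 0 <= normc z by case: z => u v; rewrite /= sqrtr_ge0.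
  have -> : (a *: f + g) x = a * f x + g x by [].
  apply: (@le_trans _ _ ((normc a * normc (f x) + normc (g x)) ^+ 2)).
    by rewrite ler_sqr ?nnegrE ?addr_ge0 ?mulr_ge0.
  exact: sqrDle.
apply: (le_lt_trans le1).
rewrite esumD; last 2 first.
- by move=> x _; rewrite lee_fin mulr_ge0// sqr_ge0.
- by move=> x _; rewrite lee_fin mulr_ge0// sqr_ge0.
apply: lte_add_pinfty.
- apply: le_lt_trans (Zesum _ _ M0) _.
  by apply: lte_mul_pinfty => //; rewrite ?lee_fin.
- apply: le_lt_trans (Zesum _ _ _) _; first by [].
  by apply: lte_mul_pinfty => //; rewrite ?lee_fin.
Qed.

HB.instance Definition _ := GRing.isSubmodClosed.Build C (Q -> C) sqsum
  sqsum_closed.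

Record ell2 := Ell2 { ell2_fun :> Q -> C; ell2P : ell2_fun \in sqsum }.

HB.instance Definition _ := [isSub for ell2_fun].
HB.instance Definition _ := [Choice of ell2 by <:].
HB.instance Definition _ := [SubChoice_isSubLmodule of ell2 by <:].

Definition l2norm (f : ell2) : R := Num.sqrt (fine (sqnorm f)).

(* The sum of an absolutely summable real family; [u^\+] and [u^\-] are the
   positive and negative parts. *)
Definition rsum (u : Q -> R) : R :=
  fine (\esum_(x in [set: Q]) ((EFin \o u)^\+ x))%E -
  fine (\esum_(x in [set: Q]) ((EFin \o u)^\- x))%E.

Definition l2inner (f g : ell2) : C :=
  rsum (fun x => complex.Re (f x * conjc (g x))) +i*
  rsum (fun x => complex.Im (f x * conjc (g x))).

Lemma left_translate_sqsum (g : Q) (f : ell2) :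
  (fun h => f (g^-1 * h)%g) \in sqsum.
Proof.
apply/asboolP; have /asboolP := ell2P f.
rewrite /sqnorm (@reindex_esum _ _ _ setT setT (fun h : Q => (g^-1 * h)%g))//.
split => //; first by move=> x y _ _; exact: mulgI.
by move=> y _; exists (g * y)%g => //; rewrite mulKg.
Qed.

Definition lreg (g : Q) (f : ell2) : ell2 := Ell2 (left_translate_sqsum g f).

(* [ell2 -> ell2] carries the pointwise vector space structure. *)
Definition bounded_operator (T : ell2 -> ell2) :=
  linear T /\ exists M : R, forall f, l2norm (T f) <= M * l2norm f.

Definition opnorm (T : ell2 -> ell2) : R :=
  sup [set l2norm (T f) | f in [set f | l2norm f <= 1]].

Definition adjoint (T S : ell2 -> ell2) :=
  forall f g, l2inner (T f) g = l2inner f (S g).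

Definition lreg_span : set (ell2 -> ell2) :=
  [set T | exists s : seq (C * Q), T = \sum_(p <- s) p.1 *: lreg p.2].

Definition reduced_cstar : set (ell2 -> ell2) :=
  [set T | bounded_operator T /\
     forall e : R, 0 < e -> exists2 S, lreg_span S & opnorm (T - S) < e].

Definition two_sided_ideal (A I : set (ell2 -> ell2)) :=
  [/\ I `<=` A, I 0, forall S T, I S -> I T -> I (S + T),
      forall (c : C) T, I T -> I (c *: T)
    & forall S T, A S -> I T -> I (S \o T) /\ I (T \o S)].

Definition simple_algebra (A : set (ell2 -> ell2)) :=
  forall I, two_sided_ideal A I -> I = [set 0] \/ I = A.

(* [s] is only meaningful on [A]; [0 <= z] in [C] says that [z] is a
   nonnegative real. *)
Definition normalized_trace (A : set (ell2 -> ell2))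
    (s : (ell2 -> ell2) -> C) :=
  [/\ forall (c : C) S T, A S -> A T -> s (c *: S + T) = c * s S + s T,
      s idfun = 1,
      forall T T', A T -> A T' -> adjoint T T' -> 0 <= s (T' \o T)
    & forall S T, A S -> A T -> s (S \o T) = s (T \o S)].

Definition has_unique_trace (A : set (ell2 -> ell2)) :=
  exists2 s, normalized_trace A s &
    forall t, normalized_trace A t -> forall T, A T -> t T = s T.

End Ell2.

Definition cstar_simple (R : realType) (Q : groupType) :=
  simple_algebra (@reduced_cstar R Q).

Definition unique_trace (R : realType) (Q : groupType) :=
  has_unique_trace (@reduced_cstar R Q).

(* Main.v *)
(* Let [d] be the word metric for the letters of [X] and of the peripheral
   subgroups. The isoperimetric inequality bounds the integral along a closed
   [d]-path of every closed 1-cochain which is bounded on relators. For cochains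
   approximating [f dg] with [f], [g] 1-Lipschitz this is a linear area
   inequality, which makes [d] hyperbolic; for a truncated length on one coset of
   a peripheral subgroup it confines the peripheral components that are isolated
   in a loop to a finite set. Hence there is a loxodromic element [h], and it
   satisfies weak proper discontinuity.
   The elements which quasi-preserve the axis of [h] commute with a power of [h];
   those all of whose conjugates do so form the maximal finite normal subgroup
   [E]. Finitely many elements outside [E] can be conjugated off the stabilizer of
   the axis at the same time, and shadows of the axis then give Powers' condition
   relative to [E], which passes to [G / E]. Powers' averaging argument yields
   simplicity and uniqueness of the trace, and three disjoint translates rule out
   an invariant mean on a normal subgroup not contained in [E]. *)

Require Import Defs.
From mathcomp Require Import all_boot all_order all_algebra.
From mathcomp Require Import complex zify ring lra.
From mathcomp Require Import all_classical all_reals all_analysis.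

Set Implicit Arguments.
Unset Strict Implicit.
Unset Printing Implicit Defensive.

(** * Loxodromic elements of hyperbolic length functions *)

(* Terms over a [groupType] reach the same operation through different
   (convertible) paths of structures, which [lia] does not identify. *)
Ltac gcanon_op op M :=
  repeat match goal with
  | H : context [op ?N] |- _ =>
    assert_fails (constr_eq N M); change (op N) with (op M) in H
  | |- context [op ?N] => assert_fails (constr_eq N M); change (op N) with (op M)
  end.
Ltac gcanon G :=
  gcanon_op @monoid.mul (monoid_Group__to__monoid_Magma G);
  gcanon_op @natexp (monoid_Group__to__monoid_BaseUMagma G);
  gcanon_op @monoid.inv (monoid_Group__to__monoid_BaseGroup G);
  gcanon_op @monoid.one (monoid_Group__to__monoid_BaseUMagma G).
Ltac glia G := gcanon G; lia.

(** The metric [d] is not proper: its unit ball contains every peripheral subgroup, so finiteness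
    cannot come from counting points. Integration of cochains does the work of van Kampen diagrams:
    a cochain closed on the relations of the free product integrates over elements of [rel_free],
    conjugation only moves the base point, and each relator costs a bounded amount. The form [f dg]
    is not closed along a peripheral coset, whence its approximation; freezing [f] there is harmless
    because such cosets have diameter at most one. Area controls thinness as in Besicovitch's
    inequality: a triangle of thinness [t] contains a rectangle of area about [t ^ 2 / 2] on a loop
    of length linear in [t]. Finiteness comes from isolated components: a path of bounded length may
    carry infinitely many labels, but a peripheral edge isolated in a loop of bounded length carries
    only finitely many. In Powers' condition the complement of [D] is, up to translation, the shadow
    of a high power of [h]; an element off the stabilizer of the axis moves it off itself because
    the Gromov products of [h ^+ N] and [f * h ^+ N] stay bounded. *)

Section LengthFunctions.
#[local] Bind Scope group_scope with Group.sort.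
Variable G : groupType.

Record is_length (len : G -> nat) : Prop := IsLength {
  len1 : len 1%g = 0;
  lenV : forall x, len x^-1%g = len x;
  lenM : forall x y, len (x * y)%g <= len x + len y }.

Definition dist (len : G -> nat) (x y : G) := len (x^-1 * y)%g.

Definition four_point (len : G -> nat) (delta : nat) :=
  forall x y z w, dist len x z + dist len y w <=
    maxn (dist len x y + dist len z w) (dist len x w + dist len y z) + delta.

Variables (len : G -> nat) (lenP : is_length len).
Local Notation d := (dist len).

Lemma dist_id x : d x x = 0.
Proof. by rewrite /dist mulVg (len1 lenP). Qed.

Lemma dist1 x : d 1 x = len x.
Proof. by rewrite /dist invg1 mul1g. Qed.

Lemma dist_sym x y : d x y = d y x.
Proof. by rewrite /dist -(lenV lenP) invgM invgK. Qed.

Lemma dist_tri y x z : d x z <= d x y + d y z.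
Proof.
rewrite /dist (_ : x^-1 * z = (x^-1 * y) * (y^-1 * z))%g ?(lenM lenP) //.
by rewrite !gnorm.
Qed.

Lemma dist_mul g x y : d (g * x) (g * y) = d x y.
Proof. by rewrite /dist !gnorm. Qed.

Lemma dist_mulr x y : d x (x * y) = len y.
Proof. by rewrite /dist !gnorm. Qed.

Lemma len_expg x n : len (x ^+ n) <= n * len x.
Proof.
elim: n => [|n IH]; first by rewrite expg0 (len1 lenP).
by rewrite expgS mulSn; have := lenM lenP x (x ^+ n); glia G.
Qed.

(** Additive form of the statement that the powers of [h] form a quasi-geodesic ray. The first
    clause forces [n <= len (h ^+ n)], the second bounds the backtracking. *)
Definition growing (B : nat) (h : G) : Prop :=
  (forall n, (len (h ^+ n)).+1 <= len (h ^+ n.+1)) /\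
  (forall m n, len (h ^+ m) + len (h ^+ n) <= len (h ^+ (m + n)) + B).

Lemma dist_expg h m n : m <= n -> d (h ^+ m) (h ^+ n) = len (h ^+ (n - m)).
Proof.
move=> mn; rewrite /dist -{1}(subnKC mn) expgnDr mulKg //.
Qed.

Section FourPoint.
Variables (delta : nat) (hyp : four_point len delta).

(** In the four-point condition for [1], [h], [h ^+ 2], [h ^+ n.+2] the gain of [delta + 1] at the
    previous step excludes one alternative, and the other is the gain at the next step. Two such
    gains exclude an alternative again and leave the defect [len h + delta]. *)
Lemma loxodromic_growing h :
  len h + 2 * delta + 1 <= len (h ^+ 2) -> growing (len h + delta) h.
Proof.
move=> h2; have h2' : len (h ^+ 2) <= 2 * len h := len_expg h 2.
have step n : len (h ^+ n) + delta + 1 <= len (h ^+ n.+1).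
  elim: n => [|n IH]; first by rewrite expg0 (len1 lenP) expg1; glia G.
  have := hyp 1%g h (h ^+ 2)%g (h ^+ n.+2)%g; rewrite !dist1.
  rewrite -[X in d X (h ^+ n.+2)]expg1 -[X in d X (h ^+ 2)]expg1 !dist_expg //.
  by rewrite !subSS !subn0 expg1; glia G.
split=> [n|m [|n]]; first by have := step n; glia G.
  by rewrite addn0 expg0 (len1 lenP); glia G.
have := hyp 1%g (h ^+ m)%g (h ^+ m.+1)%g (h ^+ (m + n.+1))%g.
rewrite !dist1 !dist_expg; try glia G.
rewrite subSnn addKn (_ : m + n.+1 - m.+1 = n) ?expg1; last by glia G.
by have := step m; have := step n; have := step (m + n); glia G.
Qed.

(** Otherwise all squares are short, so [g1] and [g2] are close to their inverses, and the absence
    of cancellation in [g1^-1 * g2] passes to [g1 * g2] and [g2 * g1]. Then [(g1 * g2) ^+ 2] has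
    length at least [4 * n - 5 * delta], too long for the square of an element of length at most
    [2 * n]. *)
Lemma exists_loxodromic n g1 g2 : 7 * delta < n ->
  len g1 = n -> len g2 = n -> len (g1^-1 * g2) = n + n ->
  exists h, len h + 2 * delta + 1 <= len (h ^+ 2).
Proof.
move=> nd l1 l2 l12; apply: contrapT => no.
have nl (g : G) : len (g * g) <= len g + 2 * delta.
  by rewrite leqNgt; apply/negP => lt; apply: no; exists g; rewrite expg2; glia G.
have dV (x y : G) : d x y^-1 = len (y * x).
  by rewrite dist_sym /dist invgK.
have e12 : n + n <= len (g1 * g2) + delta.
  have := hyp g1 1%g g2 g1^-1%g; have := nl g1.
  by rewrite !dV !dist1 (dist_sym g1 1%g) dist1 mulg1 /dist; glia G.
have e21 : n + n <= len (g2 * g1) + delta.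
  have := hyp g1 1%g g2 g2^-1%g; have := nl g2.
  by rewrite !dV !dist1 (dist_sym g1 1%g) dist1 mulg1 /dist; glia G.
have e3 : 3 * n <= len (g1 * g2 * g1) + 3 * delta.
  have := hyp 1%g g1 (g1 * g2)%g (g1 * g2 * g1)%g.
  rewrite !dist1 -!mulgA !dist_mul !dist_mulr mulgA l1 l2; glia G.
have e4 : 4 * n <= len ((g1 * g2) ^+ 2) + 5 * delta.
  have := hyp 1%g (g1 * g2)%g (g1 * g2 * g1)%g (g1 * g2 * g1 * g2)%g.
  have E : d (g1 * g2) (g1 * g2 * g1 * g2) = len (g1 * g2).
    by rewrite -mulgA dist_mulr.
  rewrite (_ : (g1 * g2) ^+ 2 = g1 * g2 * g1 * g2)%g; last by rewrite expg2 mulgA.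
  by rewrite E !dist1 !dist_mulr l2; glia G.
rewrite expg2 in e4; have := nl (g1 * g2)%g; have := lenM lenP g1 g2; glia G.
Qed.

Section Axis.
Variables (h : G) (B : nat) (hB : growing B h).

Lemma len_grow m n : m <= n -> len (h ^+ m) + (n - m) <= len (h ^+ n).
Proof.
move/subnKC => <-; elim: (n - m) => [|k IH]; first by rewrite addn0; glia G.
by have := hB.1 (m + k); rewrite addnS; glia G.
Qed.

Lemma len_grow0 n : n <= len (h ^+ n).
Proof. by have := @len_grow 0 n; rewrite expg0 (len1 lenP); glia G. Qed.

Lemma len_expg_mono m n : len (h ^+ m) < len (h ^+ n) -> m < n.
Proof.
by move=> lt; rewrite ltnNge; apply/negP => /len_grow; glia G.
Qed.

(** Twice the Gromov product at [1] of [h ^+ N] and [f * h ^+ N] is unbounded: [f] fixes the end of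
    the ray of positive powers. *)
Definition unbounded (f : G) := forall T, exists N,
  d (h ^+ N) (f * h ^+ N) + T <= len (h ^+ N) + len (f * h ^+ N).

(** The point [f * h ^+ j] almost lies between [1] and [f * h ^+ N]: the threshold on [j] excludes
    the other alternative of the four-point condition. *)
Lemma translate_growth f j N : 2 * len f + B + delta < j -> j <= N ->
  len (f * h ^+ j) + len (h ^+ (N - j)) <= len (f * h ^+ N) + B + delta.
Proof.
move=> jJ jN; have := hyp f 1%g (f * h ^+ N)%g (f * h ^+ j)%g.
have e1 : d f 1 = len f by rewrite dist_sym dist1.
have e2 : d (h ^+ N) (h ^+ j) = len (h ^+ (N - j)) by rewrite dist_sym dist_expg.
have := hB.2 j (N - j); rewrite subnKC //.
have := len_grow0 j.
have := dist_tri f 1 (f * h ^+ j); rewrite !dist_mul e2 !dist1 !dist_mulr e1.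
by glia G.
Qed.

(** The rays towards [h ^+ N] and [f * h ^+ N] stay together far beyond [f * h ^+ j], so the last
    power of [h] no longer than [f * h ^+ j] is near it. *)
Lemma fellow_travel f j : unbounded f -> 2 * len f + B + delta < j ->
  exists i, [/\ len (h ^+ i) <= len (f * h ^+ j),
    len (f * h ^+ j) < len (h ^+ i) + len h &
    d (h ^+ i) (f * h ^+ j) <= len h + B + 3 * delta].
Proof.
move=> uf jJ.
(* By the triangle inequality [h ^+ N] is then longer than both [h ^+ j] and [f * h ^+ j], which
   gives [j <= N] and the bound needed for the maximum [i]. *)
have [N HN] := uf (2 * len (h ^+ j) + 2 * len (f * h ^+ j) + 1).
have trN := dist_tri (f * h ^+ N) 1 (h ^+ N).
rewrite !dist1 dist_sym in trN.
have tr2 := dist_tri (h ^+ N) 1 (f * h ^+ N); rewrite !dist1 in tr2.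
have jN : j <= N by rewrite leqNgt; apply/negP => /ltnW /len_grow; glia G.
have lN : len (f * h ^+ j) < len (h ^+ N).
  by have := dist_sym (h ^+ N) (f * h ^+ N); glia G.
pose P i := len (h ^+ i) <= len (f * h ^+ j).
have P0 : exists i, P i by exists 0; rewrite /P expg0 (len1 lenP).
have Pub i : P i -> i <= N.
  by rewrite /P => Pi; apply: ltnW; apply: len_expg_mono; glia G.
case: (ex_maxnP P0 Pub) => i Pi imax; exists i.
have Pi1 : len (f * h ^+ j) < len (h ^+ i.+1).
  by rewrite ltnNge; apply/negP => /imax; rewrite ltnn.
have Hi1 : len (h ^+ i.+1) <= len (h ^+ i) + len h.
  by rewrite expgSr; apply: (lenM lenP).
have iN := Pub _ Pi.
have tg := translate_growth jJ jN.
have h1 := hyp (h ^+ i)%g (h ^+ N)%g (f * h ^+ N)%g 1%g.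
have h2 := hyp (h ^+ i)%g (f * h ^+ N)%g (f * h ^+ j)%g 1%g.
have hb := hB.2 i (N - i); rewrite subnKC // in hb.
rewrite /P in Pi; split=> //; first by glia G.
have e2 : d (h ^+ N) (h ^+ j) = len (h ^+ (N - j)) by rewrite dist_sym dist_expg.
move: h1 h2; rewrite !(dist_sym _ 1%g) !dist1 dist_mul e2 dist_expg //; glia G.
Qed.

(* Weak proper discontinuity, for the orbit of [1] only. *)
Definition wpd := forall eps M0, exists2 M, M0 <= M &
  exists2 P : set G, finite_set P &
  forall p, len p <= eps -> d (h ^+ M) (p * h ^+ M) <= eps -> P p.

Lemma dist_expg_le m n r : m <= n + r -> n <= m + r ->
  d (h ^+ m) (h ^+ n) <= r * len h.
Proof.
move=> mn nm; case: (leqP m n) => [le|/ltnW le]; last rewrite dist_sym.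
  by rewrite dist_expg //; apply: leq_trans (len_expg _ _) _; rewrite leq_mul2r; glia G.
by rewrite dist_expg //; apply: leq_trans (len_expg _ _) _; rewrite leq_mul2r; glia G.
Qed.

(** Fellow travelling at [j] and at [j + M] gives [i] and [i'] with [i' - i] within [2 * eps] of
    [M]. Hence [h ^- i * f * h ^+ j] moves [1] by at most [eps] and [h ^+ M] by at most
    [2 * eps * len h + eps]. These bounds, and so [P], are uniform in [f]. *)
Lemma wpd_finite : wpd -> exists2 P : set G, finite_set P &
  forall f j, unbounded f -> 2 * len f + B + delta < j ->
    exists i, P (h ^- i * f * h ^+ j)%g.
Proof.
move=> W; set eps := len h + B + 3 * delta.
have [M M0 [P finP HP]] := W (2 * eps * len h + eps) (B + delta + len h).
exists P => // f j uf jJ.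
have [i [i1 i2 i3]] := fellow_travel uf jJ.
have jM : 2 * len f + B + delta < j + M by glia G.
have [i' [i1' i2' i3']] := fellow_travel uf jM.
exists i; have aM := len_grow0 M.
have tg := translate_growth jJ (leq_addr M j).
rewrite addKn in tg.
have ii' : i < i' by apply: len_expg_mono; glia G.
have lm : d (h ^+ i) (h ^+ i') = len (h ^+ (i' - i)).
  by rewrite dist_expg // ltnW.
have ty : d (f * h ^+ j) (f * h ^+ (j + M)) = len (h ^+ M).
  by rewrite dist_mul dist_expg ?leq_addr // addKn.
rewrite -/eps in i3 i3'.
have t1 := dist_tri (f * h ^+ j) (h ^+ i) (h ^+ i').
have t2 := dist_tri (f * h ^+ (j + M)) (f * h ^+ j) (h ^+ i').
have t3 := dist_tri (h ^+ i) (f * h ^+ j) (f * h ^+ (j + M)).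
have t4 := dist_tri (h ^+ i') (h ^+ i) (f * h ^+ (j + M)).
have s1 := dist_sym (f * h ^+ (j + M)) (h ^+ i').
have s2 := dist_sym (f * h ^+ j) (h ^+ i).
have r1 : i' - i <= M + 2 * eps.
  rewrite leqNgt; apply/negP => lt.
  by have := @len_grow M (i' - i); glia G.
have r2 : M <= i' - i + 2 * eps.
  rewrite leqNgt; apply/negP => lt.
  by have := @len_grow (i' - i) M; glia G.
apply: HP.
  by have := i3; rewrite {1}/dist -!mulgA; glia G.
apply: leq_trans (dist_tri (h ^+ (i' - i)) _ _) _.
apply: leq_add; first by apply: dist_expg_le; glia G.
rewrite -(dist_mul (h ^+ i)) -expgnDr subnKC ?(ltnW ii') //.
by rewrite -!mulgA mulVKg -expgnDr.
Qed.

End Axis.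
End FourPoint.
End LengthFunctions.

(** * The stabilizer of an axis *)

Lemma seq_uniform_bound (T : eqType) (s : seq T) (Q : T -> nat -> Prop) :
  (forall x m n, m <= n -> Q x m -> Q x n) ->
  (forall x, x \in s -> exists n, Q x n) ->
  exists n, forall x, x \in s -> Q x n.
Proof.
move=> mono; elim: s => [|a s IH] H; first by exists 0.
have [n1 H1] := H a (mem_head _ _).
have [|n2 H2] := IH; first by move=> x xs; apply: H; rewrite inE xs orbT.
exists (maxn n1 n2) => x; rewrite inE => /predU1P [->|xs].
  exact: mono (leq_maxl _ _) H1.
exact: mono (leq_maxr _ _) (H2 _ xs).
Qed.

Lemma cofinal_pigeonhole (T : choiceType) (P : set T) (R : nat -> T -> Prop) :
  finite_set P -> (forall n0, exists2 n, n0 <= n & exists2 x, P x & R n x) ->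
  exists i j x, [/\ i < j, R i x & R j x].
Proof.
move=> /finite_seqP [s ->]; elim: s => [|a s IH] H.
  by have [n _ [x]] := H 0.
have [[n0 Hn0]|no] := pselect (exists n0, forall n, n0 <= n -> ~ R n a).
  apply: IH => m; have [n nm [x /= xs Rx]] := H (maxn m n0).
  exists n; first exact: leq_trans (leq_maxl _ _) nm.
  exists x => //=; move: xs; rewrite inE => /predU1P [xa|//].
  by case: (Hn0 n); [exact: leq_trans (leq_maxr _ _) nm|rewrite -xa].
have inf n0 : exists2 n, n0 <= n & R n a.
  apply: contrapT => H0; apply: no; exists n0 => n n0n Rn.
  by apply: H0; exists n.
have [i _ Ri] := inf 0; have [j ij Rj] := inf i.+1.
by exists i, j, a.
Qed.

Section AxisAlgebra.
Local Open Scope classical_set_scope.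
Local Open Scope group_scope.
Variables (G : groupType) (h : G).

Lemma conj_expg (s x y : G) n : s * x = y * s -> s * x ^+ n = y ^+ n * s.
Proof.
move=> sxy; elim: n => [|n IH]; first by rewrite !expg0 mulg1 mul1g.
by rewrite expgS mulgA sxy -mulgA IH mulgA -expgS.
Qed.

(** For a loxodromic WPD element this is the group usually written [E^+(h)]; the next definition is
    its extension [E(h)] by the elements exchanging the ends of the axis. *)
Definition axis_stab (f : G) := exists2 n, 0 < n & f * h ^+ n = h ^+ n * f.

Definition axis_stab_or_flip (s : G) :=
  exists2 n, 0 < n & s * h ^+ n = h ^+ n * s \/ s * h ^+ n = h ^- n * s.

Definition powers (x : G) := exists n, x = h ^+ n \/ x = h ^- n.

Local Notation K := axis_stab.
Local Notation K' := axis_stab_or_flip.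

Lemma powersM x y : powers x -> powers y -> powers (x * y).
Proof.
move=> [m [->|->]] [n [->|->]].
- by exists (m + n); left; rewrite expgnDr.
- case: (leqP n m) => [nm|/ltnW mn].
    by exists (m - n); left; rewrite expgnFr.
  by exists (n - m); right; rewrite expgnFr // invgF.
- case: (leqP m n) => [mn|/ltnW nm].
    exists (n - m); left; rewrite expgnFr // .
    by apply: (mulgI (h ^+ m)); rewrite mulVKg mulgA -expgnDr addnC expgnDr mulgK.
  exists (m - n); right; rewrite expgnFr // invgF.
  by apply: (mulgI (h ^+ m)); rewrite mulVKg mulgA -expgnDr addnC expgnDr mulgK.
- by exists (n + m); right; rewrite expgnDr invgM.
Qed.

Lemma powersV x : powers x -> powers x^-1.
Proof.
by move=> [m [->|->]]; exists m; [right|left; rewrite invgK].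
Qed.

Lemma powers_commute x y : powers x -> powers y -> x * y = y * x.
Proof.
have cV (a b : G) : commute a b -> commute a^-1 b.
  by move=> /commute_sym /commuteV /commute_sym.
have c m n : commute (h ^+ m) (h ^+ n) by apply: commuteX2.
by move=> [m [->|->]] [n [->|->]]; rewrite -/(commute _ _); do ?[exact: c
  | apply: commuteV | apply: cV].
Qed.

Lemma axis_stab1 : K 1.
Proof. by exists 1%N; rewrite // mul1g mulg1. Qed.

Lemma axis_stab_exp f m n : f * h ^+ n = h ^+ n * f ->
  f * h ^+ (n * m) = h ^+ (n * m) * f.
Proof. by rewrite expgnA => E; exact: conj_expg. Qed.

Lemma axis_stabM x y : K x -> K y -> K (x * y).
Proof.
move=> [m m0 xm] [n n0 yn]; exists (m * n)%N; first by rewrite muln_gt0 m0.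
rewrite mulgA -[x * y * _]mulgA [in y * _]mulnC (axis_stab_exp _ yn) mulgA.
by rewrite mulnC (axis_stab_exp _ xm).
Qed.

Lemma axis_stabV x : K x -> K x^-1.
Proof.
move=> [m m0 xm]; exists m => //.
by apply: (mulgI x); rewrite mulVKg !mulgA xm mulgK.
Qed.

Lemma powers_axis_stab x : powers x -> K x.
Proof.
move=> px; exists 1%N => //; apply: powers_commute => //.
by exists 1%N; left.
Qed.

Lemma axis_stab_conj_powers f n : K (f ^ h ^+ n) -> K f.
Proof.
have pn : K (h ^+ n) by apply: powers_axis_stab; exists n; left.
move=> Kf; have -> : f = h ^+ n * (f ^ h ^+ n * (h ^+ n)^-1).
  by rewrite conjgE !gnorm.
by apply: axis_stabM => //; apply: axis_stabM => //; exact: axis_stabV.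
Qed.

Lemma axis_stab_conj_flip f s : K' s -> K (f ^ s) -> K f.
Proof.
move=> [n n0 sn] [k k0]; rewrite conjgE => fk.
have Hk : f * (s * h ^+ k * s^-1) = (s * h ^+ k * s^-1) * f.
  move: (congr1 (fun x => s * x * s^-1) fk) => /=.
  by rewrite !gnorm.
have Hc m : f * (s * h ^+ (k * m) * s^-1) = (s * h ^+ (k * m) * s^-1) * f.
  have -> : s * h ^+ (k * m) * s^-1 = (s * h ^+ k * s^-1) ^+ m.
    have E := @conj_expg s (h ^+ k) (s * h ^+ k * s^-1) m.
    by rewrite expgnA E ?mulgK // mulgVK.
  exact: conj_expg.
exists (k * n)%N; first by rewrite muln_gt0 k0.
move: (Hc n); case: sn => sn.
  have := conj_expg k sn; rewrite -!expgnA [(n * k)%N]mulnC => ->.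
  by rewrite mulgK.
have := conj_expg k sn; rewrite expVgn -!expgnA [(n * k)%N]mulnC => ->.
rewrite mulgK => E; apply: (mulIg (h ^- (k * n))); rewrite mulgK -mulgA E.
by rewrite mulgA mulgV mul1g.
Qed.

Definition axis_core : set G := [set f | forall t, K (f ^ t)].

Lemma axis_core_closed : group_closed (fun x => x \in axis_core).
Proof.
split; first by apply/mem_set => t; rewrite conj1g; exact: axis_stab1.
move=> x y /set_mem Ex /set_mem Ey; apply/mem_set => t.
by rewrite conjMg conjVg; apply: axis_stabM => //; exact: axis_stabV.
Qed.

(** The contribution of geometry to this section: conjugation preserves translation lengths, and the
    stabilizer of the axis consists of finitely many cosets of the powers of [h]. *)
Hypothesis conj_pow : forall (s : G) k l, 0 < k -> 0 < l ->
  s * h ^+ k = h ^+ l * s \/ s * h ^+ k = h ^- l * s -> k = l.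
Hypothesis h_inf : forall k, 0 < k -> h ^+ k <> 1.
Variable (P : set G).
Hypothesis finP : finite_set P.
Hypothesis KP : forall f, K f -> exists c p, [/\ powers c, P p & f = c * p].

Lemma powers_torsion x q : powers x -> 0 < q -> x ^+ q = 1 -> x = 1.
Proof.
move=> [n [->|->]] q0; case: n => [|n] //; rewrite ?invg1 // => E.
  by case: (h_inf (k := (n.+1 * q)%N)); rewrite ?muln_gt0 ?q0 // expgnA.
case: (h_inf (k := (n.+1 * q)%N)); rewrite ?muln_gt0 ?q0 // expgnA.
by apply: invg_inj; rewrite -expVgn E invg1.
Qed.

Lemma axis_stab_exponent : exists2 n, 0 < n &
  forall f, K f -> f * h ^+ n = h ^+ n * f.
Proof.
have /finite_seqP [s Ps] := finP.
have [n n0 Hn] : exists2 n, 0 < n &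
    forall p, p \in s -> K p -> p * h ^+ n = h ^+ n * p.
  elim: s {Ps} => [|a s [n n0 IH]]; first by exists 1%N.
  have [[m m0 am]|nKa] := pselect (K a).
    exists (m * n)%N; first by rewrite muln_gt0 m0.
    move=> p; rewrite inE => /predU1P [-> _|ps Kp]; first exact: axis_stab_exp.
    by rewrite mulnC; apply/axis_stab_exp/IH.
  by exists n => // p; rewrite inE => /predU1P [->|]; [|exact: IH].
exists n => // f Kf; have [c [p [pc Pp E]]] := KP Kf.
have Kp : K p.
  have -> : p = c^-1 * f by rewrite E mulKg.
  by apply: axis_stabM => //; apply/axis_stabV/powers_axis_stab.
have hp : p * h ^+ n = h ^+ n * p by apply: Hn => //; move: Pp; rewrite Ps.
rewrite E -mulgA hp !mulgA; congr (_ * _).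
by apply: powers_commute => //; exists n; left.
Qed.

Definition axis_torsion : set G := [set f | K f /\ exists2 q, 0 < q & f ^+ q = 1].

(** For a common exponent [n], the powers of [h ^+ n] commute with all of [K] and leave finitely
    many cosets. Two torsion elements of one coset differ by a power of [h] that commutes with them,
    hence is torsion, hence trivial: each coset holds at most one. *)
Lemma finite_axis_torsion : finite_set axis_torsion.
Proof.
have [n n0 Hn] := axis_stab_exponent.
pose S x := [set f : G | axis_torsion f /\
  exists k, f = h ^+ (n * k) * x \/ f = h ^- (n * k) * x]%classic.
pose X := [set a * p | a in (fun r => h ^+ r) @` `I_n `|` (fun r => h ^- r) @` `I_n
                     & p in P]%classic.
have finX : finite_set X.
  apply: finite_image2 => //; rewrite finite_setU; split; apply: finite_image;
  exact: finite_II.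
apply: (@sub_finite_set _ _ (\bigcup_(x in X) S x)%classic); last first.
  apply: bigcup_finite => // x _.
  have key f f' : S x f -> S x f' -> f = f'.
    move=> [[Kf [q q0 fq]] fx] [[_ [q' q0' fq']] fx'].
    have [z [pz zc E]] : exists z, [/\ powers z, z * f = f * z & f' = z * f].
      have com k g : K g -> h ^+ (n * k) * g = g * h ^+ (n * k).
        by move=> Kg; apply/esym/axis_stab_exp/Hn.
      have comV k g : K g -> h ^- (n * k) * g = g * h ^- (n * k).
        move=> Kg; apply: (mulgI (h ^+ (n * k))); rewrite mulVKg mulgA com //.
        by rewrite mulgK.
      have gen a b : powers a -> powers b -> (a * f = f * a) -> (b * f = f * b) ->
          f = a * x -> f' = b * x ->
          exists z, [/\ powers z, z * f = f * z & f' = z * f].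
        move=> pa pb ca cb E E'; exists (b * a^-1); split.
        - by apply: powersM => //; exact: powersV.
        - rewrite -mulgA [RHS]mulgA -cb -!mulgA; congr (_ * _).
          by apply: (mulgI a); rewrite mulVKg mulgA ca mulgK.
        - by rewrite E E' !gnorm.
      have ph k : powers (h ^+ k) by exists k; left.
      have phV k : powers (h ^- k) by exists k; right.
      case: fx => k Ek; case: fx' => k' Ek'.
      by case: Ek => Ek; case: Ek' => Ek'; apply: (gen _ _ _ _ _ _ Ek Ek');
         rewrite ?com ?comV.
    have : z = 1.
      apply: (@powers_torsion _ (q * q')) => //; first by rewrite muln_gt0 q0.
      have : f' ^+ (q * q') = 1 by rewrite mulnC expgnA fq' expg1n.
      rewrite E expgMn //.
      by rewrite [f ^+ (q * q')]expgnA fq expg1n mulg1.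
    by move=> z1; rewrite E z1 mul1g.
  have [[f0 Sf0]|no] := pselect (exists f, S x f).
    by apply: (sub_finite_set _ (finite_set1 f0)) => f Sf; exact: key.
  by apply: (sub_finite_set _ (finite_set0 _)) => f Sf; apply: no; exists f.
move=> f [Kf tf]; have [c [p [[k kc] Pp E]]] := KP Kf.
have kE := divn_eq k n; rewrite mulnC in kE.
case: kc => kc.
- exists (h ^+ (k %% n) * p).
    exists (h ^+ (k %% n)); last by exists p.
    by left; exists (k %% n) => //=; rewrite ltn_mod.
  by split=> //; exists (k %/ n); left; rewrite mulgA -expgnDr -kE -kc.
- exists (h ^- (k %% n) * p).
    exists (h ^- (k %% n)); last by exists p.
    by right; exists (k %% n) => //=; rewrite ltn_mod.
  split=> //; exists (k %/ n); right.
  by rewrite mulgA -invgM -expgnDr addnC -kE -kc.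
Qed.

Lemma axis_stab_power f : K f -> ~ (exists2 q, 0 < q & f ^+ q = 1) ->
  exists2 q, 0 < q & exists2 c, 0 < c & f ^+ q = h ^+ c \/ f ^+ q = h ^- c.
Proof.
move=> Kf nt.
have KX j : K (f ^+ j).
  by elim: j => [|j IH]; [exact: axis_stab1|rewrite expgS; exact: axis_stabM].
have [|i [j [p [ij [c pc ci] [c' pc' cj]]]]] :=
    @cofinal_pigeonhole G P (fun j p => exists2 c, powers c & f ^+ j = c * p) finP.
  move=> n0; exists n0 => //; have [c [p [pc Pp E]]] := KP (KX n0).
  by exists p => //; exists c.
have E : f ^+ (j - i) = c' * c^-1.
  apply: (mulIg (f ^+ i)); rewrite -expgnDr subnK ?(ltnW ij) // cj ci.
  by rewrite -mulgA mulKg.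
have [[|k] Hk] : powers (f ^+ (j - i)).
- by rewrite E; apply: powersM => //; exact: powersV.
- case: nt; exists (j - i); first by rewrite subn_gt0.
  by case: Hk => ->; rewrite expg0 // invg1.
by exists (j - i); [rewrite subn_gt0|exists k.+1].
Qed.

(* Two infinite-order elements of [K] with conjugate powers are conjugate into
   the same axis. *)
Lemma conj_axis_stab f u : K f -> K (f ^ u) -> ~ (exists2 q, 0 < q & f ^+ q = 1) ->
  K' u.
Proof.
move=> Kf Kfu nt.
have ntu : ~ (exists2 q, 0 < q & (f ^ u) ^+ q = 1).
  move=> [q q0 E]; apply: nt; exists q => //.
  by apply: (conjg_inj u); rewrite conjXg conj1g.
have [q q0 [c c0 Hc]] := axis_stab_power Kf nt.
have [q' q0' [c' c0' Hc']] := axis_stab_power Kfu ntu.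
have H1 : f ^+ (q * q') = h ^+ (c * q') \/ f ^+ (q * q') = h ^- (c * q').
  by rewrite !expgnA; case: Hc => ->; [left|right; rewrite expVgn].
have H2 : u * h ^+ (c' * q) = f ^+ (q * q') * u \/
    u * h ^- (c' * q) = f ^+ (q * q') * u.
  have E : u * (f ^ u) ^+ (q * q') = f ^+ (q * q') * u.
    by rewrite -conjXg conjgE !gnorm.
  have F : (f ^ u) ^+ (q * q') = (f ^ u) ^+ q' ^+ q by rewrite mulnC expgnA.
  by rewrite -E F; case: Hc' => ->; [left|right]; rewrite ?expVgn expgnA.
have inv k x : u * h ^- k = x * u -> u * h ^+ k = x^-1 * u.
  move=> E; apply: (mulgI x); rewrite mulVKg -[x](mulgK u) -E.
  by rewrite !gnorm.
have H3 : u * h ^+ (c' * q) = h ^+ (c * q') * u \/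
    u * h ^+ (c' * q) = h ^- (c * q') * u.
  case: H2 => [->|/inv ->]; case: H1 => ->; rewrite ?invgK; by [left|right].
have cq0 : 0 < c' * q by rewrite muln_gt0 c0'.
have E : (c' * q = c * q')%N by apply: (conj_pow cq0 _ H3); rewrite muln_gt0 c0.
by exists (c' * q)%N => //; move: H3; rewrite -E.
Qed.

(** Suppose infinitely many of these conjugates lie in [K]. If [f] is torsion, two of them coincide
    and a power of [h] commutes with [f]. If not, the element [w] carrying one to another is in
    [K']; as [w] is a power of [h] conjugated by [s], so is [s], and [f] falls back into [K]. *)
Lemma axis_stab_conj_eventually f s : ~ K f ->
  exists n1, forall n, n1 <= n -> ~ K (f ^ (h ^+ n * s)).
Proof.
move=> nKf; apply: contrapT => H.
have inf n0 : exists2 n, n0 <= n & K (f ^ (h ^+ n * s)).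
  apply: contrapT => H0; apply: H; exists n0 => n n0n Rn.
  by apply: H0; exists n.
have [[q q0 fq]|nt] := pselect (exists2 q, 0 < q & f ^+ q = 1).
  have [|i [j [x [ij Ei Ej]]]] := @cofinal_pigeonhole G axis_torsion
      (fun n x => x = f ^ (h ^+ n * s)) finite_axis_torsion.
    move=> n0; have [n n0n Kn] := inf n0; exists n => //; eexists; last by [].
    by split=> //; exists q => //; rewrite -conjXg fq conj1g.
  apply: nKf; exists (j - i); first by rewrite subn_gt0.
  move: Ej; rewrite Ei !conjgM => /conjg_inj.
  rewrite -{1}(subnK (ltnW ij)) expgnDr conjgM => /conjg_inj.
  by move=> E; rewrite {2}E conjgE !gnorm.
have [n _ Kn] := inf 0; have [m nm Km] := inf n.+1.
set w := (h ^+ n * s)^-1 * (h ^+ m * s).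
have nt' : ~ (exists2 q, 0 < q & (f ^ (h ^+ n * s)) ^+ q = 1).
  move=> [q q0 E]; apply: nt; exists q => //.
  by apply: (conjg_inj (h ^+ n * s)); rewrite conjXg conj1g.
have K'w : K' w.
  by apply: (conj_axis_stab Kn) => //; rewrite -conjgM /w mulVKg.
have wE : w = h ^+ (m - n) ^ s.
  have E : h ^+ m = h ^+ n * h ^+ (m - n) by rewrite -expgnDr subnKC // ltnW.
  by rewrite /w E conjgE !gnorm.
clearbody w.
have Kw2 : K (w ^+ 2).
  have [a a0 Ha] := K'w; exists a => //; rewrite expg2 -mulgA.
  case: Ha => Ha; first by rewrite Ha !mulgA Ha.
  have HV : w * h ^- a = h ^+ a * w.
    by apply: (mulIg (h ^+ a)); rewrite mulgVK -mulgA Ha mulgA mulgV mul1g.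
  by rewrite Ha mulgA HV -mulgA.
have h2 : (h ^+ ((m - n) * 2)) ^ s = w ^+ 2 by rewrite expgnA conjXg wE.
have K's : K' s.
  apply: (@conj_axis_stab (h ^+ ((m - n) * 2))).
  - by apply: powers_axis_stab; exists ((m - n) * 2)%N; left.
  - by rewrite h2.
  - move=> [q q0 E]; case: (h_inf (k := ((m - n) * 2 * q)%N)); last by rewrite expgnA.
    by rewrite !muln_gt0 subn_gt0 nm.
apply: nKf; apply: (@axis_stab_conj_powers _ n).
by apply: (axis_stab_conj_flip K's); rewrite -conjgM.
Qed.

Lemma axis_core_finite s : ~ K' s -> finite_set axis_core.
Proof.
move=> nK's; apply: (sub_finite_set _ finite_axis_torsion) => f Ef.
have Kf : K f by rewrite -(conjg1 f).
split=> //; apply: contrapT => nt; apply: nK's.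
exact: (conj_axis_stab Kf (Ef s) nt).
Qed.

Lemma axis_core_max (M : set G) : finite_set M -> (forall g m, M m -> M (m ^ g)) ->
  M `<=` axis_core.
Proof.
move=> finM nM m Mm t; move: (nM t _ Mm); move: (m ^ t) => {m Mm} m Mm.
have [|i [j [x [ij Ei Ej]]]] := @cofinal_pigeonhole G M
    (fun n x => x = m ^ (h ^+ n)) finM.
  by move=> n; exists n => //; eexists; last by []; exact: nM.
exists (j - i); first by rewrite subn_gt0.
move: Ej; rewrite Ei -{1}(subnK (ltnW ij)) expgnDr conjgM => /conjg_inj.
by move=> E; rewrite {2}E conjgE !gnorm.
Qed.

(** To move a further [f ^ t] off [K] by some [s] without spoiling the others, conjugate by a power
    of [h] before [s]: a multiple of an exponent of [f ^ t] leaves [f ^ t] unchanged, and a large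
    one keeps all the others off [K]. *)
Lemma off_core_conj (F : seq G) : (forall f, f \in F -> ~ axis_core f) ->
  exists t, forall f, f \in F -> ~ K (f ^ t).
Proof.
elim: F => [|f F IH] H; first by exists 1.
have [|t Ht] := IH; first by move=> g gF; apply: H; rewrite inE gF orbT.
have [Kf|nKf] := pselect (K (f ^ t)); last first.
  by exists t => g; rewrite inE => /predU1P [->|/Ht].
have [s nKs] : exists s, ~ K ((f ^ t) ^ s).
  apply: contrapT => no; apply: (H f (mem_head _ _)) => u.
  apply: contrapT => nKu; apply: no; exists (t^-1 * u).
  by rewrite -conjgM mulVKg.
have [n n0 fn] := Kf.
have [n1 Hn1] : exists n1, forall g, g \in F -> forall n, n1 <= n ->
    ~ K ((g ^ t) ^ (h ^+ n * s)).
  apply: seq_uniform_bound => [x m m' mm' Hx k km|g gF].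
    by apply: Hx; exact: leq_trans km.
  exact/axis_stab_conj_eventually/Ht.
exists (t * (h ^+ (n * n1) * s)) => g; rewrite conjgM inE => /predU1P [->|gF].
  rewrite conjgM; suff -> : (f ^ t) ^ h ^+ (n * n1) = f ^ t by [].
  by rewrite [LHS]conjgE (axis_stab_exp _ fn) mulKg.
by apply: Hn1 => //; apply: leq_pmull.
Qed.

End AxisAlgebra.

(** * Powers' condition for groups with a weakly properly discontinuous element *)

(* Powers' condition relative to [E]: writing [C] for the complement of [D],
   [f * C] misses [C] for [f] in [F], and [n] translates of [D] are disjoint. *)
Definition powers_off (G : groupType) (E : set G) :=
  forall (F : seq G) (n : nat), (forall f, f \in F -> ~ E f) ->
  exists (D : set G) (g : nat -> G),
    (forall f, f \in F -> forall x, ~ D x -> D (f * x)%g) /\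
    (forall i j, i < n -> j < n -> i <> j ->
       forall x y, D x -> D y -> (g i * x)%g <> (g j * y)%g).

Section AxisGeometry.
Local Open Scope classical_set_scope.
Local Open Scope group_scope.
#[local] Bind Scope group_scope with Group.sort.
Variables (G : groupType) (len : G -> nat) (lenP : is_length len).
Variables (delta : nat) (hyp : four_point len delta).
Local Notation d := (dist len).

Section OneAxis.
Variables (h : G) (B : nat) (hB : growing len B h).

(** Conjugation by [s] changes lengths by at most [2 * len s], whereas for [k <> l] the lengths of
    [h ^+ (k * n)] and [h ^+ (l * n)] differ by at least [n]; take [n] to be [(2 * len s).+1]. *)
Lemma growing_conj_pow (s : G) k l : 0 < k -> 0 < l ->
  s * h ^+ k = h ^+ l * s \/ s * h ^+ k = h ^- l * s -> k = l.
Proof.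
move=> k0 l0 H.
have key (x y : G) : s * x = y * s ->
    len x <= len y + 2 * len s /\ len y <= len x + 2 * len s.
  move=> E; have -> : y = s * x * s^-1 by rewrite E mulgK.
  split; last first.
    have := lenM lenP (s * x) s^-1; have := lenM lenP s x.
    by rewrite (lenV lenP); glia G.
  have -> : x = s^-1 * (s * x * s^-1 * s) by rewrite !gnorm.
  move: (s * x * s^-1) => z.
  have := lenM lenP s^-1 (z * s); have := lenM lenP z s.
  by rewrite (lenV lenP) !gnorm; glia G.
have H' n : len (h ^+ (k * n)) <= len (h ^+ (l * n)) + 2 * len s /\
    len (h ^+ (l * n)) <= len (h ^+ (k * n)) + 2 * len s.
  rewrite !expgnA; case: H => /(conj_expg n) /key //.
  by rewrite expVgn (lenV lenP).
have [H1 H2] := H' (2 * len s).+1.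
have mono m n c : m < n -> len (h ^+ (m * c)) + c <= len (h ^+ (n * c)).
  move=> mn; have := @len_grow G len h B hB (m * c) (n * c).
  have : m.+1 * c <= n * c by rewrite leq_mul2r mn orbT.
  by rewrite mulSn => E1 /(_ _); rewrite leq_mul2r (ltnW mn) orbT => /(_ isT); lia.
case: (ltngtP k l) => // lt; have := mono _ _ (2 * len s).+1 lt; lia.
Qed.

Lemma growing_inf k : 0 < k -> h ^+ k <> 1.
Proof.
move=> k0 E; have := len_grow0 lenP hB k; rewrite E (len1 lenP); lia.
Qed.

Lemma axis_stab_unbounded f : axis_stab h f -> unbounded len h f.
Proof.
move=> [n n0 E] T; exists (n * (T + 2 * len f))%N.
rewrite (axis_stab_exp _ E) dist_mulr.
have := leq_pmull (T + 2 * len f) n0.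
have := len_grow0 lenP hB (n * (T + 2 * len f)).
move: (n * _)%N => N.
have := lenM lenP (h ^+ N * f) f^-1; rewrite mulgK (lenV lenP); glia G.
Qed.

Hypothesis W : wpd len h.

(** Finitely many values of [h ^- i * f * h ^+ j] for infinitely many [j] make [f] conjugate a
    positive power of [h] to a power of [h]. The exponents agree up to sign, and the sign is
    positive because [f] fixes the end. *)
Lemma unbounded_axis_stab f : unbounded len h f -> axis_stab h f.
Proof.
move=> uf; have [P finP HP] := wpd_finite lenP hyp hB W.
set J := (2 * len f + B + delta).+1.
have [|j [j' [x [jj' [i Ei] [i' Ei']]]]] := @cofinal_pigeonhole G P
    (fun j x => exists i, x = h ^- i * f * h ^+ j) finP.
  move=> n0; exists (n0 + J); first by rewrite leq_addr.
  have [|i Pi] := HP f (n0 + J) uf; first by rewrite /J; lia.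
  by eexists; [exact: Pi|exists i].
have E : f * h ^+ (j' - j) = h ^+ i' * (h ^- i * f).
  apply: (mulIg (h ^+ j)); rewrite -!mulgA -expgnDr subnK ?(ltnW jj') //.
  apply: (mulgI (h ^- i')); rewrite !mulgA -Ei' Ei.
  by rewrite !gnorm.
have m0 : 0 < j' - j by rewrite subn_gt0.
case: (ltngtP i i') => ii'.
- have E' : f * h ^+ (j' - j) = h ^+ (i' - i) * f.
    by rewrite E mulgA expgnFr ?(ltnW ii').
  exists (j' - j) => //; rewrite {2}(@growing_conj_pow f _ (i' - i) m0) ?subn_gt0 //.
  by left.
- have E' : f * h ^+ (j' - j) = h ^- (i - i') * f.
    by rewrite E mulgA expgnFr ?(ltnW ii') // invgF.
  have km : j' - j = i - i'.
    by apply: (@growing_conj_pow f) => //; [rewrite subn_gt0|right].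
  rewrite -{}km in E'.
  move: (j' - j) m0 E' => m m0 Em.
  (* A flip would put [f * h ^+ (m * M)] near [h ^- (m * M)], while fellow travelling puts it near a
     nonnegative power; this [M] makes the two too far apart. *)
  pose M := J + 2 * len f + len h + B + 3 * delta.
  have EM := @conj_expg _ f (h ^+ m) (h ^- m) M Em.
  rewrite expVgn -!expgnA in EM.
  have mM : M <= m * M by rewrite leq_pmull.
  have [|u [_ _]] := fellow_travel lenP hyp hB (j := m * M) uf.
    by rewrite /M /J in mM *; lia.
  rewrite EM /dist => du.
  have := len_grow0 lenP hB (u + m * M).
  have -> : h ^+ (u + m * M) = ((h ^+ u)^-1 * (h ^- (m * M) * f) * f^-1)^-1.
    by rewrite addnC expgnDr !gnorm.
  have := lenM lenP ((h ^+ u)^-1 * (h ^- (m * M) * f)) f^-1.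
  have : 2 * len f + len h + B + 3 * delta < M by rewrite /M /J; lia.
  move: (m * M)%N mM du => k; rewrite !(lenV lenP) => mM du *; exfalso; glia G.
- rewrite ii' mulVKg in E.
  case: (growing_inf m0); apply: (mulgI f); rewrite E mulg1 //.
Qed.

Lemma axis_stab_cosets : exists2 P : set G, finite_set P &
  forall f, axis_stab h f -> exists c p, [/\ powers h c, P p & f = c * p].
Proof.
have [P finP HP] := wpd_finite lenP hyp hB W.
exists P => // f Kf; have [n n0 E] := Kf.
set J := (2 * len f + B + delta).+1.
have [|i Pi] := HP f (n * J)%N (axis_stab_unbounded Kf).
  by have : J <= n * J by [rewrite leq_pmull]; rewrite /J; lia.
exists (h ^- (n * J) * h ^+ i), (h ^- i * f * h ^+ (n * J)); split=> //.
  by apply: powersM; [exists (n * J)%N; right|exists i; left].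
by rewrite -[h ^- i * f * _]mulgA (axis_stab_exp _ E) !gnorm.
Qed.

Lemma bounded_product f : ~ axis_stab h f -> exists T, forall N,
  len (h ^+ N) + len (f * h ^+ N) < d (h ^+ N) (f * h ^+ N) + T.
Proof.
move=> nK; apply: contrapT => H; apply/nK/unbounded_axis_stab => T.
apply: contrapT => H'; apply: H; exists T => N.
by rewrite ltnNge; apply/negP => le; apply: H'; exists N.
Qed.

End OneAxis.

Variables (h : G) (B : nat) (hB : growing len B h) (W : wpd len h).

Lemma growingV : growing len B h^-1.
Proof.
by have [h1 h2] := hB; split=> [n|m n]; rewrite !expVgn !(lenV lenP).
Qed.

Lemma axis_stab_inv f : axis_stab h^-1 f -> axis_stab h f.
Proof.
move=> [n n0]; rewrite !expVgn => E; exists n => //.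
apply: (mulgI (h ^- n)); rewrite mulgA -E mulgVK mulKg //.
Qed.

Lemma wpdV : wpd len h^-1.
Proof.
move=> eps M0; have [M M0M [P finP HP]] := W eps M0; exists M => //.
exists [set h ^- M * p * h ^+ M | p in P]; first exact: finite_image.
move=> p p1 p2; exists (h ^+ M * p * h ^- M); last by rewrite !gnorm.
apply: HP; move: p1 p2; rewrite /dist !expVgn invgK !gnorm //.
Qed.

Hypothesis nonel : ~ elementary G.

Lemma powers_closed : group_closed (fun x => x \in [set x | powers h x]).
Proof.
split; first by apply/mem_set; exists 0%N; left.
move=> x y /set_mem px /set_mem py; apply/mem_set.
by apply: powersM => //; exact: powersV.
Qed.

(** If finitely many cosets of the stabilizer covered [G], finitely many cosets of the powers of [h]
    would too, and [G] would be elementary. *)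
Lemma axis_stab_infinite_index (s : seq G) :
  exists t, forall u, u \in s -> ~ axis_stab h (u^-1 * t).
Proof.
apply: contrapT => H; apply: nonel; exists (Subgroup powers_closed).
  exists h; apply/seteqP; split => [x [n pn] S hS|x].
    have /set_mem S1 : (1 : G) \in sg_set S by apply/mem_set; exact: sg1.
    have Sh : forall m, sg_set S (h ^+ m).
      elim=> [|m IH] //; rewrite expgS; apply: sgM => //.
      by apply: hS.
    by case: pn => ->; [|apply: sgV].
  by move=> /(_ (Subgroup powers_closed)); apply=> /= y ->; exists 1%N; left.
have [P finP HP] := axis_stab_cosets hB W.
rewrite /finite_index /=.
pose X := [set u * p | u in [set` s] & p in [set p^-1 | p in P]].
have finX : finite_set X.
  by apply: finite_image2; [exact: finite_seq|exact: finite_image].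
apply: sub_finite_set (finite_image
  (fun x => [set x * c | c in [set x | powers h x]]) finX) => _ [g _ <-].
have [u us Ku] : exists2 u, u \in s & axis_stab h (u^-1 * g).
  apply: contrapT => H'; apply: H; exists g => u us Ku.
  by apply: H'; exists u.
have [c [p [pc Pp E]]] := HP _ (axis_stabV Ku).
exists (u * p^-1).
  exists u => //; exists p^-1 => //; by exists p.
have gE : g = u * p^-1 * c^-1.
  rewrite -mulgA -invgM -E !gnorm //.
apply/seteqP; split=> [_ [k pk <-]|_ [k pk <-]] /=.
  exists (c * k); first exact: powersM.
  by rewrite gE !gnorm.
exists (c^-1 * k); first by apply: powersM => //; exact: powersV.
by rewrite gE !gnorm.
Qed.

(** If every element preserved or flipped the axis, the stabilizer would have index at most two,
    since [s^-1 * t] preserves it whenever [s] and [t] both flip it. *)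
Lemma axis_stab_not_all : exists s, ~ axis_stab_or_flip h s.
Proof.
apply: contrapT => H.
have H' s : axis_stab_or_flip h s by apply: contrapT => Hs; apply: H; exists s.
have [s0 Hs0] := axis_stab_infinite_index [:: 1].
have {}Hs0 : ~ axis_stab h s0.
  by have := Hs0 1; rewrite inE eqxx invg1 mul1g; apply.
have [t Ht] := axis_stab_infinite_index [:: 1; s0].
have nt : ~ axis_stab h t by have := Ht 1; rewrite inE eqxx invg1 mul1g; apply.
have nst : ~ axis_stab h (s0^-1 * t) by apply: Ht; rewrite !inE eqxx orbT.
have flip s : ~ axis_stab h s ->
    exists2 n, 0 < n & s * h ^+ n = h ^- n * s.
  move=> ns; have [n n0 [E|E]] := H' s; last by exists n.
  by case: ns; exists n.
have [m m0 Em] := flip _ Hs0; have [n n0 En] := flip _ nt.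
apply: nst; exists (m * n)%N; first by rewrite muln_gt0 m0.
have Em' := conj_expg n Em; have En' := conj_expg m En.
rewrite !expVgn -!expgnA in Em' En'; rewrite mulnC in En'.
apply: (mulgI s0); rewrite -[s0^-1 * t * _]mulgA mulVKg En'.
by rewrite [RHS]mulgA Em' -[RHS]mulgA mulVKg.
Qed.

(** The complement of [D0] is the shadow of [h ^+ M] seen from [1]. If [y] and [f ^ t * y] were both
    in it, [h ^+ M] and [f ^ t * h ^+ M] would have a large Gromov product. In turn [h ^- M] sends
    [D0] into the shadow of [h ^- M], around the other end of the axis, and the elements [ts] of
    distinct cosets of the stabilizer make these shadows disjoint. *)
Lemma core_off_powers : powers_off (axis_core h).
Proof.
move=> F n HF.
have [P finP HP] := axis_stab_cosets hB W.
have [t Ht] := off_core_conj (@growing_conj_pow _ _ hB) (@growing_inf _ _ hB)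
  finP HP HF.
have [ts tsn Hts] : exists2 ts : seq G, size ts = n &
    forall i j, i < j < n -> ~ axis_stab h ((nth 1 ts i)^-1 * nth 1 ts j).
  elim: n => [|n [ts tsn IH]]; first by exists [::] => // i j; lia.
  have [u Hu] := axis_stab_infinite_index ts.
  exists (rcons ts u); first by rewrite size_rcons tsn.
  move=> i j /andP[ij jn]; rewrite !nth_rcons tsn.
  have -> : i < n by lia.
  case: (ltnP j n) => jn'; first by apply: IH; rewrite ij.
  have -> : j == n by lia.
  by apply/Hu/mem_nth; rewrite tsn; lia.
pose L := (\sum_(f <- [seq (f ^ t)%g | f <- F]) len f + \sum_(u <- ts) len u)%N.
have sumL (s : seq G) u : u \in s -> len u <= \sum_(v <- s) len v.
  elim: s => // a s IH; rewrite inE big_cons => /predU1P [->|/IH]; glia G.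
have [T HT] : exists T, forall f, f \in F -> forall N,
    len (h ^+ N) + len (f ^ t * h ^+ N) < d (h ^+ N) (f ^ t * h ^+ N) + T.
  apply: seq_uniform_bound => [f m m' mm' H N|f fF]; first by have := H N; lia.
  exact: (bounded_product hB W (Ht _ fF)).
have [T' HT'] : exists T', forall p, p \in [seq (i, j) | i <- iota 0 n, j <- iota 0 n] ->
    p.1 < p.2 -> forall N,
    let u := (nth 1 ts p.1)^-1 * nth 1 ts p.2 in
    len (h ^- N) + len (u * h ^- N) < d (h ^- N) (u * h ^- N) + T'.
  apply: seq_uniform_bound => [p m m' mm' H pp N|p].
    by have := H pp N => /=; lia.
  move=> /allpairsP [[i j] /= [ii jn ->]] /=.
  rewrite !mem_iota /= !add0n in ii jn.
  case: (ltnP i j) => ij; last by exists 0%N.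
  have [|T1 HT1] := bounded_product growingV wpdV (f := (nth 1 ts i)^-1 * nth 1 ts j).
    by move=> /axis_stab_inv; apply: Hts; rewrite ij.
  by exists T1 => _ N; have := HT1 N; rewrite expVgn.
(* Moving the base point of a Gromov product by an element of length at most [L] changes its double
   by at most [2 * L]: this happens once for [f ^ t] in [kap], and for two elements of [ts] in
   [M]. *)
pose kap := T + 2 * L + delta.
pose M := kap + 4 * L + delta + T' + 1.
pose D0 := [set x | len x + len (h ^+ M) < d x (h ^+ M) + kap].
exists [set x | D0 (t^-1 * x)], (fun i => nth 1 ts i * h ^- M * t^-1); split.
  move=> f fF x /= nDx; apply: contrapT => nDfx.
  have := HT f fF M.
  move: nDx nDfx; rewrite /D0 /=.
  have -> : t^-1 * (f * x) = f ^ t * (t^-1 * x) by rewrite conjgE !gnorm.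
  have : len (f ^ t) <= L.
    apply: leq_trans (leq_addr _ _).
    by apply: sumL; apply/mapP; exists f.
  move: (f ^ t) (t^-1 * x) => g y gL /negP; rewrite -leqNgt => ny.
  move=> /negP; rewrite -leqNgt => ngy lt.
  have := hyp (h ^+ M) (g * y) (g * h ^+ M) 1.
  rewrite dist_mul // (dist_sym lenP (h ^+ M) 1) (dist_sym lenP (g * h ^+ M) 1).
  rewrite (dist_sym lenP (g * y) 1) !dist1 (dist_sym lenP (h ^+ M) (g * y)).
  have := lenM lenP g^-1 (g * y); rewrite mulKg (lenV lenP).
  have := lenM lenP g^-1 (g * h ^+ M); rewrite mulKg (lenV lenP).
  have := lenM lenP g (h ^+ M).
  have := lenM lenP g y.
  move: lt ny ngy; rewrite /kap; glia G.
move=> i j; wlog ij : i j / i < j.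
  move=> IH il jl ne x y Dx Dy E.
  case: (ltngtP i j) => [lt|lt|//]; first exact: (IH i j lt il jl ne x y).
  exact: (IH j i lt jl il (nesym ne) y x Dy Dx (esym E)).
move=> il jl _ x y; rewrite /= -!mulgA.
move: (t^-1 * x) (t^-1 * y) => {}x {}y Dx Dy E.
have mem : (i, j) \in [seq (i, j) | i <- iota 0 n, j <- iota 0 n].
  by apply/allpairsP; exists (i, j); rewrite !mem_iota !add0n il jl.
have := HT' (i, j) mem ij M => /=.
move: E.
have : len (nth 1 ts i) <= L by apply: leq_trans (leq_addl _ _); apply/sumL/mem_nth; rewrite tsn.
have : len (nth 1 ts j) <= L by apply: leq_trans (leq_addl _ _); apply/sumL/mem_nth; rewrite tsn.
move: (nth 1 ts i) (nth 1 ts j) => a b bL aL E.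
have lVM : len (h ^- M) = len (h ^+ M) by rewrite (lenV lenP).
have := len_grow0 lenP hB M; rewrite -lVM.
have HX z : d z (h ^+ M) = len (h ^- M * z) by rewrite (dist_sym lenP).
have HV z : len z = d (h ^- M) (h ^- M * z) by rewrite dist_mulr.
move: Dx Dy; rewrite /D0 /= !HX (HV x) (HV y) -lVM.
have -> : d (h ^- M) (a^-1 * b * h ^- M) = d (a * h ^- M) (b * h ^- M).
  by rewrite -(dist_mul len a) !gnorm.
have := hyp (a * h ^- M) (a * (h ^- M * x)) (b * h ^- M) 1.
move: E; move: (h ^- M) (h ^- M * x) (h ^- M * y) => V X Y E.
rewrite (dist_sym lenP _ 1) (dist_sym lenP (a * V) 1) (dist_sym lenP (b * V) 1).
rewrite {1}E {2}E (dist_sym lenP (b * Y)) !dist_mul !dist1.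
have := lenM lenP a^-1 (a * X); rewrite mulKg (lenV lenP).
have := lenM lenP b^-1 (b * Y); rewrite mulKg (lenV lenP) -E.
have := lenM lenP a V; have := lenM lenP b V.
move: bL aL; rewrite /M /kap; glia G.
Qed.

Lemma axis_max_finite_normal :
  exists E : subgroup G, max_finite_normal E /\ powers_off (sg_set E).
Proof.
exists (Subgroup (axis_core_closed h)); split; last exact: core_off_powers.
have [P finP HP] := axis_stab_cosets hB W.
have [s nKs] := axis_stab_not_all.
split=> /=.
- by move=> g n En t; rewrite -conjgM; exact: En.
- exact: (axis_core_finite (@growing_conj_pow _ _ hB) (@growing_inf _ _ hB)
    finP HP nKs).
- by move=> M nM finM; apply: axis_core_max => // g m; exact: nM.
Qed.

End AxisGeometry.

Import Order.TTheory GRing.Theory Num.Theory.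

(** * Word length and integration of cochains along words *)

Section WordLength.
Local Open Scope classical_set_scope.
Local Open Scope nat_scope.
#[local] Bind Scope group_scope with Group.sort.
Variables (G : groupType) (S : set G).
Hypothesis symS : forall x, S x -> S (x^-1)%g.
Hypothesis genS : generated S = setT.

(** The letter [1] is allowed, which makes the balls increase with [n]. *)
Fixpoint word_ball (n : nat) (x : G) : Prop :=
  if n is m.+1 then
    exists s y, [/\ s = 1%g \/ S s, word_ball m y & x = (s * y)%g]
  else x = 1%g.

Lemma word_ballM m n x y :
  word_ball m x -> word_ball n y -> word_ball (m + n) (x * y)%g.
Proof.
elim: m x => [|m IH] x /=; first by move=> -> ; rewrite mul1g.
by move=> [s [z [Ss Bz ->]]] By; exists s, (z * y)%g; rewrite mulgA; split=> //; exact: IH.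
Qed.

Lemma word_ball_letter s : s = 1%g \/ S s -> word_ball 1 s.
Proof. by move=> Ss; exists s, 1%g; rewrite mulg1. Qed.

Lemma word_ballV n x : word_ball n x -> word_ball n (x^-1)%g.
Proof.
elim: n x => [|n IH] x; first by move=> ->; rewrite /= invg1.
move=> [s [y [Ss By ->]]]; rewrite invgM -addn1.
apply: word_ballM; first exact: IH.
by apply: word_ball_letter; case: Ss => [->|/symS]; [left; rewrite invg1|right].
Qed.

Lemma word_ball_exists x : exists n, `[< word_ball n x >].
Proof.
have cl : group_closed (fun x => x \in [set x | exists n, word_ball n x]).
  split; first by apply/mem_set; exists 0.
  move=> u v /set_mem [m Bu] /set_mem [n Bv]; apply/mem_set; exists (m + n).
  by apply: word_ballM => //; exact: word_ballV.
have : generated S x by rewrite genS.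
move=> /(_ (Subgroup cl)) [|n Bx]; last by exists n; apply/asboolP.
by move=> s Ss /=; exists 1; apply: word_ball_letter; right.
Qed.

Definition word_len (x : G) : nat := ex_minn (word_ball_exists x).

Lemma word_len_le n x : word_ball n x -> word_len x <= n.
Proof. by move=> Bx; rewrite /word_len; case: ex_minnP => m _; apply; apply/asboolP. Qed.

Lemma word_lenP x : word_ball (word_len x) x.
Proof. by rewrite /word_len; case: ex_minnP => m /asboolP. Qed.

Lemma word_len_length : is_length word_len.
Proof.
have lV x : word_len (x^-1)%g <= word_len x.
  by apply/word_len_le/word_ballV/word_lenP.
split=> [|x|x y].
- by apply/eqP; rewrite -leqn0; apply: word_len_le.
- by apply/eqP; rewrite eqn_leq lV -{1}(invgK x) lV.
- by apply/word_len_le/word_ballM; exact: word_lenP.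
Qed.

Lemma word_len_le1 x : word_len x <= 1 -> x = 1%g \/ S x.
Proof.
have := word_lenP x; case: (word_len x) => [|[|//]] /=; first by left.
by move=> [s [y [Ss -> ->]]] _; rewrite mulg1.
Qed.

Lemma word_len_letter x : S x -> word_len x <= 1.
Proof. by move=> Sx; apply: word_len_le; apply: word_ball_letter; right. Qed.

Lemma word_len_eq0 x : word_len x = 0 -> x = 1%g.
Proof. by move=> E; have := word_lenP x; rewrite E. Qed.

Lemma word_len_first x n : word_len x = n.+1 ->
  exists s y, [/\ x = (s * y)%g, word_len s <= 1 & word_len y = n].
Proof.
move=> E; have := word_lenP x; rewrite E => -[s [y [Ss By xE]]].
have s1 := word_len_le (word_ball_letter Ss).
exists s, y; split=> //; apply/eqP; rewrite eqn_leq word_len_le //=.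
by have := lenM word_len_length s y; rewrite -xE E; lia.
Qed.

End WordLength.

Section PathSums.
Variables (R : realType) (T : Type).
Local Open Scope ring_scope.

Fixpoint path_sum (F : T -> T -> R) (x : T) (s : seq T) : R :=
  if s is y :: s' then F x y + path_sum F y s' else 0.

Lemma path_sum_cat F x s t :
  path_sum F x (s ++ t) = path_sum F x s + path_sum F (last x s) t.
Proof. by elim: s x => [|y s IH] x /=; rewrite ?add0r // IH addrA. Qed.

End PathSums.

(** * Integrals of cochains over relators and closed paths *)

Section Cochains.
Local Open Scope classical_set_scope.
Local Open Scope ring_scope.
#[local] Bind Scope group_scope with Group.sort.
Variables (R : realType) (G : groupType) (L : Type) (H : L -> subgroup G).
Variable X : set G.

Local Notation letter := (fp_letter (set_type X) (fun l => sgType (H l))).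
Local Notation gen := (FGen (fun l => sgType (H l))).
Local Notation per := (FPer (K := fun l => sgType (H l)) (set_type X)).

Definition letter_val (a : letter) : G :=
  fp_leval (fun x : set_type X => val x) (fun l (h : sgType (H l)) => val h) a.

Definition word_val (w : seq letter) : G :=
  fp_eval (fun x : set_type X => val x) (fun l (h : sgType (H l)) => val h) w.

Lemma word_val_cons a w : word_val (a :: w) = (letter_val a * word_val w)%g.
Proof. by rewrite /word_val /fp_eval big_cons. Qed.

Section OneCochain.
Variable phi : G -> letter -> R.

(** Closedness on the relations of the free product only, not on those of [G]: the integral along a
    word then depends on the element of [rel_free] that it represents. *)
Record is_cochain : Prop := IsCochain {
  cochain_cancel : forall x a b,
    phi x (gen a b) + phi (x * letter_val (gen a b)) (gen a (~~ b)) = 0;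
  cochain_one : forall x l, phi x (per (1%g : sgType (H l))) = 0;
  cochain_mul : forall x l (g h : sgType (H l)),
    phi x (per (g * h)%g) = phi x (per g) + phi (x * val g)%g (per h) }.

Hypothesis phiP : is_cochain.

Fixpoint word_int (x : G) (w : seq letter) : R :=
  if w is a :: w' then phi x a + word_int (x * letter_val a)%g w' else 0.

Lemma word_int_cat x u v :
  word_int x (u ++ v) = word_int x u + word_int (x * word_val u)%g v.
Proof.
elim: u x => [|a u IH] x /=.
  by rewrite add0r /word_val /fp_eval big_nil mulg1.
by rewrite IH word_val_cons addrA mulgA.
Qed.

Lemma word_val_eq u v : fp_eq u v -> word_val u = word_val v.
Proof. by apply: fp_eval_eq. Qed.

Lemma word_int_eq u v : fp_eq u v -> forall x, word_int x u = word_int x v.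
Proof.
elim=> {u v} //=.
- by move=> u v w _ IH1 _ IH2 x; rewrite IH1.
- move=> u u' v v' E1 IH1 E2 IH2 x.
  by rewrite !word_int_cat IH1 IH2 (word_val_eq E1).
- by move=> a b x; rewrite addr0 (cochain_cancel phiP).
- by move=> l x; rewrite addr0 (cochain_one phiP).
- by move=> l g h x; rewrite !addr0 (cochain_mul phiP).
Qed.

Local Notation F := (rel_free H X).

Definition free_int (x : G) (u : F) : R := word_int x (qrepr u).

Lemma free_int_pi x (w : seq letter) :
  free_int x (@qpi (free_product_pre _ _) w) = word_int x w.
Proof. by apply: word_int_eq; exact: (@qpiK (free_product_pre _ _)). Qed.

Lemma rel_nat_pi (w : seq letter) :
  rel_nat (@qpi (free_product_pre _ _) w : F) = word_val w.
Proof. exact: fp_lift_pi. Qed.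

Lemma free_intM x (u v : F) :
  free_int x (u * v)%g = free_int x u + free_int (x * rel_nat u)%g v.
Proof.
rewrite -(qreprK u) -(qreprK v) -qpiM !free_int_pi rel_nat_pi /=.
exact: word_int_cat.
Qed.

Lemma rel_nat1 : rel_nat (1%g : F) = 1%g.
Proof. by apply: (mulgI (rel_nat (1%g : F))); rewrite -rel_natM !mulg1. Qed.

Lemma rel_natV (u : F) : rel_nat u^-1%g = (rel_nat u)^-1%g.
Proof.
by apply: (mulgI (rel_nat u)); rewrite -rel_natM !mulgV rel_nat1.
Qed.

Lemma free_int1 x : free_int x (1%g : F) = 0.
Proof.
have := free_intM x 1%g 1%g; rewrite rel_nat1 !mulg1 => /eqP.
by rewrite -subr_eq subrr eq_sym => /eqP.
Qed.

Lemma free_intV x (u : F) :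
  free_int x u^-1%g = - free_int (x * (rel_nat u)^-1)%g u.
Proof.
have := free_intM x u^-1%g u; rewrite mulVg free_int1 rel_natV.
by move=> /esym/eqP; rewrite addr_eq0 => /eqP.
Qed.

(** The two passages along [u] cancel. As the base point moves, bounds on relators are required at
    all base points. *)
Lemma free_intJ x (u r : F) : rel_nat r = 1%g ->
  free_int x (r ^ u)%g = free_int (x * (rel_nat u)^-1)%g r.
Proof.
move=> r1; rewrite conjgE !free_intM free_intV rel_natV r1 mulg1.
by rewrite addrCA addNr addr0.
Qed.

Variables (rels : set F) (M : R).
Hypothesis relsP : rel_presentation rels.
Hypothesis relsM : forall r, rels r -> forall x, `|free_int x r| <= M.

Lemma relator_nat r : rels r -> rel_nat r = 1%g.
Proof.
move=> rr; have : normal_closure rels r by move=> N _; apply.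
by rewrite -relsP.
Qed.

Lemma free_int_relators (s : seq (F * F * bool)) :
  (forall t, t \in s -> rels t.1.2) -> forall x,
  let u := (\prod_(t <- s) ((if t.2 then t.1.2^-1 else t.1.2) ^ t.1.1))%g in
  rel_nat u = 1%g /\ `|free_int x u| <= M * (size s)%:R.
Proof.
elim: s => [|t s IH] Hs x /=.
  by rewrite big_nil rel_nat1 free_int1 normr0 mulr0.
have [|I1 I2] := IH _ x; first by move=> a as_; apply: Hs; rewrite inE as_ orbT.
have rt := Hs t (mem_head _ _); have nt := relator_nat rt.
rewrite big_cons; set r := (if t.2 then _ else _).
have nr : rel_nat r = 1%g.
  by rewrite /r; case: ifP => _ //; rewrite rel_natV nt invg1.
have nrc : rel_nat (r ^ t.1.1)%g = 1%g.
  by rewrite conjgE !rel_natM nr rel_natV mul1g mulVg.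
split; first by rewrite rel_natM nrc I1 mulg1.
rewrite free_intM nrc mulg1 free_intJ //.
apply: le_trans (ler_normD _ _) _.
rewrite -addn1 natrD mulrDr mulr1 addrC; apply: lerD => //.
rewrite /r; case: ifP => _; last exact: relsM.
by rewrite free_intV normrN; apply: relsM.
Qed.

Definition alphabet_letter (a : rel_alphabet H X) : letter :=
  match a with
  | inl x => gen x false
  | inr (existT l h) => per (proj1_sig h)
  end.

Lemma rel_word_pi (w : seq (rel_alphabet H X)) :
  rel_word w = @qpi (free_product_pre _ _) (map alphabet_letter w) :> F.
Proof.
elim: w => [|a w IH]; first by rewrite /rel_word big_nil.
rewrite /rel_word big_cons -/(rel_word w) IH /= -cat1s.
rewrite (@qpiM (free_product_pre _ _) [:: alphabet_letter a] _).
by case: a => [x|[l h]].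
Qed.

Variable C : R.
Hypothesis C0 : 0 <= C.
Hypothesis isoC : forall w : seq (rel_alphabet H X), rel_nat (rel_word w) = 1%g ->
  exists s : seq (F * F * bool),
    [/\ forall t, t \in s -> rels t.1.2,
        rel_word w = (\prod_(t <- s) ((if t.2 then t.1.2^-1 else t.1.2) ^ t.1.1))%g
      & (size s)%:R <= C * (size w)%:R].

Variable e : rel G.

Variable sel : G -> G -> option (rel_alphabet H X).
Hypothesis selP : forall u v, e u v ->
  if sel u v is Some a then letter_val (alphabet_letter a) = (u^-1 * v)%g
  else u = v.

Definition sel_cost (u v : G) : R :=
  if sel u v is Some a then phi u (alphabet_letter a) else 0.

Lemma closed_path_bound (M0 : 0 <= M) x (s : seq G) : path e x s -> last x s = x ->
  `|path_sum sel_cost x s| <= C * (size s)%:R * M.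
Proof.
move=> xs sx.
have [w [wn w1 w2]] : exists w : seq (rel_alphabet H X),
    [/\ (size w <= size s)%N,
        word_val (map alphabet_letter w) = (x^-1 * last x s)%g &
        word_int x (map alphabet_letter w) = path_sum sel_cost x s].
  elim: s x xs {sx} => [|y s IH] x /=.
    by exists [::]; rewrite mulVg /word_val /fp_eval big_nil.
  move=> /andP[xy /IH [w [wn w1 w2]]].
  have := selP xy; rewrite /sel_cost; case: (sel x y) => [a aE|->]; last first.
    by exists w; rewrite add0r; split=> //; exact: leqW.
  exists (a :: w); split=> //=; first by rewrite word_val_cons aE w1 !gnorm.
  by rewrite aE mulVKg w2.
have [|t [t1 t2 t3]] := isoC (w := w).
  by rewrite rel_word_pi rel_nat_pi w1 sx mulVg.
have [_] := free_int_relators t1 x.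
rewrite -t2 rel_word_pi free_int_pi w2 => /le_trans; apply.
rewrite mulrC; apply: ler_wpM2r => //; apply: (le_trans t3).
by apply: ler_wpM2l => //; rewrite ler_nat.
Qed.

End OneCochain.
End Cochains.

(** * Area inequality and isolated components *)

Section RelativePresentation.
Local Open Scope classical_set_scope.
Local Open Scope ring_scope.
#[local] Bind Scope group_scope with Group.sort.
Variables (R : realType) (G : groupType) (L : Type) (H : L -> subgroup G).
Variable X : set G.

Local Notation letter := (fp_letter (set_type X) (fun l => sgType (H l))).

Definition rel_letters : set G := X `|` \bigcup_(l in [set: L]) sg_set (H l).

Hypothesis symX : forall x, X x -> X x^-1%g.
Hypothesis genX : rel_generating H X.

Lemma rel_letters_sym x : rel_letters x -> rel_letters x^-1%g.
Proof.
by move=> [/symX|[l _ /sgV Hl]]; [left|right; exists l].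
Qed.

Definition rel_len : G -> nat := @word_len G rel_letters rel_letters_sym genX.
Local Notation d := (dist rel_len).
Local Notation e := (fun u v : G => (d u v <= 1)%N).

Let lenP : is_length rel_len := word_len_length rel_letters_sym genX.

Lemma rel_len_letter (a : letter) : (rel_len (letter_val a) <= 1)%N.
Proof.
case: a => [x b|l h]; apply: word_len_letter.
  have /set_mem Xx : val x \in X by exact: valP.
  by rewrite /letter_val /=; case: b; [left; exact: symX|left].
by right; exists l => //; exact: set_mem (sg_valP h).
Qed.

Lemma rel_len_per l (x : G) : sg_set (H l) x -> (rel_len x <= 1)%N.
Proof. by move=> Hx; apply: word_len_letter; right; exists l. Qed.

Lemma rel_len_word (w : seq letter) : (rel_len (word_val w) <= size w)%N.
Proof.
elim: w => [|a w IH]; first by rewrite /word_val /fp_eval big_nil (len1 lenP).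
rewrite word_val_cons /=.
have := lenM lenP (letter_val a) (word_val w); have := rel_len_letter a; lia.
Qed.

(** An element may be a letter of [X] and of several peripheral subgroups at once. A cochain that
    sees only one subgroup needs the edges inside its cosets to be read as letters of that
    subgroup. *)
Definition prefers (o : L -> Prop) (x : option (rel_alphabet H X)) : Prop :=
  match x with
  | None => True
  | Some (inl _) => False
  | Some (inr (existT l _)) => o l
  end.

Lemma exists_letter_choice (o : L -> Prop) :
  exists sel : G -> G -> option (rel_alphabet H X), forall u v, e u v ->
    (if sel u v is Some a then letter_val (alphabet_letter a) = (u^-1 * v)%g
     else u = v) /\
    ((exists2 l, o l & sg_set (H l) (u^-1 * v)%g) -> prefers o (sel u v)).
Proof.
have pick (p : G * G) : exists x : option (rel_alphabet H X), e p.1 p.2 ->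
    (if x is Some a then letter_val (alphabet_letter a) = (p.1^-1 * p.2)%g
     else p.1 = p.2) /\
    ((exists2 l, o l & sg_set (H l) (p.1^-1 * p.2)%g) -> prefers o x).
  case: p => u v /=.
  have [uv|nuv] := pselect (u = v); first by exists None.
  have per_ok l : sg_set (H l) (u^-1 * v)%g ->
      exists a : rel_alphabet H X,
      letter_val (alphabet_letter a) = (u^-1 * v)%g /\ (o l -> prefers o (Some a)).
    move=> Hl; pose h := SgElt (mem_set Hl).
    have h1 : h <> 1%g.
      move=> /(congr1 val) /= E; apply: nuv.
      by apply: (mulgI u^-1%g); rewrite E mulVg.
    by exists (inr (existT _ l (exist _ h h1))).
  have [[l ol Hl]|no] := pselect (exists2 l, o l & sg_set (H l) (u^-1 * v)%g).
    have [a [aE ao]] := per_ok _ Hl.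
    by exists (Some a) => _; split=> // _; exact: ao.
  have [uv1|] := pselect (e u v); last by exists None.
  have := word_len_le1 uv1 => -[E|[Xx|[l _ Hl]]].
  - by case: nuv; apply: (mulgI u^-1%g); rewrite E mulVg.
  - pose x0 : set_type X := SigSub (mem_set Xx).
    by exists (Some (inl x0)) => _; split.
  - have [a [aE _]] := per_ok _ Hl.
    by exists (Some a) => _; split.
have [f Hf] := choice pick.
by exists (fun u v => f (u, v)) => u v uv; exact: (Hf (u, v)).
Qed.

Definition lipschitz1 (f : G -> R) := forall x y, `|f x - f y| <= (d x y)%:R.

(** * The area form and its linear bound *)

Section Area.
Variables (f g : G -> R) (fL : lipschitz1 f) (gL : lipschitz1 g).

Definition coset_rep (l : L) (x : G) : G :=
  xget 1%g [set z | sg_set (H l) (x^-1 * z)%g].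

Lemma coset_repP l x : sg_set (H l) (x^-1 * coset_rep l x)%g.
Proof.
by rewrite /coset_rep; apply: (@xgetPex _ 1%g [set z | sg_set (H l) (x^-1 * z)%g]);
  exists x; rewrite /= mulVg; exact: sg1.
Qed.

Lemma coset_rep_mul l x h : sg_set (H l) h ->
  coset_rep l (x * h)%g = coset_rep l x.
Proof.
move=> Hh; rewrite /coset_rep; congr xget; apply/seteqP; split=> z /= Hz.
  have -> : (x^-1 * z = h * ((x * h)^-1 * z))%g by rewrite !gnorm.
  exact: sgM.
have -> : ((x * h)^-1 * z = h^-1 * (x^-1 * z))%g by rewrite !gnorm.
by apply: sgM => //; exact: sgV.
Qed.

(* The 1-cochain [f dg]; on a coset of a peripheral subgroup [f] is frozen at a
   representative, which makes the cochain closed there. *)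
Definition area_cochain (x : G) (a : letter) : R :=
  match a with
  | FGen y b => let z := (x * (val y)^-1)%g in
      if b then f z * (g z - g x) else f x * (g (x * val y)%g - g x)
  | FPer l h => f (coset_rep l x) * (g (x * val h)%g - g x)
  end.

Lemma area_cochainP : is_cochain area_cochain.
Proof.
split=> [x y b|x l|x l u v] /=.
- by case: b => /=; rewrite ?mulgVK ?mulgK; ring.
- by rewrite mulg1 subrr mulr0.
- rewrite coset_rep_mul; last exact: set_mem (sg_valP u).
  by rewrite mulgA; ring.
Qed.

Lemma lipschitz_step (k : G -> R) x y : lipschitz1 k -> (d x y <= 1)%N ->
  `|k x - k y| <= 1.
Proof. by move=> kL xy; apply: le_trans (kL x y) _; rewrite lern1. Qed.

Lemma area_letter x (a : letter) :
  `|area_cochain x a - f x * (g (x * letter_val a)%g - g x)| <= 1.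
Proof.
have key y z : (d y x <= 1)%N -> (d z x <= 1)%N ->
    `|f y * (g z - g x) - f x * (g z - g x)| <= 1.
  move=> yx zx; rewrite -mulrBl normrM -[1 in X in _ <= X]mulr1.
  by apply: ler_pM => //; exact: lipschitz_step.
have letx (b : letter) : (d (x * letter_val b)%g x <= 1)%N.
  by rewrite dist_sym // dist_mulr rel_len_letter.
have dxx : (d x x <= 1)%N by rewrite dist_id.
have := letx a; case: a => [y [|]|l h] /= la; try exact: key.
apply: key => //; rewrite dist_sym //.
exact: (rel_len_per (coset_repP l x)).
Qed.

(** The main terms telescope to the closed form. Each letter adds an error of at most [1] for
    freezing, plus the variation of [f] times the change of [g] over the rest of the word, whence a
    quadratic bound; it is applied to the finitely many relators only. *)
Lemma area_word x (w : seq letter) :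
  `|word_int area_cochain x w - f x * (g (x * word_val w)%g - g x)|
    <= (size w * (size w).+1)%:R.
Proof.
elim: w x => [|a w IH] x /=.
  by rewrite /word_val /fp_eval big_nil mulg1 subrr mulr0 subrr normr0.
rewrite word_val_cons mulgA.
set y := (x * letter_val a)%g; set z := (y * word_val w)%g.
have -> : area_cochain x a + word_int area_cochain y w - f x * (g z - g x) =
  (area_cochain x a - f x * (g y - g x)) +
  ((word_int area_cochain y w - f y * (g z - g y)) + (f y - f x) * (g z - g y)).
  by ring.
have a1 := area_letter x a; have a2 := IH y.
have a3 : `|(f y - f x) * (g z - g y)| <= (size w)%:R.
  rewrite normrM -[(size w)%:R]mul1r; apply: ler_pM => //.
    by apply: lipschitz_step => //; rewrite dist_sym // /y dist_mulr rel_len_letter.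
  apply: le_trans (gL z y) _.
  by rewrite ler_nat dist_sym // /z dist_mulr rel_len_word.
apply: le_trans (ler_normD _ _) _.
have := ler_normD (word_int area_cochain y w - f y * (g z - g y))
  ((f y - f x) * (g z - g y)).
have -> : ((size w).+1 * (size w).+2)%:R =
   (size w * (size w).+1)%:R + (size w)%:R + 1 + (size w).+1%:R :> R.
  rewrite (_ : (size w).+1 * (size w).+2 =
    size w * (size w).+1 + size w + 1 + (size w).+1)%N ?natrD //; nia.
have : 0 <= (size w).+1%:R :> R by [].
rewrite -/y -/z; move: a1 a2 a3; lra.
Qed.

End Area.

Variables (rels : set (rel_free H X)).
Hypothesis finrels : finite_set rels.
Hypothesis relsP : rel_presentation rels.
Hypothesis isoP : linear_rel_isoperimetric R rels.

Lemma relator_size_bound : exists N, forall r, rels r -> (size (qrepr r) <= N)%N.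
Proof.
have /finite_seqP [s ->] := finrels.
have [|r _|N HN] := @seq_uniform_bound _ s (fun r n => size (qrepr r) <= n)%N.
- by move=> r m n mn rm; exact: leq_trans mn.
- by exists (size (qrepr r)).
by exists N => r /= rs; exact: HN.
Qed.

Lemma area_inequality : exists C : nat, forall f g, lipschitz1 f -> lipschitz1 g ->
  forall x s, path e x s -> last x s = x ->
  `|path_sum (fun u v => f u * (g v - g u)) x s| <= C%:R * (size s)%:R.
Proof.
have [N HN] := relator_size_bound; have [C C0 isoC] := isoP.
exists (Num.truncn (C * (N * N.+1)%:R + 1)).+1 => f g fL gL x s xs sx.
have [sel Hsel] := exists_letter_choice (fun _ => False).
have M0 : 0 <= (N * N.+1)%:R :> R by [].
have B := @closed_path_bound R G L H X _ (area_cochainP f g) rels _ relsP _ C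
  (ltW C0) isoC e sel (fun u v uv => (Hsel u v uv).1) M0 x s xs sx.
have {}B : `|path_sum (sel_cost (area_cochain f g) sel) x s| <=
    C * (size s)%:R * (N * N.+1)%:R.
  apply: B => r rr y; have := area_word fL gL y (qrepr r).
  have -> : word_val (qrepr r) = 1%g by exact: (relator_nat relsP rr).
  rewrite mulg1 subrr mulr0 subr0 => /le_trans; apply.
  by rewrite ler_nat leq_mul // ?ltnS HN.
have D : `|path_sum (sel_cost (area_cochain f g) sel) x s -
    path_sum (fun u v => f u * (g v - g u)) x s| <= (size s)%:R.
  elim: s x xs {sx B} => [|y s IH] x /=; first by rewrite subrr normr0.
  move=> /andP[xy ys]; have := IH _ ys; set P1 := path_sum _ y s.
  set P2 := path_sum _ y s.
  rewrite (_ : _ + P1 - (_ + P2) = (sel_cost (area_cochain f g) sel x y -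
    f x * (g y - g x)) + (P1 - P2)); last by ring.
  move=> PP; apply: le_trans (ler_normD _ _) _; rewrite -add1n natrD.
  apply: lerD => //; have [+ _] := Hsel x y xy; rewrite /sel_cost.
  case: (sel x y) => [a aE|->]; last by rewrite !subrr mulr0 subrr normr0.
  have := area_letter fL gL x (alphabet_letter a); rewrite aE mulVKg //.
have -> : path_sum (fun u v => f u * (g v - g u)) x s =
    path_sum (sel_cost (area_cochain f g) sel) x s -
   (path_sum (sel_cost (area_cochain f g) sel) x s -
    path_sum (fun u v => f u * (g v - g u)) x s) by ring.
apply: le_trans (ler_normB _ _) _.
apply: le_trans (lerD B D) _.
rewrite -mulrA [_%:R * _]mulrC mulrA -{2}(mul1r (size s)%:R) -mulrDl.
by apply: ler_wpM2r => //; apply: ltW; apply: truncnS_gt.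
Qed.

(** * Peripheral edges isolated in a loop *)

Definition relator_letters : set G := \bigcup_(r in rels)
  ([set` map (@letter_val _ _ H X) (qrepr r)] `|`
   [set x^-1%g | x in [set` map (@letter_val _ _ H X) (qrepr r)]]).

Lemma finite_relator_letters : finite_set relator_letters.
Proof.
apply: bigcup_finite => // r _; rewrite finite_setU; split; first exact: finite_seq.
by apply: finite_image; exact: finite_seq.
Qed.

Fixpoint relator_ball (n : nat) : set G :=
  if n is m.+1 then
    relator_ball m `|` [set x * w | x in relator_ball m & w in relator_letters]%g
  else [set 1%g].

Lemma finite_relator_ball n : finite_set (relator_ball n).
Proof.
elim: n => [|n IH] /=; first exact: finite_set1.
rewrite finite_setU; split=> //; apply: finite_image2 => //.
exact: finite_relator_letters.
Qed.

Lemma relator_ball_mono m n : (m <= n)%N -> relator_ball m `<=` relator_ball n.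
Proof.
move/subnKC => <-; elim: (n - m)%N => [|k IH]; first by rewrite addn0.
by rewrite addnS => x /IH; left.
Qed.

Section Isolated.
Variables (l0 : L) (y : G) (K : nat).
Local Notation H0 := (sg_set (H l0)).

Let depth_ex (x : G) : exists n, `[< relator_ball n (y^-1 * x)%g >] || (K <= n)%N.
Proof. by exists K; rewrite leqnn orbT. Qed.

(** Word length of [y^-1 * x] in the letters of the relators. These letters need not generate, and
    the truncation at [K] keeps the length finite without losing its Lipschitz bound. *)
Definition depth (x : G) : nat := ex_minn (depth_ex x).

Lemma depth_letter x w : relator_letters w -> (depth (x * w) <= (depth x).+1)%N.
Proof.
move=> Ww; rewrite /depth; case: (ex_minnP (depth_ex x)) => m Hm _.
case: ex_minnP => n _; apply; case/orP: Hm => [/asboolP Bm|Km].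
  apply/orP; left; apply/asboolP; right.
  by exists (y^-1 * x)%g => //; exists w => //; rewrite mulgA.
by rewrite leqW ?orbT.
Qed.

Lemma relator_lettersV w : relator_letters w -> relator_letters w^-1%g.
Proof.
move=> [r rr [wr|[x xr <-]]]; exists r => //; [right|left]; first by exists w.
by rewrite invgK.
Qed.

Lemma depth_letter_dist x w : relator_letters w ->
  `|(depth (x * w))%:R - (depth x)%:R| <= 1 :> R.
Proof.
move=> Ww; have h1 := depth_letter x Ww.
have := depth_letter (x * w)%g (relator_lettersV Ww); rewrite mulgK => h2.
have {}h1 : (depth (x * w))%:R <= (depth x)%:R + 1 :> R.
  by rewrite -(natrD R _ 1) ler_nat addn1.
have {}h2 : (depth x)%:R <= (depth (x * w))%:R + 1 :> R.
  by rewrite -(natrD R _ 1) ler_nat addn1.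
by rewrite ler_norml; move: h1 h2; lra.
Qed.

(** The differential of [depth] on the single coset [y H_l0], extended by zero. A relator changes
    [depth] by at most one per letter, because its own letters are among those that [depth]
    counts. *)
Definition depth_cochain (x : G) (a : letter) : R :=
  match a with
  | FGen _ _ => 0
  | FPer l h => if `[< l = l0 /\ H0 (y^-1 * x)%g >]
                then (depth (x * val h))%:R - (depth x)%:R else 0
  end.

Lemma depth_cochainP : is_cochain depth_cochain.
Proof.
split=> [x z b|x l|x l u v] /=; first by rewrite addr0.
  by rewrite mulg1 subrr if_same.
case: asboolP => [[ll Hx]|no].
  case: asboolP => [_|no]; first by rewrite mulgA; ring.
  case: no; split=> //; rewrite mulgA; apply: sgM => //.
  by rewrite -ll; exact: set_mem (sg_valP u).
case: asboolP => [[ll Hx]|_]; last by rewrite addr0.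
case: no; split=> //.
have -> : (y^-1 * x = (y^-1 * (x * sg_val u)) * (sg_val u)^-1)%g by rewrite !gnorm.
apply: sgM => //; apply: sgV.
by rewrite -ll; exact: set_mem (sg_valP u).
Qed.

Lemma depth_word x (w : seq letter) :
  (forall a, a \in map (@letter_val _ _ H X) w -> relator_letters a) ->
  `|word_int depth_cochain x w| <= (size w)%:R.
Proof.
elim: w x => [|a w IH] x Hw /=; first by rewrite normr0.
apply: le_trans (ler_normD _ _) _; rewrite -add1n natrD; apply: lerD; last first.
  by apply: IH => b bw; apply: Hw; rewrite /= inE bw orbT.
have := Hw (letter_val a); rewrite inE eqxx => /(_ isT).
case: a {Hw} => [z b|l h] /= Wa; first by rewrite normr0.
by case: ifP => _; [exact: depth_letter_dist|rewrite normr0].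
Qed.

End Isolated.

(* [p] lists the edges of the path; an edge inside [y H_l] only occurs at the
   start. *)
Lemma isolated_component : exists C : nat, forall l y v s,
  sg_set (H l) (y^-1 * v)%g -> path e v s -> last v s = y ->
  (forall p, p \in zip (v :: s) s -> p.1 <> p.2 ->
     ~ (sg_set (H l) (y^-1 * p.1)%g /\ sg_set (H l) (y^-1 * p.2)%g)) ->
  relator_ball (C * (size s).+1) (y^-1 * v)%g.
Proof.
have [N HN] := relator_size_bound; have [C C0 isoC] := isoP.
set C' := (Num.truncn (C * N%:R)).+1; exists C' => l y v s Hv vs sy nos.
set K := (C' * (size s).+1)%N.
have [sel Hsel] := exists_letter_choice (fun l' => l' = l).
have M0 : 0 <= N%:R :> R by [].
have yv : e y v by exact: rel_len_per Hv.
have B := @closed_path_bound R G L H X _ (depth_cochainP l y K.+1) rels _ relsP _ C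
  (ltW C0) isoC e sel (fun u v uv => (Hsel u v uv).1) M0 y (v :: s).
have {}B : `|path_sum (sel_cost (depth_cochain l y K.+1) sel) y (v :: s)| <=
    C * (size (v :: s))%:R * N%:R.
  apply: B => //; last by rewrite /= yv.
  move=> r rr x; apply: le_trans (_ : (size (qrepr r))%:R <= _); last by rewrite ler_nat HN.
  apply: depth_word.
  by move=> a ar; exists r => //; left.
have cost u w : e u w ->
    sel_cost (depth_cochain l y K.+1) sel u w =
    if `[< sg_set (H l) (y^-1 * u)%g /\ sg_set (H l) (y^-1 * w)%g >]
    then (depth y K.+1 w)%:R - (depth y K.+1 u)%:R else 0.
  move=> uw; have [] := Hsel u w uw; rewrite /sel_cost.
  case: (sel u w) => [a aE pa|-> _]; last by rewrite subrr if_same.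
  case: asboolP => [[Hu Hw]|no].
    have /pa : exists2 l', l' = l & sg_set (H l') (u^-1 * w)%g.
      exists l => //; have -> : (u^-1 * w = (y^-1 * u)^-1 * (y^-1 * w))%g.
        by rewrite !gnorm.
      by apply: sgM => //; exact: sgV.
    case: a aE {pa} => [//|[l' h]] /= aE ll.
    by rewrite /letter_val /= in aE; rewrite aE mulVKg; case: asboolP => // [[]].
  case: a aE {pa} => [//|[l' h]] /= aE.
  case: asboolP => // [[ll Hu]]; case: no; split=> //.
  have -> : (y^-1 * w = (y^-1 * u) * (u^-1 * w))%g by rewrite !gnorm.
  apply: sgM => //; rewrite -aE -ll; exact: set_mem (sg_valP _).
(* Only the closing edge from [y] to [v] is seen by the cochain, so the whole integral is [depth] at
   [v]. *)
have zero : path_sum (sel_cost (depth_cochain l y K.+1) sel) v s = 0.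
  have [+ +] := (vs, nos); move: {Hv vs sy nos yv B} K cost => k cost.
  elim: s v => //= w s IH v /andP[vw ws] nos.
  rewrite cost // IH //.
    case: asboolP => [hh|_]; last by rewrite addr0.
    have [->|ne] := pselect (v = w); first by rewrite subrr addr0.
    by case: (nos (v, w)) => //; rewrite inE eqxx.
  by move=> p pi; apply: nos; rewrite inE pi orbT.
have dy : depth y K.+1 y = 0%N.
  rewrite /depth; case: ex_minnP => m _ Hm; apply/eqP; rewrite -leqn0; apply: Hm.
  by apply/orP; left; apply/asboolP; rewrite mulVg.
move: B; rewrite /= zero addr0 cost // asboolT; last first.
  by split=> //; rewrite mulVg; exact: sg1.
rewrite dy subr0 normr_nat => B.
have : (depth y K.+1 v)%:R <= K%:R :> R.
  apply: (le_trans B); rewrite /K natrM mulrAC.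
  by apply: ler_wpM2r => //; apply: ltW; exact: truncnS_gt.
(* The truncation is at [K.+1], so a value of at most [K] comes from actual membership in a ball. *)
rewrite ler_nat /depth; case: ex_minnP => m Hm _ mK.
move: Hm; rewrite [(K < m)%N]ltnNge mK orbF => /asboolP.
exact: (relator_ball_mono mK).
Qed.

End RelativePresentation.

(** * Area inequalities imply hyperbolicity *)

Section AreaHyperbolic.
Variables (T : eqType) (d : T -> T -> nat).
Hypothesis d_id : forall x, d x x = 0.
Hypothesis d_sym : forall x y, d x y = d y x.
Hypothesis d_tri : forall x y z, d x z <= d x y + d y z.

Local Notation e := (fun u v : T => d u v <= 1).

Section Rectangle.
Local Open Scope ring_scope.
Variables (R : realType) (C : nat).
Hypothesis areaC : forall f g : T -> R,
  (forall x y, `|f x - f y| <= (d x y)%:R) ->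
  (forall x y, `|g x - g y| <= (d x y)%:R) ->
  forall x s, path e x s -> last x s = x ->
  `|path_sum (fun u v => f u * (g v - g u)) x s| <= C%:R * (size s)%:R.

Definition trunc_dist (D : nat) (l : seq T) (u : T) : nat :=
  foldr (fun v m => minn (d u v) m) D l.

Lemma trunc_dist_lip D l u v : (trunc_dist D l u <= trunc_dist D l v + d u v)%N.
Proof.
elim: l => [|w l IH] /=; first exact: leq_addr.
have := d_tri u v w; lia.
Qed.

Lemma trunc_dist_lipR D l u v :
  `|(trunc_dist D l u)%:R - (trunc_dist D l v)%:R| <= (d u v)%:R :> R.
Proof.
have h1 := trunc_dist_lip D l u v.
have h2 := trunc_dist_lip D l v u; rewrite (d_sym v) in h2.
rewrite -(ler_nat R) natrD in h1; rewrite -(ler_nat R) natrD in h2.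
by rewrite ler_norml; move: h1 h2; lra.
Qed.

Lemma trunc_dist_mem D l u : u \in l -> trunc_dist D l u = 0%N.
Proof.
elim: l => //= w l IH; rewrite inE => /predU1P [->|/IH ->].
  by rewrite d_id min0n.
by rewrite minn0.
Qed.

Lemma trunc_dist_far D l u : (forall v, v \in l -> (D <= d v u)%N) ->
  trunc_dist D l u = D.
Proof.
elim: l => //= w l IH H; rewrite IH; last first.
  by move=> v vl; apply: H; rewrite inE vl orbT.
by have := H w (mem_head _ _); rewrite d_sym; lia.
Qed.

Lemma path_sum_const (f g : T -> R) c x s : (forall u, u \in x :: s -> f u = c) ->
  path_sum (fun u v => f u * (g v - g u)) x s = c * (g (last x s) - g x).
Proof.
elim: s x => [|y s IH] x fc /=; first by rewrite subrr mulr0.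
rewrite IH; last by move=> u us; apply: fc; rewrite inE us orbT.
by rewrite fc ?mem_head //; ring.
Qed.

Lemma path_sum_flat (f g : T -> R) c x s : (forall u, u \in x :: s -> g u = c) ->
  path_sum (fun u v => f u * (g v - g u)) x s = 0.
Proof.
elim: s x => [//|y s IH] x gc /=.
rewrite IH; last by move=> u us; apply: gc; rewrite inE us orbT.
by rewrite !gc ?inE ?eqxx ?orbT // subrr mulr0 addr0.
Qed.

(** Besicovitch's argument. Take for [f] and [g] the truncated distances to the first and second
    sides: [f] is [0] and [D1] on the first and third sides, [g] is [0] and [D2] on the second and
    fourth, so the integral of [f dg] is exactly [D1 * D2]. *)
Lemma rectangle D1 D2 x1 s1 x2 s2 x3 s3 x4 s4 :
  path e x1 s1 -> last x1 s1 = x2 -> path e x2 s2 -> last x2 s2 = x3 ->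
  path e x3 s3 -> last x3 s3 = x4 -> path e x4 s4 -> last x4 s4 = x1 ->
  (forall u v, u \in x1 :: s1 -> v \in x3 :: s3 -> (D1 <= d u v)%N) ->
  (forall u v, u \in x2 :: s2 -> v \in x4 :: s4 -> (D2 <= d u v)%N) ->
  (D1 * D2 <= C * (size s1 + size s2 + size s3 + size s4))%N.
Proof.
move=> p1 l1 p2 l2 p3 l3 p4 l4 H1 H2.
pose f u : R := (trunc_dist D1 (x1 :: s1) u)%:R.
pose g u : R := (trunc_dist D2 (x2 :: s2) u)%:R.
have lastm x s : last x s \in x :: s by exact: mem_last.
have := areaC (f := f) (g := g) (trunc_dist_lipR _ _) (trunc_dist_lipR _ _)
  (x := x1) (s := s1 ++ s2 ++ s3 ++ s4).
rewrite !cat_path !last_cat l1 l2 l3 p1 p2 p3 p4 => /(_ isT l4).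
rewrite !path_sum_cat l1 l2 l3.
rewrite (@path_sum_const f g 0 x1 s1); last first.
  by move=> u us; rewrite /f trunc_dist_mem.
rewrite (@path_sum_flat f g 0 x2 s2); last first.
  by move=> u us; rewrite /g trunc_dist_mem.
rewrite (@path_sum_const f g D1%:R x3 s3); last first.
  by move=> u us; rewrite /f trunc_dist_far // => v vs; exact: H1.
rewrite (@path_sum_flat f g D2%:R x4 s4); last first.
  by move=> u us; rewrite /g trunc_dist_far // => v vs; exact: H2.
have -> : g x3 = 0 by rewrite /g trunc_dist_mem // -l2.
have -> : g (last x3 s3) = D2%:R.
  by rewrite /g trunc_dist_far // => v vs; apply: H2 => //; rewrite l3 mem_head.
rewrite mul0r !add0r addr0 subr0 !size_cat -!natrM normr_nat ler_nat.
by rewrite !addnA.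
Qed.

End Rectangle.

(** * Geodesics and slim triangles *)

Definition geod (p : nat -> T) (n : nat) :=
  forall i j, i <= j -> j <= n -> d (p i) (p j) = j - i.

Hypothesis geodesic : forall x y, exists p, [/\ p 0 = x, p (d x y) = y &
  geod p (d x y)].

Lemma geod_dist p n i j : geod p n -> i <= n -> j <= n ->
  d (p i) (p j) = (j - i) + (i - j).
Proof.
move=> gp ni nj; case: (leqP i j) => [ij|/ltnW ij]; first by rewrite gp //; lia.
by rewrite d_sym gp //; lia.
Qed.

Lemma geod_rev p n : geod p n -> geod (fun i => p (n - i)) n.
Proof. by move=> gp i j ij jn; rewrite (geod_dist gp); lia. Qed.

Lemma geod_shift p n k m : geod p n -> k + m <= n -> geod (fun i => p (k + i)) m.
Proof. by move=> gp kn i j ij jn; rewrite (geod_dist gp); lia. Qed.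

Definition seg (p : nat -> T) i m := [seq p k | k <- iota i.+1 m].

Lemma size_seg p i m : size (seg p i m) = m.
Proof. by rewrite size_map size_iota. Qed.

Lemma last_seg p i m : last (p i) (seg p i m) = p (i + m).
Proof.
rewrite /seg last_map; congr p; elim: m i => [|m IH] i /=; first by rewrite addn0.
by rewrite IH addnS addSn.
Qed.

Lemma mem_seg p i m v : v \in p i :: seg p i m ->
  exists j, [/\ i <= j, j <= i + m & v = p j].
Proof.
rewrite inE => /predU1P [->|/mapP [j]].
  by exists i; rewrite leq_addr.
by rewrite mem_iota => jm ->; exists j; split=> //; lia.
Qed.

Lemma path_seg p n i m : geod p n -> i + m <= n -> path e (p i) (seg p i m).
Proof.
move=> gp; elim: m i => [//|m IH] i im /=.
apply/andP; split; first by rewrite gp; lia.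
by apply: (IH i.+1); lia.
Qed.

(** The bound [N] on the sides makes [slim N N] immediate, so that a least thinness exists; the
    estimate obtained for it does not depend on [N]. *)
Definition slim N D := forall p q r np nq nr,
  geod p np -> geod q nq -> geod r nr -> np <= N -> nq <= N -> nr <= N ->
  p 0 = q 0 -> p np = r 0 -> q nq = r nr ->
  forall k, k <= np ->
    (exists2 i, i <= nq & d (p k) (q i) <= D) \/
    (exists2 i, i <= nr & d (p k) (r i) <= D).

(* Two sides towards a common vertex are short-cut at distance [20 D], away from
   the ball of radius [D] around [o]. *)
Lemma avoiding_path N D q r nq nr o i j : 0 < D -> 12 * D <= N -> slim N D ->
  geod q nq -> geod r nr -> nq <= N -> nr <= N -> q nq = r nr ->
  (forall m, m <= nq -> D <= d o (q m)) -> (forall m, m <= nr -> D <= d o (r m)) ->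
  i <= nq -> j <= nr -> d (q i) (r j) <= 12 * D -> d o (q i) <= 6 * D ->
  exists s, [/\ path e (q i) s, last (q i) s = r j, size s <= 72 * D &
    forall v, v \in q i :: s -> D <= d o v].
Proof.
move=> D0 DN sl gq gr nqN nrN qr oq or iq jr yz oy.
case: (leqP (nq - i) (20 * D)) => short.
  have dc : nr - j <= 20 * D + 12 * D.
    have := d_tri (r j) (q i) (r nr); rewrite -{2}qr gr // gq // d_sym; lia.
  pose r' m := r (nr - m).
  have gr' : geod r' nr by exact: geod_rev.
  have E : last (q i) (seg q i (nq - i)) = r' 0.
    by rewrite last_seg subnKC // qr /r' subn0.
  exists (seg q i (nq - i) ++ seg r' 0 (nr - j)); split.
  - rewrite cat_path E (path_seg gq) ?(path_seg gr') //; lia.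
  - by rewrite last_cat E last_seg /r' add0n; congr r; lia.
  - by rewrite size_cat !size_seg; lia.
  - move=> v; rewrite -cat_cons mem_cat => /orP [/mem_seg [m [m1 m2 ->]]|vr].
      by apply: oq; lia.
    have /mem_seg [m [m1 m2 ->]] : v \in r' 0 :: seg r' 0 (nr - j).
      by rewrite inE vr orbT.
    by apply: or; lia.
have [t [t0 tl gt]] := geodesic (q i) (r j).
have g1 : geod (fun m => q (i + m)) (nq - i) by apply: (geod_shift gq); lia.
have g3 : geod (fun m => r (nr - m)) (nr - j).
  by move=> a b ab bn; rewrite (geod_dist gr); lia.
have n1 : nq - i <= N by lia.
have n2 : d (q i) (r j) <= N by lia.
have n3 : nr - j <= N by lia.
have e1 : q (i + 0) = t 0 by rewrite addn0 t0.
have e2 : q (i + (nq - i)) = r (nr - 0) by rewrite subnKC // qr subn0.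
have e3 : t (d (q i) (r j)) = r (nr - (nr - j)) by rewrite tl subKn.
(* The base [t] has length at most [12 * D], so the point [20 * D] along [q] is too far from it and
   must be close to [r]. *)
case: (sl _ _ _ _ _ _ g1 gt g3 n1 n2 n3 e1 e2 e3 (20 * D) (ltnW short)).
- move=> [m mt qt].
  have := d_tri (q i) (t m) (q (i + 20 * D)).
  rewrite [d (q i) (q _)]gq; [|lia|lia]; rewrite (d_sym (t m)).
  have : d (q i) (t m) = m by rewrite -t0 gt // subn0.
  lia.
move=> [m mr qm].
pose m' := nr - m.
have m'j : j <= m' by rewrite /m'; lia.
have rm : r (nr - m) = r m' by [].
rewrite {}rm in qm.
pose r' k := r (nr - k).
have gr' : geod r' nr by exact: geod_rev.
have [w [w0 wl gw]] := geodesic (q (i + 20 * D)) (r m').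
set n := d (q (i + 20 * D)) (r m') in qm w0 wl gw.
have dj : m' - j <= 33 * D.
  have := d_tri (r j) (q i) (r m'); have := d_tri (q i) (q (i + 20 * D)) (r m').
  rewrite [d (q i) (q _)]gq; [|lia|lia]; rewrite [d (r j) (r m')]gr //; last by lia.
  rewrite (d_sym (r j)) -/n; lia.
have E1 : last (q i) (seg q i (20 * D)) = w 0 by rewrite last_seg w0.
have E2 : last (w 0) (seg w 0 n) = r' m by rewrite last_seg add0n wl.
(* The crossing [w] avoids the ball: it stays within [D] of a point at distance at least [14 * D]
   from [o]. *)
exists (seg q i (20 * D) ++ seg w 0 n ++ seg r' m (m' - j)); split.
- rewrite !cat_path E1 E2 (path_seg gq) ?(path_seg gw) ?(path_seg gr') //;
  rewrite /m' in m'j *; lia.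
- rewrite !last_cat E1 E2 last_seg /r'; congr r; rewrite /m' in m'j *; lia.
- rewrite !size_cat !size_seg; lia.
- move=> v; rewrite -cat_cons !mem_cat => /orP [/mem_seg [a [a1 a2 ->]]|].
    by apply: oq; lia.
  move=> /orP[] vr.
    have /mem_seg [a [a1 a2 ->]] : v \in w 0 :: seg w 0 n by rewrite inE vr orbT.
    have := d_tri (q i) o (w a); have := d_tri (q i) (w a) (q (i + 20 * D)).
    have : d (w a) (q (i + 20 * D)) <= n.
      by rewrite d_sym -w0 gw //; lia.
    rewrite [d (q i) (q _)]gq; [|lia|lia]; rewrite (d_sym (q i) o); lia.
  have /mem_seg [a [a1 a2 ->]] : v \in r' m :: seg r' m (m' - j).
    by rewrite inE vr orbT.
  by apply: or; lia.
Qed.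

Variable C : nat.
Hypothesis rectC : forall D1 D2 x1 s1 x2 s2 x3 s3 x4 s4,
  path e x1 s1 -> last x1 s1 = x2 -> path e x2 s2 -> last x2 s2 = x3 ->
  path e x3 s3 -> last x3 s3 = x4 -> path e x4 s4 -> last x4 s4 = x1 ->
  (forall u v, u \in x1 :: s1 -> v \in x3 :: s3 -> D1 <= d u v) ->
  (forall u v, u \in x2 :: s2 -> v \in x4 :: s4 -> D2 <= d u v) ->
  D1 * D2 <= C * (size s1 + size s2 + size s3 + size s4).

(* The loop runs along [p] from [p i1] to [p i2], along [c2] to [y2], back along
   [s] to [y1], and along [c1] to [p i1]. *)
Lemma fat_loop p np k D h i1 i2 y1 y2 c1 c2 s :
  geod p np -> h + h <= D -> i1 <= k - h -> h <= k -> k + h <= i2 -> i2 <= np ->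
  path e (p i2) c2 -> last (p i2) c2 = y2 -> path e y2 s -> last y2 s = y1 ->
  path e y1 c1 -> last y1 c1 = p i1 ->
  (forall v, v \in y2 :: s -> D <= d (p k) v) ->
  (forall v, v \in c2 -> d (p i2) v + k + D <= i2) ->
  (forall v, v \in y1 :: c1 -> d (p i1) v + i1 + D <= k \/ v = p i1) ->
  h * (h + h) <= C * (i2 - i1 + size c2 + size s + size c1).
Proof.
move=> gp hD i1k hk ki2 i2n pc2 lc2 ps ls pc1 lc1 far f2 f1.
have E1 : last (p (k - h)) (seg p (k - h) (h + h)) = p (k + h).
  by rewrite last_seg; congr p; lia.
have E2 : last (p (k + h)) (seg p (k + h) (i2 - (k + h))) = p i2.
  by rewrite last_seg subnKC.
have E4 : last (p i1) (seg p i1 (k - h - i1)) = p (k - h).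
  by rewrite last_seg subnKC.
have := @rectC h (h + h) (p (k - h)) (seg p (k - h) (h + h)) (p (k + h))
  (seg p (k + h) (i2 - (k + h)) ++ c2) y2 s y1 (c1 ++ seg p i1 (k - h - i1)).
rewrite !cat_path !last_cat E1 E2 lc2 lc1 E4 pc2 pc1 !(path_seg gp); try lia.
move=> /(_ isT erefl isT erefl ps ls isT erefl) H.
apply: leq_trans (H _ _) _; last first.
- by rewrite !size_cat !size_seg leq_mul2l; lia.
- have pos2 v : v \in p (k + h) :: seg p (k + h) (i2 - (k + h)) ++ c2 ->
      exists2 j, k + h <= j + d (p j) v /\ j <= np & k + h + d (p j) v <= j.
    rewrite -cat_cons mem_cat => /orP[/mem_seg [j [j1 j2 ->]]|/f2 vc].
      by exists j; rewrite d_id; lia.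
    by exists i2; lia.
  have pos4 v : v \in y1 :: c1 ++ seg p i1 (k - h - i1) ->
      exists2 j, j <= np & j + d (p j) v + h <= k.
    rewrite -cat_cons mem_cat => /orP[/f1 [vc|->]|vs].
    - by exists i1; lia.
    - by exists i1; rewrite ?d_id; lia.
    - have /mem_seg [j [j1 j2 ->]] : v \in p i1 :: seg p i1 (k - h - i1).
        by rewrite inE vs orbT.
      by exists j; rewrite ?d_id; lia.
  move=> u v /pos2 [a [_ an] Ha] /pos4 [b bn Hb].
  have := d_tri (p a) u (p b); have := d_tri u v (p b).
  rewrite (geod_dist gp an bn) (d_sym v (p b)); lia.
- move=> u v /mem_seg [a [a1 a2 ->]] /far vo.
  have := d_tri (p k) (p a) v; rewrite (geod_dist gp); lia.
Qed.

(* For the minimal thinness [D], a triangle which is not [D.-1]-slim gives a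
   loop of length at most [84 * D] containing a rectangle with sides about [D]
   and [D / 2], whose area is at most linear in the length of the loop. *)
Lemma slim_bound N : slim N (252 * C + 2).
Proof.
have sN : exists D, `[< slim N D >].
  exists N; apply/asboolP => p q r np nq nr gp gq gr npN nqN nrN pq pr qr k kp.
  by left; exists 0 => //; rewrite -pq d_sym gp //; lia.
case: (ex_minnP sN) => D /asboolP sD Dmin.
have [DC|DC] := leqP D (252 * C + 2).
  move=> p q r np nq nr gp gq gr npN nqN nrN pq pr qr k kp.
  have [[i i1 i2]|[i i1 i2]] := sD p q r np nq nr gp gq gr npN nqN nrN pq pr qr k kp.
    by left; exists i => //; exact: leq_trans DC.
  by right; exists i => //; exact: leq_trans DC.
have nsD : ~ slim N D.-1.
  by move=> /asboolP /Dmin; lia.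
exfalso; apply: nsD => p q r np nq nr gp gq gr npN nqN nrN pq pr qr k kp.
apply: contrapT => /not_orP [nq' nr'].
have oq m : m <= nq -> D <= d (p k) (q m).
  by move=> mq; rewrite leqNgt; apply/negP => lt; apply: nq'; exists m => //; lia.
have or m : m <= nr -> D <= d (p k) (r m).
  by move=> mr; rewrite leqNgt; apply/negP => lt; apply: nr'; exists m => //; lia.
have kD : D <= k by have := oq 0 isT; rewrite -pq d_sym gp // subn0.
have kD' : k + D <= np by have := or 0 isT; rewrite -pr gp //; lia.
pose h := D./2.
have hD : h + h <= D by rewrite /h; lia.
have Dh : D <= h + h + 1 by rewrite /h; lia.
(* The length [84 * D] is made of [10 * D] along [p], two crossings of length [D] and a detour of
   length [72 * D]. As [D <= 2 * h + 1], the area bound would give [2 * h <= 252 * C]. *)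
have contra n : n <= 84 * D -> h * (h + h) <= C * n -> False.
  move=> nD H1; have H2 : h * (h + h) <= C * (84 * (h + h + 1)).
    by apply: leq_trans H1 _; rewrite leq_mul2l; apply/orP; right; lia.
  have : h * (h + h) > h * (252 * C).
    by rewrite ltn_mul2l; lia.
  have : 84 * C * (h + h + 1) <= 252 * C * h.
    have -> : 252 * C * h = 84 * C * (3 * h) by lia.
    by rewrite leq_mul2l; apply/orP; right; lia.
  move: H2; nia.
case: (leqP (12 * D) N) => DN; last first.
  pose r' m := r m.
  pose q' m := q (nq - m).
  have E : last (p np) (seg r 0 nr) = q' 0 by rewrite pr last_seg add0n /q' subn0.
  have /contra : h * (h + h) <= C * (np - 0 + size (Nil T) +
      size (seg r 0 nr ++ seg q' 0 nq) + size (Nil T)).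
    apply: (@fat_loop p np k D h 0 np (p 0) (p np)) => //; try lia.
    - rewrite cat_path E {1}pr (path_seg gr) // (path_seg (geod_rev gq)) //.
    - by rewrite last_cat E last_seg /q' add0n subnn.
    - move=> v; rewrite -cat_cons mem_cat => /orP [|vq].
        by rewrite pr => /mem_seg [j [_ j1 ->]]; apply: or.
      have /mem_seg [j [_ j1 ->]] : v \in q' 0 :: seg q' 0 nq by rewrite inE vq orbT.
      by apply: oq; lia.
    - by move=> v; rewrite inE => /eqP ->; right.
  by apply; rewrite size_cat !size_seg /=; lia.
pose inU v := (exists2 m, m <= nq & v = q m) \/ (exists2 m, m <= nr & v = r m).
have sDp j : j <= np -> exists2 y, inU y & d (p j) y <= D.
  move=> jp; have [[m m1 m2]|[m m1 m2]] :=
    sD p q r np nq nr gp gq gr npN nqN nrN pq pr qr j jp.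
    by exists (q m) => //; left; exists m.
  by exists (r m) => //; right; exists m.
(* Leave [p] at distance [5 * D] from [p k], or at the vertex if it comes sooner, as it already lies
   on another side. *)
have [i2 [y2 [i2a i2b Uy2 dy2 H2]]] : exists i2 y2, [/\ k + D <= i2 <= np,
    i2 <= k + 5 * D, inU y2, d (p i2) y2 <= D & d (p i2) y2 + k + D <= i2].
  case: (leqP (k + 5 * D) np) => kn.
    have [y Uy dy] := sDp _ kn; exists (k + 5 * D), y; split=> //; lia.
  exists np, (p np); rewrite d_id; split=> //; try lia.
  by right; exists 0.
have [i1 [y1 [i1a i1b Uy1 dy1 H1]]] : exists i1 y1, [/\ i1 + D <= k,
    k <= i1 + 5 * D, inU y1, d (p i1) y1 <= D & d (p i1) y1 + i1 + D <= k].
  case: (leqP (5 * D) k) => kn.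
    have [|y Uy dy] := sDp (k - 5 * D); first by lia.
    by exists (k - 5 * D), y; split=> //; lia.
  exists 0, (p 0); rewrite d_id; split=> //; try lia.
  by left; exists 0.
have d12 : d y2 y1 <= 12 * D.
  have := d_tri y2 (p i2) y1; have := d_tri (p i2) (p i1) y1.
  rewrite (geod_dist gp) ?(d_sym y2); lia.
have dk2 : d (p k) y2 <= 6 * D.
  have := d_tri (p k) (p i2) y2; rewrite (geod_dist gp); lia.
have dk1 : d (p k) y1 <= 6 * D.
  have := d_tri (p k) (p i1) y1; rewrite (geod_dist gp); lia.
have [s [ps ls ss fs]] : exists s, [/\ path e y2 s, last y2 s = y1, size s <= 72 * D &
    forall v, v \in y2 :: s -> D <= d (p k) v].
  have same t nt a b : geod t nt -> (forall m, m <= nt -> D <= d (p k) (t m)) ->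
      a <= nt -> b <= nt -> d (t a) (t b) <= 12 * D ->
      exists s, [/\ path e (t a) s, last (t a) s = t b, size s <= 72 * D &
      forall v, v \in t a :: s -> D <= d (p k) v].
    move=> gt ot an bn tab; case: (leqP a b) => ab.
      exists (seg t a (b - a)); rewrite (path_seg gt) ?last_seg ?size_seg ?subnKC //.
      rewrite (geod_dist gt) // in tab; split=> //; first lia.
      by move=> v /mem_seg [j [j1 j2 ->]]; apply: ot; lia.
    pose t' m := t (nt - m); have gt' : geod t' nt by exact: geod_rev.
    have Ea : t a = t' (nt - a) by rewrite /t' subKn.
    exists (seg t' (nt - a) (a - b)); rewrite {1 2}Ea (path_seg gt'); last by lia.
    rewrite last_seg size_seg (geod_dist gt) // in tab *; split=> //.
    - by rewrite /t'; congr t; lia.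
    - lia.
    - by rewrite Ea => v /mem_seg [j [j1 j2 ->]]; apply: ot; lia.
  case: Uy2 d12 dk2 {H2 dy2} => -[a an ->] d12 dk2;
  case: Uy1 d12 dk1 {H1 dy1} => -[b bn ->] d12 dk1.
  - by apply: (same q nq).
  - apply: (@avoiding_path N D q r nq nr (p k) a b) => //; lia.
  - apply: (@avoiding_path N D r q nr nq (p k) a b) => //; lia.
  - by apply: (same r nr).
have [g2 [g20 g2l gg2]] := geodesic (p i2) y2.
have [g1 [g10 g1l gg1]] := geodesic y1 (p i1).
have /contra : h * (h + h) <= C * (i2 - i1 + size (seg g2 0 (d (p i2) y2)) +
    size s + size (seg g1 0 (d y1 (p i1)))).
  apply: (@fat_loop p np k D h i1 i2 y1 y2) => //; try lia.
  - by rewrite -{1}g20 (path_seg gg2).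
  - by rewrite -{1}g20 last_seg.
  - by rewrite -{1}g10 (path_seg gg1).
  - by rewrite -{1}g10 last_seg.
  - move=> v vg; have /mem_seg [j [_ j1 ->]] : v \in g2 0 :: seg g2 0 (d (p i2) y2).
      by rewrite inE vg orbT.
    by rewrite -{1}g20 gg2 //; lia.
  - move=> v vg; have /mem_seg [j [_ j1 ->]] : v \in g1 0 :: seg g1 0 (d y1 (p i1)).
      by rewrite g10.
    by left; rewrite -{1}g1l d_sym gg1 // (d_sym y1); rewrite (d_sym y1) in j1 *; lia.
by apply; rewrite !size_seg (d_sym y1); lia.
Qed.

Local Notation D0 := (252 * C + 3).

(** The last point of [p] close to the side from [x] to [y] has a successor close to the side from
    [z] to [y], so both sides nearly pass through [p k]. The step back from the successor accounts
    for [D0] being [252 * C + 3]. *)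
Lemma tripod x y z p : p 0 = x -> p (d x z) = z -> geod p (d x z) ->
  exists2 k, k <= d x z &
    k + d (p k) y <= d x y + 2 * D0 /\ d (p k) y + (d x z - k) <= d y z + 2 * D0.
Proof.
move=> p0 pz gp.
have [q [q0 qy gq]] := geodesic x y; have [r [r0 ry gr]] := geodesic z y.
have sl := @slim_bound (d x z + d x y + d z y) p q r _ _ _ gp gq gr.
have {}sl k : k <= d x z -> (exists2 i, i <= d x y & d (p k) (q i) <= 252 * C + 2) \/
    (exists2 i, i <= d z y & d (p k) (r i) <= 252 * C + 2).
  by apply: sl; rewrite ?p0 ?q0 ?pz ?r0 ?qy ?ry //; lia.
pose A k := (k <= d x z) && `[< exists2 i, i <= d x y & d (p k) (q i) <= 252 * C + 2 >].
have A0 : exists k, A k.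
  exists 0; apply/andP; split=> //; apply/asboolP; exists 0 => //.
  by rewrite p0 q0 d_id.
have Aub k : A k -> k <= d x z by case/andP.
case: (ex_maxnP A0 Aub) => k /andP[kn /asboolP [i iq di]] kmax.
exists k => //; split.
  have qy' : d (q i) y = d x y - i by rewrite -[X in d _ X = _]qy gq.
  have qx : d x (q i) = i by rewrite -[X in d X _]q0 gq // subn0.
  have := d_tri (p k) (q i) y; have := d_tri x (q i) (p k).
  rewrite qy' qx (d_sym (q i)).
  have : d x (p k) = k by rewrite -[X in d X _]p0 gp // subn0.
  lia.
have [j [jr dj]] : exists j, j <= d z y /\ d (p k) (r j) <= D0.
  case: (leqP (d x z) k) => kn'.
    exists 0; split=> //; rewrite r0 (_ : k = d x z) ?pz ?d_id //; lia.
  have [[i' iq' di']|[j jr dj]] := sl k.+1 kn'.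
    suff : k.+1 <= k by rewrite ltnn.
    by apply: kmax; rewrite /A kn'; apply/asboolP; exists i'.
  exists j; split=> //; have := d_tri (p k) (p k.+1) (r j).
  by rewrite gp //; lia.
have ry' : d (r j) y = d z y - j by rewrite -[X in d _ X = _]ry gr.
have rz : d z (r j) = j by rewrite -[X in d X _]r0 gr // subn0.
have := d_tri (p k) (r j) y; have := d_tri z (r j) (p k).
rewrite ry' rz (d_sym (r j)).
have : d z (p k) = d x z - k by rewrite d_sym -[X in d _ X = _]pz gp.
rewrite (d_sym y z); lia.
Qed.

(** Project [y] and [w] to a geodesic from [x] to [z]; the order of the two projections decides
    which alternative holds. *)
Lemma area_four_point x y z w :
  d x z + d y w <= maxn (d x y + d z w) (d x w + d y z) + 4 * D0.
Proof.
have [p [p0 pz gp]] := geodesic x z.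
have [k kn [k1 k2]] := tripod y p0 pz gp.
have [l ln [l1 l2]] := tripod w p0 pz gp.
have := d_tri y (p k) w; have := d_tri (p k) (p l) w.
rewrite (geod_dist gp) // (d_sym y (p k)) (d_sym z w); lia.
Qed.

End AreaHyperbolic.

(** * The geometry of relatively hyperbolic groups *)

Section Edges.
Variable T : eqType.

Lemma edges_cat (x : T) s t : zip (x :: s ++ t) (s ++ t) =
  zip (x :: s) s ++ zip (last x s :: t) t.
Proof. by elim: s x => [|y s IH] x //=; rewrite IH. Qed.

Lemma edges_seg (f : nat -> T) i m (p : T * T) :
  p \in zip (f i :: seg f i m) (seg f i m) ->
  exists j, [/\ i <= j, j < i + m & p = (f j, f j.+1)].
Proof.
elim: m i => [|m IH] i //=; rewrite inE => /predU1P [->|/(IH i.+1) [j [j1 j2 ->]]].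
  by exists i; split=> //; lia.
by exists j; split=> //; lia.
Qed.

Lemma geod_of_steps (d : T -> T -> nat) (p : nat -> T) n :
  (forall x, d x x = 0) -> (forall x y z, d x z <= d x y + d y z) ->
  (forall i, i < n -> d (p i) (p i.+1) <= 1) -> n <= d (p 0) (p n) -> geod d p n.
Proof.
move=> d0 dt st dn.
have up i m : i + m <= n -> d (p i) (p (i + m)) <= m.
  elim: m => [|m IH] im; first by rewrite addn0 d0.
  rewrite addnS; have := dt (p i) (p (i + m)) (p (i + m).+1).
  have := st (i + m); rewrite addnS in im; move: (IH (ltnW im)); lia.
move=> i j ij jn; apply/eqP; rewrite eqn_leq; apply/andP; split.
  by have := up i (j - i); rewrite subnKC //; apply.
have := dt (p 0) (p i) (p n); have := dt (p i) (p j) (p n).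
have := up 0 i; have := up j (n - j); rewrite subnKC // add0n; lia.
Qed.

End Edges.

Section RelativelyHyperbolicGeometry.
Local Open Scope classical_set_scope.
Local Open Scope nat_scope.
#[local] Bind Scope group_scope with Group.sort.
Variables (R : realType) (G : groupType) (L : Type) (H : L -> subgroup G).
Variable X : set G.
Hypothesis finX : finite_set X.
Hypothesis symX : forall x, X x -> X x^-1%g.
Hypothesis genX : rel_generating H X.
Variables (rels : set (rel_free H X)).
Hypothesis finrels : finite_set rels.
Hypothesis relsP : rel_presentation rels.
Hypothesis isoP : linear_rel_isoperimetric R rels.

Local Notation len := (rel_len symX genX).
Local Notation d := (dist len).
Local Notation e := (fun u v : G => (d u v <= 1)%N).
Local Notation ball := (relator_ball rels).

Let lenP : is_length len := word_len_length (rel_letters_sym symX) genX.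
Let d_id := dist_id lenP.
Let d_sym := dist_sym lenP.
Let d_tri x y z : d x z <= d x y + d y z := dist_tri lenP y x z.

Lemma rel_geodesic1 n x : len x = n -> exists p, [/\ p 0 = 1%g, p n = x &
  forall i, i < n -> d (p i) (p i.+1) <= 1].
Proof.
elim: n x => [|n IH] x E.
  by exists (fun _ => 1%g); split=> //; rewrite (word_len_eq0 E).
have [s [y [-> s1 /IH [p [p0 pn st]]]]] := word_len_first E.
exists (fun i => if i is j.+1 then (s * p j)%g else 1%g); split=> //.
  by rewrite pn.
case=> [_|i i1]; first by rewrite p0 mulg1 dist1.
by rewrite dist_mul; apply: st.
Qed.

Lemma rel_geodesic x y :
  exists p, [/\ p 0 = x, p (d x y) = y & geod d p (d x y)].
Proof.
have [p [p0 pn st]] := @rel_geodesic1 (d x y) (x^-1 * y)%g erefl.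
exists (fun i => x * p i)%g; rewrite p0 pn mulg1 mulVKg; split=> //.
apply: geod_of_steps => //; last by rewrite p0 pn dist_mul dist1.
by move=> i i1; rewrite dist_mul; apply: st.
Qed.

Lemma rel_four_point : exists delta, four_point len delta.
Proof.
have [C areaC] := area_inequality symX genX finrels relsP isoP.
exists (4 * (252 * C + 3)) => x y z w.
apply: (area_four_point d_id d_sym d_tri rel_geodesic) => {x y z w}.
exact: (rectangle d_id d_sym d_tri areaC).
Qed.

(** * Long elements built from a deep peripheral element *)

Section Zigzag.
Variables (l : L) (a g : G).
Local Notation H0 := (sg_set (H l)).
Hypotheses (Ha : H0 a) (ng : ~ H0 g) (g1 : len g <= 1).
Local Notation b := (a * g)%g.

Fixpoint zigzag (x : G) (n : nat) : seq G :=
  if n is m.+1 then [:: x * a, x * b & zigzag (x * b) m]%g else [::].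

Lemma last_zigzag x n : last x (zigzag x n) = (x * b ^+ n)%g.
Proof.
elim: n x => [|n IH] x /=; first by rewrite mulg1.
by rewrite IH expgS !mulgA.
Qed.

Lemma size_zigzag x n : size (zigzag x n) = 2 * n.
Proof. by elim: n x => //= n IH x; rewrite IH; lia. Qed.

Lemma path_zigzag x n : path e x (zigzag x n).
Proof.
have a1 : len a <= 1 by exact: rel_len_per Ha.
elim: n x => //= n IH x; rewrite IH dist_mulr a1 andbT /=.
by rewrite mulgA dist_mulr.
Qed.

Lemma edges_zigzag x n p : p \in zip (x :: zigzag x n) (zigzag x n) ->
  exists2 i, i < n & p = (x * b ^+ i, x * b ^+ i * a)%g \/
    p = (x * b ^+ i * a, x * b ^+ i.+1)%g.
Proof.
elim: n x => [//|n IH] x; rewrite /= !inE => /or3P [/eqP ->|/eqP ->|/IH].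
- by exists 0 => //; left; rewrite expg0 mulg1.
- by exists 0 => //; right; rewrite expg0 mulg1 expg1.
- move=> [i i1 E]; exists i.+1 => //.
  have bE j : (x * b * b ^+ j = x * b ^+ j.+1)%g by rewrite expgS -mulgA.
  by move: E; rewrite !bE.
Qed.

Lemma edge_zigzag_coset y x n p : p \in zip (x :: zigzag x n) (zigzag x n) ->
  H0 (y^-1 * p.1)%g -> H0 (y^-1 * p.2)%g ->
  exists2 i, i < n & H0 (y^-1 * (x * b ^+ i))%g.
Proof.
move=> /edges_zigzag [i i1 [->|->]] /= h1 h2; exists i => //.
case: ng; have -> : (g = (y^-1 * (x * b ^+ i * a))^-1 * (y^-1 * (x * b ^+ i.+1)))%g.
  by rewrite expgSr !gnorm.
by apply: sgM => //; exact: sgV.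
Qed.

Variable C : nat.
Hypothesis isolC : forall l y v s,
  sg_set (H l) (y^-1 * v)%g -> path e v s -> last v s = y ->
  (forall p, p \in zip (v :: s) s -> p.1 <> p.2 ->
     ~ (sg_set (H l) (y^-1 * p.1)%g /\ sg_set (H l) (y^-1 * p.2)%g)) ->
  ball (C * (size s).+1) (y^-1 * v)%g.

Variable D : nat.
Hypothesis nball : ~ ball (C * (4 * D + 8)) a.

(** If [b ^+ k] were the first power in the subgroup, the zigzag from [b] to [b ^+ k] would close up
    through a peripheral edge to [a]. Minimality isolates the edge from [b] to [b * a], which would
    put [a] into the ball. *)
Lemma zigzag_cosets k : 0 < k -> k <= D.+1 -> ~ H0 (b ^+ k)%g.
Proof.
have Hb : ~ H0 b.
  move=> Hb; apply: ng; rewrite -(mulKg a g); apply: sgM => //; exact: sgV.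
elim/ltn_ind: k => -[|[|k]] IH // _ kD Hk.
apply: nball.
pose s := behead (zigzag b k.+1) ++ [:: a; b].
have sz : C * (size s).+1 <= C * (4 * D + 8).
  by rewrite leq_mul2l size_cat size_behead size_zigzag /=; apply/orP; right; lia.
apply: (relator_ball_mono sz).
have -> : a = (b^-1 * (b * a))%g by rewrite mulKg.
have pz := path_zigzag b k.+1; have lz := last_zigzag b k.+1.
have lz' : last (b * a)%g (behead (zigzag b k.+1)) = (b ^+ k.+2)%g.
  by rewrite -[RHS]lz.
have nb i : 0 < i -> i < k.+2 -> ~ H0 (b^-1 * (b * b ^+ i))%g.
  by move=> i0 ik; rewrite mulKg; apply: IH => //; lia.
apply: (isolC (l := l)).
- by rewrite mulKg.
- rewrite cat_path lz' /=; case/andP: pz => _ -> /=.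
  rewrite dist_mulr g1 !andbT.
  have -> : d (b ^+ k.+2) a = len (a^-1 * b ^+ k.+2) by rewrite d_sym.
  by apply: (rel_len_per symX genX (l := l)); apply: sgM => //; exact: sgV.
- by rewrite last_cat.
move=> p; rewrite edges_cat lz' mem_cat => /orP [pin|pin] _ [h1 h2].
  have pin' : p \in zip ((b * b)%g :: zigzag (b * b)%g k) (zigzag (b * b)%g k) \/
      p = (b * a, b * b)%g.
    by move: pin; rewrite /= inE => /predU1P [|]; [right|left].
  case: pin' => [|E].
    move=> /edge_zigzag_coset /(_ h1 h2) [i ik].
    have -> : (b * b * b ^+ i = b * b ^+ i.+1)%g by rewrite expgS -mulgA.
    by apply: nb => //; lia.
  by move: h2; rewrite E /= mulKg.
have nb1 : ~ H0 (b^-1 * b ^+ k.+2)%g by rewrite expgS; exact: nb.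
move: pin; rewrite !inE => /orP [] /eqP E; rewrite E /= in h1 h2 => //.
by apply: ng; move: h1; rewrite invgM mulgVK => /sgV; rewrite invgK.
Qed.

(* Were [b ^+ D.+1] short, the zigzag closed up by a geodesic would be a short
   loop; as no peripheral edge [a] may be isolated in it, the [D.+1] cosets
   would have to share the at most [D] edges of the geodesic. *)
Lemma zigzag_unbounded : D < len (b ^+ D.+1).
Proof.
rewrite ltnNge; apply/negP => lD.
have [p [p0 pn gp]] := rel_geodesic (b ^+ D.+1) 1.
set n := d _ _ in pn gp.
have nD : n <= D by rewrite /n d_sym dist1.
have pick (i : 'I_D.+1) : exists t : 'I_D,
    H0 ((b ^+ i)^-1 * p t)%g /\ H0 ((b ^+ i)^-1 * p t.+1)%g.
  apply: contrapT => no; apply: nball.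
  have [m mE] : exists m, D.+1 = i + m.+1.
    by exists (D - i); have := ltn_ord i; lia.
  pose z := behead (zigzag (b ^+ i) m.+1).
  pose s := z ++ seg p 0 n ++ zigzag 1%g i.
  have sz : C * (size s).+1 <= C * (4 * D + 8).
    rewrite leq_mul2l /s /z !size_cat size_behead !size_zigzag size_seg.
    by apply/orP; right; lia.
  apply: (relator_ball_mono sz).
  have -> : a = ((b ^+ i)^-1 * (b ^+ i * a))%g by rewrite mulKg.
  have pz := path_zigzag (b ^+ i) m.+1.
  have lz : last (b ^+ i * a)%g z = p 0.
    have bD : (b ^+ D.+1 = b ^+ i * b ^+ m.+1)%g by rewrite -expgnDr -mE.
    by rewrite p0 bD -[RHS](last_zigzag (b ^+ i) m.+1).
  have l2 : last (p 0) (seg p 0 n) = 1%g by rewrite last_seg add0n pn.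
  have coset (j : nat) : j != i -> j <= D -> ~ H0 ((b ^+ i)^-1 * b ^+ j)%g.
    move=> ji jD; case: (ltngtP j i) ji => // ji _.
      rewrite -(subnK (ltnW ji)) addnC expgnDr invgM mulgVK => /sgV.
      by rewrite invgK; apply: zigzag_cosets; have := ltn_ord i; lia.
    rewrite -(subnKC (ltnW ji)) expgnDr mulKg.
    by apply: zigzag_cosets; lia.
  apply: (isolC (l := l) (y := (b ^+ i)%g) (v := (b ^+ i * a)%g) (s := s)).
  - by rewrite mulKg.
  - rewrite /s !cat_path lz l2 (path_seg gp) // path_zigzag !andbT.
    by case/andP: pz.
  - by rewrite /s !last_cat lz l2 last_zigzag mul1g.
  move=> q; rewrite /s !edges_cat lz l2 !mem_cat => /or3P [qin|qin|qin] _ [h1 h2].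
  - have [qin'|E] : q \in zip ((b ^+ i * b)%g :: zigzag (b ^+ i * b)%g m)
        (zigzag (b ^+ i * b)%g m) \/ q = (b ^+ i * a, b ^+ i * b)%g.
      by move: qin; rewrite /z /= inE => /predU1P [|]; [right|left].
    have [j jm] := edge_zigzag_coset qin' h1 h2.
    have -> : (b ^+ i * b * b ^+ j = b ^+ (i + j.+1))%g.
      by rewrite expgnDr expgS -mulgA.
    by apply: coset; lia.
  - rewrite E /= !mulKg in h1 h2; apply: ng; rewrite -(mulKg a g).
    by apply: sgM => //; exact: sgV.
  - have [j [_ jn E]] := edges_seg qin; rewrite E /= in h1 h2.
    have jD : j < D by lia.
    by apply: no; exists (Ordinal jD).
  - have [j ji] := edge_zigzag_coset qin h1 h2; rewrite mul1g.
    by apply: coset; have := ltn_ord i; lia.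
have [f Hf] := choice pick.
suff finj : injective f.
  by have := leq_card f finj; rewrite !card_ord ltnn.
move=> i j fij; apply/eqP; apply: contraT => ij.
have key (i1 j1 : 'I_D.+1) : f i1 = f j1 -> i1 < j1 -> False.
  move=> E lt; have [h1 _] := Hf i1; have [h2 _] := Hf j1; rewrite -E in h2.
  apply: (@zigzag_cosets (j1 - i1)); [lia|have := ltn_ord j1; lia|].
  have bE : (b ^+ j1 = b ^+ i1 * b ^+ (j1 - i1))%g.
    by rewrite -expgnDr subnKC // ltnW.
  have -> : (b ^+ (j1 - i1) =
      ((b ^+ i1)^-1 * p (f i1)) * ((b ^+ j1)^-1 * p (f i1))^-1)%g.
    by rewrite bE !gnorm.
  by apply: sgM => //; exact: sgV.
by case: (ltngtP i j) => [/(key _ _ fij)|/(key _ _ (esym fij))|/val_inj /eqP] //;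
  rewrite (negbTE ij).
Qed.

End Zigzag.

Hypothesis properH : forall l, proper_subgroup (H l).
Hypothesis nonel : ~ elementary G.

Lemma finite_group_elementary : finite_set [set: G] -> elementary G.
Proof.
move=> finG.
have cl : group_closed (fun x => x \in [set 1%g : G]).
  split; first by apply/mem_set.
  by move=> x y /set_mem -> /set_mem ->; apply/mem_set; rewrite divg1.
exists (Subgroup cl); last exact: finite_image.
exists 1%g; apply/seteqP; split=> [x -> S|x]; first by move=> h; apply: h.
by move=> /(_ (Subgroup cl)); apply.
Qed.

Lemma finite_word_ball (S : set G) n : finite_set S -> finite_set (word_ball S n).
Proof.
move=> finS; elim: n => [|n IH]; first exact: finite_set1.
apply: (@sub_finite_set _ _ [set (s * y)%g | s in 1%g |` S & y in word_ball S n]).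
  by move=> x [s [y [Ss By ->]]]; exists s => //; exists y.
by apply: finite_image2 => //; rewrite finite_setU; split.
Qed.

(** Either some peripheral element lies outside the finite ball, and zigzags are long, or all
    letters lie in one finite set, and bounded length would make [G] finite. *)
Lemma rel_len_unbounded D : exists x, D < len x.
Proof.
apply: contrapT => no.
have bd x : len x <= D by rewrite leqNgt; apply/negP => lt; apply: no; exists x.
have [C isolC] := isolated_component symX genX finrels relsP isoP.
have [[l [a [Ha na]]]|fin] := pselect (exists l a, sg_set (H l) a /\
    ~ ball (C * (4 * D + 8)) a).
  have [g g1 ng] : exists2 g, len g <= 1 & ~ sg_set (H l) g.
    apply: contrapT => no'; apply: (properH (l := l)).
    apply/seteqP; split=> // x _.
    have : generated (rel_letters H X) x by rewrite genX.
    apply=> y Sy; apply: contrapT => ny; apply: no'; exists y => //.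
    exact: word_len_letter.
  by have := zigzag_unbounded Ha ng g1 isolC na; rewrite ltnNge bd.
apply/nonel/finite_group_elementary.
apply: (@sub_finite_set _ _ (word_ball (X `|` ball (C * (4 * D + 8))) D)).
  move=> x _; have := word_lenP (rel_letters_sym symX) genX x.
  have mono n k y : n <= k -> word_ball (rel_letters H X) n y ->
      word_ball (X `|` ball (C * (4 * D + 8))) k y.
    elim: k n y => [|k IH] [|n] y //= nk.
      move=> ->; exists 1%g, 1%g; rewrite mulg1; split=> //; first by left.
      exact: (IH 0).
    move=> [s [z [Ss Bz ->]]]; exists s, z; split=> //; last exact: (IH n).
    case: Ss => [->|[Xs|[l _ Hs]]]; [by left|by right; left|right; right].
    by apply: contrapT => nb; apply: fin; exists l, s.
  by apply: mono; exact: bd.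
apply: finite_word_ball; rewrite finite_setU; split=> //.
exact: finite_relator_ball.
Qed.

Lemma rel_loxodromic delta : four_point len delta ->
  exists h, len h + 2 * delta + 1 <= len (h ^+ 2).
Proof.
move=> hyp; set n := (7 * delta).+1.
have [x nx] := rel_len_unbounded (n + n).
have [p [p0 pn gp]] := rel_geodesic 1 x; rewrite dist1 in pn gp.
have lp i : i <= len x -> len (p i) = i.
  by move=> ix; rewrite -dist1 -[X in d X _]p0 gp // subn0.
(* Seen from its midpoint [p n], a geodesic of length [n + n] has ends [g1] and [g2] of length [n]
   without cancellation. *)
apply: (exists_loxodromic lenP hyp (n := n) (g1 := (p n)^-1%g)
    (g2 := ((p n)^-1 * p (n + n))%g)).
- exact: leqnn.
- by rewrite (lenV lenP) lp //; lia.
- by rewrite -/(d (p n) (p (n + n))) gp; lia.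
- by rewrite invgK mulVKg lp // ltnW.
Qed.

Fixpoint set_power (Z : set G) (n : nat) : set G :=
  if n is m.+1 then [set x * y | x in Z & y in set_power Z m]%g else [set 1%g].

Lemma finite_set_power Z n : finite_set Z -> finite_set (set_power Z n).
Proof.
by move=> fZ; elim: n => [|n IH] /=; [exact: finite_set1|exact: finite_image2].
Qed.

Lemma set_power_mono Z m n : Z 1%g -> m <= n -> set_power Z m `<=` set_power Z n.
Proof.
move=> Z1 /subnKC <-; elim: (n - m) => [|k IH]; first by rewrite addn0.
by rewrite addnS => x /IH Px; exists 1%g => //; exists x => //; rewrite mul1g.
Qed.

Lemma set_power_path Z (u : nat -> G) n :
  (forall a, a < n -> Z ((u a)^-1 * u a.+1)%g) -> set_power Z n ((u 0)^-1 * u n)%g.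
Proof.
elim: n u => [|n IH] u Zu /=; first by rewrite mulVg.
exists ((u 0)^-1 * u 1%N)%g; first exact: Zu.
exists ((u 1%N)^-1 * u n.+1)%g; last by rewrite !gnorm.
by apply: (IH (fun i => u i.+1)) => a an; apply: Zu.
Qed.

(** * Connectors between fellow-travelling geodesics *)

Section Connectors.
Variable C : nat.
Hypothesis isolC : forall l y v s,
  sg_set (H l) (y^-1 * v)%g -> path e v s -> last v s = y ->
  (forall p, p \in zip (v :: s) s -> p.1 <> p.2 ->
     ~ (sg_set (H l) (y^-1 * p.1)%g /\ sg_set (H l) (y^-1 * p.2)%g)) ->
  ball (C * (size s).+1) (y^-1 * v)%g.
Variables (kap : nat) (E : nat).
Hypothesis E_large : (kap + 1) * (kap + 3) + 3 * kap + 10 <= E.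

(** A finite substitute for the infinite alphabet. The radius fits loops made of two connectors of
    length at most [kap] and two stretches of length at most [E]. *)
Definition connector_letters : set G := X `|` ball (C * (2 * kap + 2 * E + 2)).

Lemma finite_connector_letters : finite_set connector_letters.
Proof. by rewrite finite_setU; split=> //; exact: finite_relator_ball. Qed.

Lemma connector_letters1 : connector_letters 1%g.
Proof. by right; apply: (relator_ball_mono (leq0n _)). Qed.

Section TwoGeodesics.
Variables (c c' : nat -> G) (gc : geod d c E) (gc' : geod d c' E).

Lemma coset_diam l y u v : sg_set (H l) (y^-1 * u)%g -> sg_set (H l) (y^-1 * v)%g ->
  d u v <= 1.
Proof.
move=> hu hv; apply: (rel_len_per symX genX (l := l)).
have -> : (u^-1 * v = (y^-1 * u)^-1 * (y^-1 * v))%g by rewrite !gnorm.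
by apply: sgM => //; exact: sgV.
Qed.

(* Once no shorter connector exists nearby, a peripheral edge of a geodesic
   connector can share its coset only with the edge of [c] or [c'] next to it;
   moving the endpoint along that edge makes every edge isolated in the loop
   closed up on the right. *)
Lemma minimal_connector i j D (u : nat -> G) : d (c E) (c' E) <= kap -> D <= kap ->
  i <= kap * (kap + 3) -> j <= kap * (kap + 3) ->
  u 0 = c i -> u D = c' j -> geod d u D -> 0 < D ->
  (forall k k', i <= k -> k <= i + kap + 3 -> j <= k' -> k' <= j + kap + 3 ->
     D <= d (c k) (c' k')) ->
  exists i' j', [/\ i' <= E, j' <= E &
    set_power connector_letters D ((c i')^-1 * c' j')%g].
Proof.
move=> cE Dk ib jb u0 uD gu D0 minD.
have pick a : exists o : option L, a < D ->
    if o is Some l then sg_set (H l) ((u a)^-1 * u a.+1)%g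
    else connector_letters ((u a)^-1 * u a.+1)%g.
  case: (ltnP a D) => aD; last by exists None.
  have : len ((u a)^-1 * u a.+1)%g <= 1.
    by have := gu a a.+1; rewrite /dist => -> //; lia.
  move=> /word_len_le1 [->|[Xu|[l _ Hu]]].
  - by exists None => _; exact: connector_letters1.
  - by exists None => _; left.
  - by exists (Some l).
have [lab Hlab] := choice pick.
pose left_moves := exists2 l, lab 0 = Some l & sg_set (H l) ((u 0)^-1 * c i.+1)%g.
pose right_moves := exists2 l, lab D.-1 = Some l &
  sg_set (H l) ((u D.-1)^-1 * c' j.+1)%g.
pose i' := if `[< left_moves >] then i.+1 else i.
pose j' := if `[< right_moves >] then j.+1 else j.
pose u' a := if a == 0 then c i' else if a == D then c' j' else u a.
have ii' : i <= i' /\ i' <= i.+1 by rewrite /i'; case: ifP; lia.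
have jj' : j <= j' /\ j' <= j.+1 by rewrite /j'; case: ifP; lia.
have u'0 : u' 0 = c i' by [].
have u'D : u' D = c' j' by rewrite /u' eqxx; case: eqP => // D00; lia.
have u'a a : 0 < a -> a < D -> u' a = u a.
  by move=> a0 aD; rewrite /u'; case: eqP => [|_]; [lia|case: eqP => //; lia].
have incoset a l : a < D -> lab a = Some l ->
    sg_set (H l) ((u a)^-1 * u' a)%g /\ sg_set (H l) ((u a)^-1 * u' a.+1)%g.
  move=> aD la; have Hl := Hlab a aD; rewrite la in Hl; split.
    case: (posnP a) => [a0|a0]; last by rewrite u'a // mulVg; exact: sg1.
    rewrite a0 u'0 /i' in la Hl *; case: asboolP => [[l' l1 l2]|_].
      by move: l1; rewrite la => -[->].
    by rewrite u0 mulVg; exact: sg1.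
  case: (ltngtP a.+1 D) => [aD'||aD']; [by rewrite u'a|lia|].
  rewrite aD' u'D /j'; have aD1 : D.-1 = a by lia.
  case: asboolP => [[l' l1 l2]|_]; last by rewrite -uD -aD'.
  by move: l1 l2; rewrite aD1 la => -[->].
have unmoved a : a < D -> lab a = None -> u' a = u a /\ u' a.+1 = u a.+1.
  move=> aD la; split.
    case: (posnP a) => [a0|a0]; last by rewrite u'a.
    rewrite a0 u'0 /i' u0; case: asboolP => // -[l' l1 _].
    by move: la; rewrite a0 l1.
  case: (ltngtP a.+1 D) => [aD'||aD']; [by rewrite u'a|lia|].
  have aD1 : D.-1 = a by lia.
  rewrite aD' u'D /j' uD; case: asboolP => // -[l' l1 _].
  by move: la; rewrite -aD1 l1.
have letters a : a < D -> lab a = None ->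
    connector_letters ((u' a)^-1 * u' a.+1)%g.
  move=> aD la; have Hl := Hlab a aD; rewrite la in Hl.
  by have [-> ->] := unmoved a aD la.
have step a : a < D -> d (u' a) (u' a.+1) <= 1.
  move=> aD; case la : (lab a) => [l|].
    by have [h1 h2] := incoset a l aD la; exact: coset_diam h1 h2.
  by have [-> ->] := unmoved a aD la; rewrite gu //; lia.
have gu' : geod d u' D.
  apply: geod_of_steps => //; rewrite u'0 u'D; apply: minD; lia.
exists i', j'; split; [lia|lia|].
rewrite -u'0 -u'D; apply: set_power_path => a aD.
case la : (lab a) => [l|]; last exact: letters.
right; have [w [w0 wn gw]] := rel_geodesic (c' E) (c E).
set n := d _ _ in wn gw; have nk : n <= kap by rewrite /n d_sym.
pose r m := c (E - m).
have gr : geod d r E by exact: geod_rev.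
pose s := seg u' a.+1 (D - a.+1) ++ seg c' j' (E - j') ++ seg w 0 n ++
  seg r 0 (E - i') ++ seg u' 0 a.
have sz : C * (size s).+1 <= C * (2 * kap + 2 * E + 2).
  by rewrite leq_mul2l /s !size_cat !size_seg; apply/orP; right; lia.
have lb1 : last (u' a.+1) (seg u' a.+1 (D - a.+1)) = c' j'.
  by rewrite last_seg subnKC.
have lb2 : last (c' j') (seg c' j' (E - j')) = w 0.
  by rewrite last_seg subnKC ?w0 //; lia.
have lb3 : last (w 0) (seg w 0 n) = r 0 by rewrite last_seg add0n wn /r subn0.
have lb4 : last (r 0) (seg r 0 (E - i')) = u' 0.
  by rewrite last_seg add0n /r subKn // ; lia.
have [h1 h2] := incoset a l aD la.
have back : sg_set (H l) ((u' a)^-1 * u' a.+1)%g.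
  have -> : ((u' a)^-1 * u' a.+1 = ((u a)^-1 * u' a)^-1 * ((u a)^-1 * u' a.+1))%g.
    by rewrite !gnorm.
  by apply: sgM => //; exact: sgV.
apply: (relator_ball_mono sz); apply: (isolC (l := l)) => //.
- rewrite /s !cat_path lb1 lb2 lb3 lb4; apply/and5P; split;
    [apply: (path_seg gu')|apply: (path_seg gc')|apply: (path_seg gw)
    |apply: (path_seg gr)|apply: (path_seg gu')]; lia.
- by rewrite /s !last_cat lb1 lb2 lb3 lb4 last_seg.
have near z : sg_set (H l) ((u' a)^-1 * z)%g ->
    [/\ d (u' a) z <= 1, d (u' a.+1) z <= 1 & sg_set (H l) ((u a)^-1 * z)%g].
  move=> hz; split.
  - by apply: (coset_diam (y := u' a) (l := l)) => //; rewrite mulVg; exact: sg1.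
  - exact: (coset_diam back hz).
  - have -> : ((u a)^-1 * z = ((u a)^-1 * u' a) * ((u' a)^-1 * z))%g by rewrite !gnorm.
    exact: sgM.
have not_u' b : b < D -> b != a -> sg_set (H l) ((u' a)^-1 * u' b)%g ->
    sg_set (H l) ((u' a)^-1 * u' b.+1)%g -> False.
  move=> bD ba /near [b1 b2 _] /near [b3 b4 _].
  move: b1 b2 b3 b4; rewrite !(geod_dist d_sym gu'); lia.
have d0a : d (c i') (u' a) = a by rewrite -u'0 gu' ?subn0 //; lia.
have daD : d (u' a.+1) (c' j') = D - a.+1 by rewrite -u'D gu'.
(* By minimality such an edge of [c] can only start at [c i] and meet the first edge of the
   connector, the case removed by passing to [i']. *)
have not_c m : i' <= m -> m < E -> sg_set (H l) ((u' a)^-1 * c m)%g ->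
    sg_set (H l) ((u' a)^-1 * c m.+1)%g -> False.
  move=> im mE /near [b1 b2 b3] /near [b4 b5 b6].
  have dm : d (c i') (c m) <= a + 1.
    by have := d_tri (c i') (u' a) (c m); rewrite d0a; lia.
  rewrite gc in dm; [|lia|lia].
  have : D <= d (c m) (c' j') by apply: minD; lia.
  have := d_tri (c m) (u' a.+1) (c' j'); rewrite daD (d_sym (c m) (u' a.+1)) => t1 t2.
  have a0 : a = 0 by lia.
  have mi : m = i.
    have : d (u 0) (c m.+1) <= 1.
      apply: (coset_diam (y := u 0) (l := l)); first by rewrite mulVg; exact: sg1.
      by rewrite -a0.
    by rewrite u0 gc; lia.
  have : left_moves by exists l; rewrite -?a0 // -mi.
  by move=> /asboolP lm; move: im; rewrite /i' lm mi ltnn.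
have not_c' m : j' <= m -> m < E -> sg_set (H l) ((u' a)^-1 * c' m)%g ->
    sg_set (H l) ((u' a)^-1 * c' m.+1)%g -> False.
  move=> jm mE /near [b1 b2 b3] /near [b4 b5 b6].
  have dm : d (c' j') (c' m) <= D - a.+1 + 1.
    have := d_tri (c' j') (u' a.+1) (c' m); rewrite (d_sym (c' j') (u' a.+1)) daD; lia.
  rewrite gc' in dm; [|lia|lia].
  have : D <= d (c i') (c' m) by apply: minD; lia.
  have := d_tri (c i') (u' a) (c' m); rewrite d0a => t1 t2.
  have aD1 : D.-1 = a by lia.
  have mj : m = j.
    have : d (u D) (c' m.+1) <= 1.
      apply: (coset_diam (y := u a) (l := l)) => //.
      by have := Hlab a aD; rewrite la -aD1 prednK.
    by rewrite uD gc'; lia.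
  have : right_moves by exists l; rewrite aD1 // -mj.
  by move=> /asboolP rm; move: jm; rewrite /j' rm mj ltnn.
(* The closing connector sits at parameter [E], out of reach of [c i'], where [i'] is at most
   [kap * (kap + 3) + 1]. *)
have not_w m : m <= n -> sg_set (H l) ((u' a)^-1 * w m)%g -> False.
  move=> mn /near [b1 _ _].
  have := d_tri (c i') (u' a) (c E); have := d_tri (u' a) (w m) (c E).
  rewrite d0a gc; [|lia|lia].
  by rewrite -wn gw // => t1 t2; lia.
move=> p; rewrite /s !edges_cat lb1 lb2 lb3 lb4 !mem_cat => /orP[|/or4P[|||]];
  move=> /edges_seg [b [b1 b2 ->]] _ /= [p1 p2].
- by apply: (not_u' b) => //; lia.
- by apply: (not_c' b) => //; lia.
- by apply: (not_w b) => //; lia.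
- apply: (not_c (E - b.+1)); [lia|lia|exact: p2|].
  by have -> : (E - b.+1).+1 = E - b by lia.
- by apply: (not_u' b) => //; lia.
Qed.

(** Descend to shorter connectors starting within the next [kap + 3] parameters. The distance drops
    at most [kap] times, so the search ends within [kap * (kap + 3)] of the start, where the
    minimality needed above holds. *)
Lemma exists_connector : (forall i, i <= E -> d (c i) (c' i) <= kap) ->
  exists i j, [/\ i <= E, j <= E &
    set_power connector_letters kap ((c i)^-1 * c' j)%g].
Proof.
move=> near.
have Eb : kap * (kap + 3) <= E by nia.
have main D i j : d (c i) (c' j) = D -> D <= kap ->
    i <= (kap - D) * (kap + 3) -> j <= (kap - D) * (kap + 3) ->
    exists i j, [/\ i <= E, j <= E &
      set_power connector_letters kap ((c i)^-1 * c' j)%g].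
  elim/ltn_ind: D i j => D IH i j dD Dk ib jb.
  have bound : (kap - D) * (kap + 3) <= kap * (kap + 3).
    by rewrite leq_mul2r leq_subr orbT.
  have [[k [k' [k1 k2 k3 k4 k5]]]|no] := pselect (exists k k',
      [/\ i <= k, k <= i + kap + 3, j <= k', k' <= j + kap + 3 &
       d (c k) (c' k') < D]).
    have mono : (kap - D).+1 * (kap + 3) <= (kap - d (c k) (c' k')) * (kap + 3).
      by rewrite leq_mul2r; apply/orP; right; lia.
    rewrite mulSn in mono.
    by apply: (IH _ k5 k k') => //; lia.
  have minD k k' : i <= k -> k <= i + kap + 3 -> j <= k' -> k' <= j + kap + 3 ->
      D <= d (c k) (c' k').
    move=> k1 k2 k3 k4; rewrite leqNgt; apply/negP => lt.
    by apply: no; exists k, k'; split.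
  case: (posnP D) => D0.
    exists i, j; split; [lia|lia|].
    have -> : ((c i)^-1 * c' j = 1)%g.
      exact: (word_len_eq0 (etrans dD D0)).
    by apply: (set_power_mono connector_letters1 (leq0n _)).
  have [u [u0 uD gu]] := rel_geodesic (c i) (c' j); rewrite dD in uD gu.
  have [i' [j' [i'E j'E P]]] := minimal_connector (near E (leqnn E)) Dk
    (leq_trans ib bound) (leq_trans jb bound) u0 uD gu D0 minD.
  exists i', j'; split=> //.
  exact: (set_power_mono connector_letters1 Dk).
by apply: (main (d (c 0) (c' 0)) 0 0) => //; apply: near.
Qed.

End TwoGeodesics.
End Connectors.

(** An element [p] almost fixing [1] and [h ^+ M] moves each point of a geodesic [c] between them by
    at most [eps + delta]. A connector from [c i] to [p * c j] with letters in a finite set leaves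
    finitely many values for [p]. *)
Lemma rel_wpd delta h B : four_point len delta -> growing len B h -> wpd len h.
Proof.
move=> hyp hB eps M0.
have [C isolC] := isolated_component symX genX finrels relsP isoP.
pose kap := eps + delta.
pose E := (kap + 1) * (kap + 3) + 3 * kap + 10.
exists (maxn M0 E); first exact: leq_maxl.
set M := maxn M0 E.
have ME : E <= len (h ^+ M).
  by apply: leq_trans (len_grow0 lenP hB M); exact: leq_maxr.
have [c [c0 cl gc]] := rel_geodesic 1 (h ^+ M); rewrite dist1 in cl gc.
pose Y := set_power (connector_letters C kap E) kap.
exists [set c q.1 * y * (c q.2)^-1 | q in `I_E.+1 `*` `I_E.+1 & y in Y]%g.
  apply: finite_image2; first by apply: finite_setX; exact: finite_II.
  by apply: finite_set_power; exact: finite_connector_letters.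
move=> p p1 p2.
have gcE : geod d c E.
  by move=> i j ij jE; apply: gc => //; exact: leq_trans ME.
have gpc : geod d (fun i => p * c i)%g E by move=> i j ij jE; rewrite dist_mul gcE.
have near i : i <= E -> d (c i) (p * c i)%g <= kap.
  move=> iE; have il : i <= len (h ^+ M) by exact: leq_trans ME.
  have := hyp 1%g (c i) (h ^+ M)%g (p * c i)%g.
  have e1 : d 1 (c i) = i by rewrite -c0 gc // subn0.
  have e2 : d (c i) (h ^+ M) = len (h ^+ M) - i by rewrite -[X in d _ X]cl gc.
  have e3 : d 1 (p * c i) <= eps + i.
    by have := d_tri 1 p (p * c i); rewrite !dist1 dist_mulr -[len (c i)]dist1 e1; lia.
  have e4 : d (h ^+ M) (p * c i) <= eps + (len (h ^+ M) - i).
    have := d_tri (h ^+ M) (p * h ^+ M) (p * c i).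
    by rewrite dist_mul (d_sym _ (c i)) e2; lia.
  rewrite e1 dist1 e2 /kap; lia.
have [i [j [iE jE Yij]]] := exists_connector isolC (leqnn _) gcE gpc near.
exists (i, j) => //.
by exists ((c i)^-1 * (p * c j))%g => //; rewrite /= !gnorm.
Qed.

End RelativelyHyperbolicGeometry.

Import ComplexField.Normc.

(** * Square summable functions *)

Section RealSums.
Local Open Scope classical_set_scope.
Local Open Scope ring_scope.
Variables (R : realType) (Q : groupType).
Implicit Types (a b u v : Q -> R).

Definition nsum a : \bar R := (\esum_(x in [set: Q]) (a x)%:E)%E.

Definition absum u := (nsum (fun x => `|u x|%R) < +oo)%E.

Lemma nsum_ge0 a : (forall x, 0 <= a x) -> (0 <= nsum a)%E.
Proof. by move=> a0; apply: esum_ge0 => x _; rewrite lee_fin. Qed.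

Lemma nsumD a b : (forall x, 0 <= a x) -> (forall x, 0 <= b x) ->
  (nsum (fun x => (a x + b x)%R) = nsum a + nsum b)%E.
Proof.
move=> a0 b0; rewrite /nsum -esumD => [|x _|x _]; rewrite ?lee_fin //.
Qed.

Lemma le_nsum a b : (forall x, a x <= b x) -> (nsum a <= nsum b)%E.
Proof. by move=> ab; apply: le_esum => x _; rewrite lee_fin. Qed.

Lemma nsumZ_le (c : R) a : 0 <= c -> (forall x, 0 <= a x) ->
  (nsum (fun x => (c * a x)%R) <= c%:E * nsum a)%E.
Proof.
move=> c0 a0; apply: ge_ereal_sup => _ [X [finX _] <-].
rewrite (eq_fsbigr (fun x => c%:E * (a x)%:E)%E) => [|x _]; last by rewrite EFinM.
rewrite -ge0_mule_fsumr; last by move=> x; rewrite lee_fin.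
apply: lee_wpmul2l; first by rewrite lee_fin.
by apply: ereal_sup_ubound; exists X.
Qed.

Lemma nsumZ (c : R) a : 0 <= c -> (forall x, 0 <= a x) ->
  (nsum (fun x => (c * a x)%R) = c%:E * nsum a)%E.
Proof.
move=> c0 a0; apply/eqP; rewrite eq_le nsumZ_le //=.
have [->|cn0] := eqVneq c 0.
  by rewrite mul0e; apply: nsum_ge0 => x; rewrite mul0r.
have ci0 : 0 <= c^-1 by rewrite invr_ge0.
have := nsumZ_le ci0 (fun x => mulr_ge0 c0 (a0 x)).
have -> : (fun x => c^-1 * (c * a x)) = a.
  by apply/funext => x; rewrite mulrA mulVf ?mul1r.
have cE : (0 <= c%:E)%E by rewrite lee_fin.
move=> /(lee_wpmul2l cE) /le_trans; apply.
by rewrite muleA -EFinM divff ?mul1e.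
Qed.

Lemma nsum_translate a (g : Q) : (forall x, 0 <= a x) ->
  nsum (fun x => a (g * x)%g) = nsum a.
Proof.
move=> a0; rewrite /nsum [RHS](@reindex_esum _ _ _ setT setT (fun h : Q => (g * h)%g)) //.
split=> // [x y _ _|y _]; first exact: mulgI.
by exists (g^-1 * y)%g => //; rewrite mulVKg.
Qed.

Lemma nsum_fin a : (forall x, 0 <= a x) -> (nsum a < +oo)%E ->
  ((fine (nsum a))%:E = nsum a)%E.
Proof.
by move=> a0 ha; rewrite fineK // ge0_fin_numE // nsum_ge0.
Qed.

Lemma absumD u v : absum u -> absum v -> absum (fun x => u x + v x).
Proof.
move=> hu hv; apply: le_lt_trans (lte_add_pinfty hu hv).
by rewrite -nsumD //; apply: le_nsum => x; exact: ler_normD.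
Qed.

Lemma absumZ c u : absum u -> absum (fun x => c * u x).
Proof.
move=> hu; rewrite /absum.
have -> : (fun x => `|c * u x|) = (fun x => `|c| * `|u x|).
  by apply/funext => x; rewrite normrM.
by rewrite nsumZ // lte_mul_pinfty.
Qed.

Lemma absum_le u a : (forall x, `|u x| <= a x) -> (nsum a < +oo)%E -> absum u.
Proof. by move=> ua; apply: le_lt_trans; exact: le_nsum. Qed.

(** Any decomposition into nonnegative summable parts computes [rsum]; linearity rests on this
    freedom, since positive parts are not additive. *)
Lemma rsum_sub a b : (forall x, 0 <= a x) -> (forall x, 0 <= b x) ->
  (nsum a < +oo)%E -> (nsum b < +oo)%E ->
  rsum (fun x => a x - b x) = fine (nsum a) - fine (nsum b).
Proof.
move=> a0 b0 fa fb.
have sm c : (forall x, 0 <= c x) -> (nsum c < +oo)%E -> summable setT (EFin \o c).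
  move=> c0 fc; rewrite /summable; apply: le_lt_trans fc; apply: le_esum => x _.
  by rewrite /= ger0_norm.
have := @esumB _ _ setT (EFin \o a) (EFin \o b) (sm a a0 fa) (sm b b0 fb) _ _.
move=> /(_ (fun x _ => a0 x) (fun x _ => b0 x)) E.
set u := (EFin \o (fun x => a x - b x)).
have pos0 : (0 <= \esum_(x in [set: Q]) (u^\+ x))%E by apply: esum_ge0.
have neg0 : (0 <= \esum_(x in [set: Q]) (u^\- x))%E by apply: esum_ge0.
have posf : ((\esum_(x in [set: Q]) (u^\+ x)) < +oo)%E.
  apply: le_lt_trans fa; apply: le_esum => x _.
  by rewrite /u funeposE /= -EFin_max lee_fin ge_max a0 andbT lerBlDr lerDl b0.
have negf : ((\esum_(x in [set: Q]) (u^\- x)) < +oo)%E.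
  apply: le_lt_trans fb; apply: le_esum => x _.
  by rewrite /u funenegE /= -EFin_max lee_fin ge_max b0 andbT opprB lerBlDr lerDl a0.
have : (\esum_(x in [set: Q]) (u^\+ x) - \esum_(x in [set: Q]) (u^\- x) =
    nsum a - nsum b)%E by exact: E.
move=> /(congr1 fine); rewrite !fineB ?ge0_fin_numE ?nsum_ge0 //.
Qed.

Definition rpos u x := Num.max (u x) 0.
Definition rneg u x := Num.max (- u x) 0.

Lemma rposneg u : u = (fun x => rpos u x - rneg u x).
Proof.
apply/funext => x; rewrite /rpos /rneg; case: (lerP 0 (u x)) => ux.
  by rewrite max_r ?subr0 // oppr_le0.
by rewrite max_l ?sub0r ?opprK // oppr_ge0 ltW.
Qed.

Lemma rpos_ge0 u x : 0 <= rpos u x. Proof. by rewrite /rpos le_max lexx orbT. Qed.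
Lemma rneg_ge0 u x : 0 <= rneg u x. Proof. by rewrite /rneg le_max lexx orbT. Qed.

Lemma rpos_fin u : absum u -> (nsum (rpos u) < +oo)%E.
Proof.
apply: le_lt_trans; apply: le_nsum => x; rewrite /rpos ge_max normr_ge0 andbT.
exact: ler_norm.
Qed.

Lemma rneg_fin u : absum u -> (nsum (rneg u) < +oo)%E.
Proof.
apply: le_lt_trans; apply: le_nsum => x; rewrite /rneg ge_max normr_ge0 andbT.
by rewrite -normrN; exact: ler_norm.
Qed.

Lemma rsumE u : absum u -> rsum u = fine (nsum (rpos u)) - fine (nsum (rneg u)).
Proof.
move=> hu; rewrite {1}(rposneg u).
by apply: rsum_sub; [exact: rpos_ge0|exact: rneg_ge0|exact: rpos_fin|exact: rneg_fin].
Qed.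

Lemma rsumD u v : absum u -> absum v ->
  rsum (fun x => u x + v x) = rsum u + rsum v.
Proof.
move=> hu hv; rewrite (rsumE hu) (rsumE hv).
have -> : (fun x => u x + v x) =
    (fun x => (rpos u x + rpos v x) - (rneg u x + rneg v x)).
  by apply/funext => x; rewrite {1}(rposneg u) {1}(rposneg v) /=; ring.
have pu := rpos_ge0 u; have pv := rpos_ge0 v.
have nu := rneg_ge0 u; have nv := rneg_ge0 v.
have fin2 a b : (forall x, 0 <= a x) -> (forall x, 0 <= b x) ->
    (nsum a < +oo)%E -> (nsum b < +oo)%E -> (nsum (fun x => (a x + b x)%R) < +oo)%E.
  by move=> a0 b0 fa fb; rewrite nsumD // lte_add_pinfty.
have fD a b : (forall x, 0 <= a x) -> (forall x, 0 <= b x) ->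
    (nsum a < +oo)%E -> (nsum b < +oo)%E ->
    fine (nsum (fun x => (a x + b x)%R)) = fine (nsum a) + fine (nsum b).
  by move=> a0 b0 fa fb; rewrite nsumD // fineD // ge0_fin_numE ?nsum_ge0.
have := rpos_fin hu; have := rpos_fin hv; have := rneg_fin hu; have := rneg_fin hv.
move=> h1 h2 h3 h4.
rewrite (rsum_sub (a := fun x => rpos u x + rpos v x)
  (b := fun x => rneg u x + rneg v x)).
- rewrite (fD _ _ pu pv h4 h3) (fD _ _ nu nv h2 h1).
  by move: (fine _) (fine _) (fine _) (fine _) => p q r t; ring.
- by move=> x; rewrite addr_ge0.
- by move=> x; rewrite addr_ge0.
- exact: fin2.
- exact: fin2.
Qed.

Lemma rsumZ c u : absum u -> rsum (fun x => c * u x) = c * rsum u.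
Proof.
move=> hu; rewrite (rsumE hu).
have pu := rpos_ge0 u; have nu := rneg_ge0 u.
have fp := rpos_fin hu; have fn := rneg_fin hu.
have main k : 0 <= k -> forall a b, (forall x, 0 <= a x) -> (forall x, 0 <= b x) ->
    (nsum a < +oo)%E -> (nsum b < +oo)%E ->
    rsum (fun x => k * a x - k * b x) = k * (fine (nsum a) - fine (nsum b)).
  move=> k0 a b a0 b0 fa fb; rewrite rsum_sub ?nsumZ ?lte_mul_pinfty ?nsum_ge0 //.
  - by rewrite !fineM ?ge0_fin_numE ?nsum_ge0 ?ltry //= mulrBr.
  - by move=> x; rewrite mulr_ge0.
  - by move=> x; rewrite mulr_ge0.
have [c0|c0] := lerP 0 c.
  rewrite -main //; congr rsum; apply/funext => x.
  by rewrite {1}(rposneg u) /=; ring.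
have c0' : 0 <= - c by rewrite oppr_ge0 ltW.
have -> : c * (fine (nsum (rpos u)) - fine (nsum (rneg u))) =
    (- c) * (fine (nsum (rneg u)) - fine (nsum (rpos u))) by ring.
rewrite -main //; congr rsum; apply/funext => x.
by rewrite {1}(rposneg u) /=; ring.
Qed.

Lemma rsum_ge0E a : (forall x, 0 <= a x) -> (nsum a < +oo)%E ->
  rsum a = fine (nsum a).
Proof.
move=> a0 fa; have := @rsum_sub a (fun _ => 0) a0 (fun _ => lexx 0) fa.
have -> : nsum (fun _ : Q => 0) = 0%E by apply: esum1.
move=> /(_ (ltry _)); rewrite subr0 => <-; congr rsum.
by apply/funext => x; rewrite subr0.
Qed.

Lemma absum_single u (x0 : Q) : (forall x, x != x0 -> u x = 0) ->
  absum u /\ rsum u = u x0.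
Proof.
move=> u0.
have single a : (forall x, 0 <= a x) -> (forall x, x != x0 -> a x = 0) ->
    nsum a = (a x0)%:E.
  move=> a0 az; rewrite /nsum (esumID [set x0]) => [|x _]; last by rewrite lee_fin.
  rewrite setTI esum_set1 ?lee_fin // esum1 ?adde0 // => x [_ /eqP xx0].
  by rewrite az.
have hu : absum u.
  rewrite /absum single ?ltry // => x /u0 ->; exact: normr0.
split=> //; rewrite rsumE // !single /=.
- by rewrite [RHS](congr1 (@^~ x0) (rposneg u)).
- exact: rneg_ge0.
- by move=> x /u0 ux; rewrite /rneg ux oppr0 maxxx.
- exact: rpos_ge0.
- by move=> x /u0 ux; rewrite /rpos ux maxxx.
Qed.

Lemma rsum_translate u (g : Q) : absum u -> rsum (fun x => u (g * x)%g) = rsum u.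
Proof.
move=> hu; have hg : absum (fun x => u (g * x)%g).
  by rewrite /absum (nsum_translate (a := fun x => `|u x|)).
by rewrite !rsumE // -(nsum_translate g (rpos_ge0 u)) -(nsum_translate g (rneg_ge0 u)).
Qed.

End RealSums.

Section ComplexNorm.
Local Open Scope ring_scope.
Local Open Scope complex_scope.
Variable R : realType.
Implicit Types z w : R[i].

Lemma normc_ge0 z : 0 <= normc z.
Proof. by case: z => a b; exact: sqrtr_ge0. Qed.

Lemma normc_sqr z : normc z ^+ 2 = complex.Re z ^+ 2 + complex.Im z ^+ 2.
Proof. by case: z => a b; rewrite /= sqr_sqrtr // addr_ge0 ?sqr_ge0. Qed.

Lemma normc_conj z : normc (conjc z) = normc z.
Proof. by case: z => a b; rewrite /= sqrrN. Qed.

Lemma Re_le_normc z : `|complex.Re z| <= normc z.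
Proof.
by rewrite -(@ler_pXn2r _ 2) ?nnegrE ?normc_ge0 // real_normK ?num_real //
  normc_sqr lerDl sqr_ge0.
Qed.

Lemma Im_le_normc z : `|complex.Im z| <= normc z.
Proof.
by rewrite -(@ler_pXn2r _ 2) ?nnegrE ?normc_ge0 // real_normK ?num_real //
  normc_sqr lerDr sqr_ge0.
Qed.

Lemma normc_le_ReIm z : normc z <= `|complex.Re z| + `|complex.Im z|.
Proof.
rewrite -(@ler_pXn2r _ 2) ?nnegrE ?normc_ge0 ?addr_ge0 // normc_sqr sqrrD.
rewrite !real_normK ?num_real // -addrA [X in _ <= _ + X]addrC lerD2l lerDl.
by rewrite mulrn_wge0 // mulr_ge0.
Qed.

Lemma normc_real (a : R) : normc (a%:C) = `|a|.
Proof. by rewrite /= expr0n addr0 sqrtr_sqr. Qed.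

Lemma mulc_conj z : z * conjc z = (normc z ^+ 2)%:C.
Proof.
rewrite normc_sqr; case: z => a b; apply/eqP; rewrite eq_complex /=.
by apply/andP; split; apply/eqP; ring.
Qed.

End ComplexNorm.

(** * The Hilbert space: Cauchy-Schwarz and completeness *)

Section InnerProduct.
Local Open Scope classical_set_scope.
Local Open Scope ring_scope.
Local Open Scope complex_scope.
Variables (R : realType) (Q : groupType).
Local Notation H := (ell2 R Q).
Local Notation C := R[i].
Implicit Types f g k : H.

Definition sqfun (f : Q -> C) (x : Q) : R := normc (f x) ^+ 2.

Lemma sqfun_ge0 f x : 0 <= sqfun f x. Proof. exact: sqr_ge0. Qed.

Lemma sqfun_fin f : (nsum (sqfun f) < +oo)%E.
Proof. by have /asboolP := ell2P f. Qed.

Lemma l2norm_ge0 f : 0 <= l2norm f. Proof. exact: sqrtr_ge0. Qed.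

Lemma l2norm_sqr f : l2norm f ^+ 2 = fine (nsum (sqfun f)).
Proof.
by rewrite /l2norm sqr_sqrtr // fine_ge0 // nsum_ge0 // => x; exact: sqfun_ge0.
Qed.

Lemma l2norm_sqrE f : ((l2norm f ^+ 2)%:E = nsum (sqfun f))%E.
Proof. by rewrite l2norm_sqr nsum_fin //; [exact: sqfun_ge0|exact: sqfun_fin]. Qed.

Lemma l2norm_le f M : 0 <= M -> (nsum (sqfun f) <= (M ^+ 2)%:E)%E -> l2norm f <= M.
Proof.
move=> M0; rewrite -l2norm_sqrE lee_fin => h.
by rewrite -(@ler_pXn2r _ 2) ?nnegrE ?l2norm_ge0.
Qed.

Lemma absum_prod f g (P : C -> R) : (forall z, `|P z| <= normc z) ->
  absum (fun x => P (f x * conjc (g x))).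
Proof.
move=> HP; apply: (@absum_le _ _ _ (fun x => sqfun f x + sqfun g x)).
  move=> x; apply: le_trans (HP _) _; rewrite normcM normc_conj /sqfun.
  have := normc_ge0 (f x); have := normc_ge0 (g x).
  move: (normc (f x)) (normc (g x)) => a b b0 a0.
  have : 0 <= (a - b) ^+ 2 by exact: sqr_ge0.
  by have : 0 <= a * b by [exact: mulr_ge0]; rewrite sqrrB; lra.
rewrite nsumD; [|exact: sqfun_ge0|exact: sqfun_ge0].
by apply: lte_add_pinfty; exact: sqfun_fin.
Qed.

Let absRe f g := absum_prod f g (@Re_le_normc R).
Let absIm f g := absum_prod f g (@Im_le_normc R).

Lemma l2innerDl (a : C) f g k :
  l2inner (a *: f + g) k = a * l2inner f k + l2inner g k.
Proof.
have fE x : (a *: f + g) x = a * f x + g x by [].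
case: a fE => a b fE; apply/eqP; rewrite eq_complex /l2inner /=.
have h1 := absRe f k; have h2 := absIm f k; have h3 := absRe g k; have h4 := absIm g k.
apply/andP; split; apply/eqP.
  rewrite -mulNr -!rsumZ // -rsumD; try exact: absumZ.
  rewrite -rsumD //; last by apply: absumD; exact: absumZ.
  congr rsum; apply/funext => x.
  rewrite -[(_ + ell2_fun g) x]/((a +i* b) * f x + g x).
  by case: (f x) (g x) (k x) => [? ?] [? ?] [? ?] /=; ring.
rewrite -!rsumZ // -rsumD; try exact: absumZ.
rewrite -rsumD //; last by apply: absumD; exact: absumZ.
congr rsum; apply/funext => x.
  rewrite -[(_ + ell2_fun g) x]/((a +i* b) * f x + g x).
by case: (f x) (g x) (k x) => [? ?] [? ?] [? ?] /=; ring.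
Qed.

Lemma l2inner_conj f g : l2inner g f = conjc (l2inner f g).
Proof.
apply/eqP; rewrite eq_complex /l2inner /=; apply/andP; split; apply/eqP.
  congr rsum; apply/funext => x.
  by case: (f x) (g x) => [? ?] [? ?] /=; ring.
rewrite -mulN1r -rsumZ; last exact: absIm.
by congr rsum; apply/funext => x; case: (f x) (g x) => [? ?] [? ?] /=; ring.
Qed.

Lemma l2inner_norm f : l2inner f f = (l2norm f ^+ 2)%:C.
Proof.
apply/eqP; rewrite eq_complex /l2inner /=; apply/andP; split; apply/eqP.
  rewrite l2norm_sqr -rsum_ge0E; [|exact: sqfun_ge0|exact: sqfun_fin].
  congr rsum; apply/funext => x; rewrite /sqfun normc_sqr.
  by case: (f x) => [? ?] /=; ring.
have := @absum_single R Q (fun _ => 0) 1%g (fun _ _ => erefl) => -[_ <-].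
congr rsum; apply/funext => x.
by case: (f x) => [? ?] /=; ring.
Qed.

Lemma l2norm_coord f x : normc (f x) <= l2norm f.
Proof.
rewrite -(@ler_pXn2r _ 2) ?nnegrE ?l2norm_ge0 ?normc_ge0 // -lee_fin l2norm_sqrE.
rewrite /nsum (esumID [set x]) => [|y _]; last by rewrite lee_fin sqfun_ge0.
rewrite setTI esum_set1 ?lee_fin ?sqfun_ge0 // leeDl //.
by apply: esum_ge0 => y _; rewrite lee_fin sqfun_ge0.
Qed.

Lemma ell2_eq f g : (forall x, f x = g x) -> f = g.
Proof. by move=> fg; apply: val_inj; apply/funext. Qed.

Lemma l2norm_eq0 f : l2norm f = 0 -> f = 0.
Proof.
move=> f0; apply: ell2_eq => x; apply: eq0_normc; apply/eqP.
by rewrite eq_le normc_ge0 andbT -f0 l2norm_coord.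
Qed.

Lemma l2inner0l g : l2inner 0 g = 0.
Proof.
have := l2innerDl 1 0 0 g; rewrite scaler0 addr0 mul1r => /eqP.
by rewrite -subr_eq subrr eq_sym => /eqP.
Qed.

Lemma l2innerDr (a : C) f g k :
  l2inner k (a *: f + g) = conjc a * l2inner k f + l2inner k g.
Proof.
by rewrite [LHS]l2inner_conj (l2inner_conj f k) (l2inner_conj g k) l2innerDl
  rmorphD rmorphM.
Qed.

Lemma l2innerZl (a : C) f k : l2inner (a *: f) k = a * l2inner f k.
Proof. by rewrite -[a *: f]addr0 l2innerDl l2inner0l addr0. Qed.

Lemma l2innerZr (a : C) f k : l2inner k (a *: f) = conjc a * l2inner k f.
Proof. by rewrite [LHS]l2inner_conj l2innerZl rmorphM (l2inner_conj f k). Qed.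

Lemma l2inner_expand (c : C) f g : (l2norm (f - c *: g) ^+ 2)%:C =
  (l2norm f ^+ 2)%:C - c * l2inner g f - conjc c * l2inner f g
  + c * conjc c * (l2norm g ^+ 2)%:C.
Proof.
rewrite -l2inner_norm addrC -scaleNr l2innerDl !l2innerDr !l2inner_norm rmorphN.
by rewrite /=; ring.
Qed.

Lemma cauchy_schwarz f g : normc (l2inner f g) <= l2norm f * l2norm g.
Proof.
have [g0|gn0] := eqVneq (l2norm g) 0.
  rewrite (l2norm_eq0 g0) l2inner_conj l2inner0l.
  by rewrite conjc0 normc0 mulr_ge0 ?l2norm_ge0.
have gp : 0 < l2norm g by rewrite lt_neqAle eq_sym gn0 l2norm_ge0.
rewrite -(@ler_pXn2r _ 2) ?nnegrE ?normc_ge0 ?mulr_ge0 ?l2norm_ge0 //.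
set z := l2inner f g; set a := l2norm g ^+ 2.
have a0 : 0 < a by exact: exprn_gt0.
have := l2inner_expand (z * (a^-1)%:C) f g.
rewrite l2inner_conj -/z -/a.
have -> : conjc (z * (a^-1)%:C) = conjc z * (a^-1)%:C.
  by rewrite rmorphM; congr (_ * _); exact: conjc_real.
have aa : (a^-1)%:C * a%:C = 1 by rewrite -rmorphM /= mulVf // gt_eqF.
have -> : (l2norm f ^+ 2)%:C - z * (a^-1)%:C * conjc z - conjc z * (a^-1)%:C * z +
    z * (a^-1)%:C * (conjc z * (a^-1)%:C) * a%:C =
    (l2norm f ^+ 2)%:C - (z * conjc z) * (a^-1)%:C * (2 - (a^-1)%:C * a%:C) by ring.
rewrite aa mulc_conj.
have -> : 2 - 1 = 1 :> C by ring.
rewrite mulr1 -rmorphM -rmorphB /= => /complexI E.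
have : 0 <= l2norm (f - z * (a^-1)%:C *: g) ^+ 2 by exact: sqr_ge0.
by rewrite E subr_ge0 ler_pdivrMr // exprMn.
Qed.

Lemma l2normD f g : l2norm (f + g) <= l2norm f + l2norm g.
Proof.
rewrite -(@ler_pXn2r _ 2) ?nnegrE ?addr_ge0 ?l2norm_ge0 //.
have := l2inner_expand (-1) f g; rewrite scaleN1r opprK => E.
have := congr1 (@complex.Re R) E.
rewrite l2inner_conj; have := cauchy_schwarz f g.
have := Re_le_normc (l2inner f g).
case: (l2inner f g) => [u v] /= h1 h2 ->.
have : u <= `|u| by exact: ler_norm.
by rewrite sqrrD; lra.
Qed.

Lemma l2normZ (a : C) f : l2norm (a *: f) = normc a * l2norm f.
Proof.
apply/eqP; rewrite -(@eqrXn2 _ 2) ?mulr_ge0 ?l2norm_ge0 ?normc_ge0 //.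
apply/eqP/(@complexI R); rewrite -l2inner_norm l2innerZl l2innerZr l2inner_norm.
by rewrite mulrA mulc_conj -rmorphM exprMn.
Qed.

Lemma l2norm0 : l2norm (0 : H) = 0.
Proof. by rewrite -(scale0r (0 : H)) l2normZ normc0 mul0r. Qed.

Lemma l2normN f : l2norm (- f) = l2norm f.
Proof. by rewrite -scaleN1r l2normZ normcN normc1 mul1r. Qed.

(* The limit is the supremum of the lower bounds [a n - eps n]. *)
Lemma cauchy_modulus (a : nat -> R) (eps : nat -> R) :
  (forall m n, (m <= n)%N -> `|a m - a n| <= eps m) ->
  exists l, forall n, `|a n - l| <= eps n.
Proof.
move=> ca.
have lu m n : a m - eps m <= a n + eps n.
  case: (leqP m n) => [mn|/ltnW mn].
    have := ca _ _ mn; have := ca n n (leqnn n).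
    rewrite !ler_norml; have := ler_norm (a n - a n); lra.
  have := ca _ _ mn; have := ca m m (leqnn m).
  by rewrite !ler_norml; lra.
pose S := [set a n - eps n | n in [set: nat]].
have S0 : S !=set0 by exists (a 0%N - eps 0%N); exists 0%N.
have Sub n : ubound S (a n + eps n) by move=> _ [m _ <-].
exists (sup S) => n; rewrite ler_norml.
have h1 : sup S <= a n + eps n by apply: ge_sup.
have h2 : a n - eps n <= sup S.
  by apply: ub_le_sup; [exists (a 0%N + eps 0%N)|exists n].
by move: h1 h2; lra.
Qed.

Lemma sum_sqfun_le (s : seq Q) f : uniq s -> \sum_(x <- s) sqfun f x <= l2norm f ^+ 2.
Proof.
move=> us; rewrite -lee_fin l2norm_sqrE -sumEFin.
rewrite fsbig_seq //.
apply: ereal_sup_ubound; exists [set` s] => //; split=> //; exact: finite_seq.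
Qed.

(** The limit is taken coordinatewise, real and imaginary parts costing [eps n] each. On finitely
    many coordinates, comparison with a late [v m] leaves [2 * eps n ^+ 2], a bound free of the set
    of coordinates. *)
Lemma l2_complete (v : nat -> H) (eps : nat -> R) :
  (forall m n, (m <= n)%N -> l2norm (v m - v n) <= eps m) ->
  (forall e, 0 < e -> exists N, forall n, (N <= n)%N -> eps n <= e) ->
  exists w, forall n, l2norm (v n - w) <= 2 * eps n.
Proof.
move=> cv e0.
have eps0 n : 0 <= eps n by apply: le_trans (cv n n (leqnn n)); exact: l2norm_ge0.
have [w Hw] : exists w : Q -> C, forall x n, normc (v n x - w x) <= 2 * eps n.
  have pick x : exists z : C, forall n, normc (v n x - z) <= 2 * eps n.
    have [|a Ha] := @cauchy_modulus (fun n => complex.Re (v n x)) eps.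
      move=> m n mn; apply: le_trans (cv m n mn).
      apply: le_trans (l2norm_coord (v m - v n) x); apply: le_trans (Re_le_normc _).
      rewrite -[(v m - v n) x]/(v m x - v n x).
      by case: (v m x) (v n x) => [? ?] [? ?]; exact: lexx.
    have [|b Hb] := @cauchy_modulus (fun n => complex.Im (v n x)) eps.
      move=> m n mn; apply: le_trans (cv m n mn).
      apply: le_trans (l2norm_coord (v m - v n) x); apply: le_trans (Im_le_normc _).
      rewrite -[(v m - v n) x]/(v m x - v n x).
      by case: (v m x) (v n x) => [? ?] [? ?]; exact: lexx.
    exists (a +i* b) => n; apply: le_trans (normc_le_ReIm _) _.
    have := Ha n; have := Hb n; case: (v n x) => [p q] /= h1 h2; lra.
  by have [w Hw] := choice pick; exists w.
have key (p q r y : R) : p <= q + r -> r <= y -> 0 <= p -> 0 <= q -> 0 <= r ->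
    p ^+ 2 <= 2 * q ^+ 2 + 2 * y ^+ 2.
  move=> c1 c2 c3 c4 c5.
  have : p ^+ 2 <= (q + r) ^+ 2 by rewrite ler_pXn2r ?nnegrE ?addr_ge0.
  have : 0 <= (q - r) ^+ 2 by exact: sqr_ge0.
  have : r ^+ 2 <= y ^+ 2 by rewrite ler_pXn2r ?nnegrE // (le_trans c5).
  rewrite sqrrB sqrrD; lra.
have fin n (s : seq Q) : uniq s ->
    \sum_(x <- s) sqfun (fun y => v n y - w y) x <= (2 * eps n) ^+ 2.
  move=> us.
  have bd m : (n <= m)%N -> \sum_(x <- s) sqfun (fun y => v n y - w y) x <=
      2 * eps n ^+ 2 + (size s)%:R * (2 * (2 * eps m) ^+ 2).
    move=> nm.
    have h1 : 2 * (\sum_(x <- s) sqfun (v n - v m : H) x) <= 2 * eps n ^+ 2.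
      rewrite ler_pM2l // (le_trans (sum_sqfun_le _ us)) //.
      by rewrite ler_pXn2r ?nnegrE ?l2norm_ge0 // cv.
    apply: le_trans (lerD h1 (lexx _)); rewrite mulr_sumr.
    have -> : (size s)%:R * (2 * (2 * eps m) ^+ 2) = \sum_(x <- s) (2 * (2 * eps m) ^+ 2).
      by rewrite big_const_seq count_predT iter_addr_0 mulr_natl.
    rewrite -big_split; apply: ler_sum => x _.
    have c1 : normc (v n x - w x) <= normc (v n x - v m x) + normc (v m x - w x).
      by rewrite -(subrKA (v m x)); apply: le_normcD.
    have c2 := Hw x m.
    have c3 := normc_ge0 (v n x - w x); have c4 := normc_ge0 (v n x - v m x).
    have c5 := normc_ge0 (v m x - w x).
    rewrite /sqfun -[(v n - v m : H) x]/(v n x - v m x).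
    exact: (key _ _ _ _ c1 c2 c3 c4 c5).
  set S := \sum_(x <- s) _ in bd *.
  have SA : S <= 2 * eps n ^+ 2.
    rewrite leNgt; apply/negP => lt.
    pose t := S - 2 * eps n ^+ 2; have t0 : 0 < t by rewrite subr_gt0.
    pose c := 8 * (size s)%:R + 8 : R.
    have c0 : 0 < c by rewrite /c ltr_wpDl // mulr_ge0.
    pose e := Num.min 1 (t / c).
    have ep : 0 < e by rewrite /e lt_min ltr01 divr_gt0.
    have [N HN] := e0 e ep.
    have eN := HN (maxn n N) (leq_maxr _ _).
    have := bd (maxn n N) (leq_maxl _ _); apply/negP; rewrite -ltNge.
    have e1 : e <= 1 by rewrite /e ge_min lexx.
    have e2 : e * c <= t by rewrite -ler_pdivlMr // /e ge_min lexx orbT.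
    have h : eps (maxn n N) ^+ 2 <= e.
      have := eps0 (maxn n N); move: (eps _) eN => y eN y0.
      by rewrite expr2; nra.
    have k0 : 0 <= (size s)%:R :> R by [].
    have : (size s)%:R * (2 * (2 * eps (maxn n N)) ^+ 2) <= (size s)%:R * (8 * e).
      apply: ler_wpM2l => //; rewrite exprMn; lra.
    rewrite /t /c in t0 e2 *; move: k0 e2 ep; move: (_%:R : R) => k; nra.
  apply: (le_trans SA); rewrite exprMn.
  by have : 0 <= eps n ^+ 2 by [exact: sqr_ge0]; lra.
have nfin n : (nsum (sqfun (fun y => v n y - w y)%R) <= ((2 * eps n) ^+ 2)%:E)%E.
  apply: ge_ereal_sup => _ [A [finA _] <-].
  rewrite fsbig_finite // sumEFin lee_fin; apply: fin; exact: finmap.fset_uniq.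
have uP : (fun y => v 0%N y - w y) \in @sqsum R Q.
  by apply/asboolP; apply: le_lt_trans (nfin 0%N) _; exact: ltry.
exists (v 0%N - Ell2 uP) => n; apply: l2norm_le; first by rewrite mulr_ge0.
apply: le_trans (nfin n); apply: le_nsum => x.
rewrite /sqfun -[(v n - (v 0%N - Ell2 uP)) x]/(v n x - (v 0%N x - (v 0%N x - w x))).
by rewrite (_ : v 0%N x - (v 0%N x - w x) = w x) ?subKr.
Qed.

End InnerProduct.

(** * The reduced algebra *)

Section Operators.
Local Open Scope classical_set_scope.
Local Open Scope ring_scope.
Local Open Scope complex_scope.
Variables (R : realType) (Q : groupType).
Local Notation H := (ell2 R Q).
Local Notation C := R[i].
Local Notation A := (@reduced_cstar R Q).
Local Notation span := (@lreg_span R Q).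
Implicit Types (f g : H) (S T U : H -> H).

(** Stands in for [opnorm] in all estimates, where a supremum would call for boundedness first;
    [cstarP] is the passage between the two. *)
Definition opbound T (M : R) := forall f, l2norm (T f) <= M * l2norm f.

Lemma opbound_le T M M' : M <= M' -> opbound T M -> opbound T M'.
Proof. by move=> MM TM f; apply: le_trans (TM f) _; rewrite ler_wpM2r ?l2norm_ge0. Qed.

Lemma opboundD S T M N : opbound S M -> opbound T N -> opbound (S + T) (M + N).
Proof.
move=> SM TN f; rewrite mulrDl; apply: le_trans (l2normD _ _) _.
by apply: lerD; [exact: SM|exact: TN].
Qed.

Lemma opboundZ (c : C) T M : opbound T M -> opbound (c *: T) (normc c * M).
Proof.
move=> TM f; rewrite -[(c *: T) f]/(c *: T f) l2normZ -mulrA.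
by apply: ler_wpM2l; [exact: normc_ge0|exact: TM].
Qed.

Lemma opboundN T M : opbound T M -> opbound (- T) M.
Proof. by move=> TM f; rewrite -[(- T) f]/(- T f) l2normN; exact: TM. Qed.

Lemma opboundB S T M N : opbound S M -> opbound T N -> opbound (S - T) (M + N).
Proof. by move=> SM /opboundN; exact: opboundD. Qed.

Lemma opbound_comp S T M N : 0 <= M -> opbound S M -> opbound T N ->
  opbound (S \o T) (M * N).
Proof.
move=> M0 SM TN f; apply: le_trans (SM _) _; rewrite -mulrA.
by apply: ler_wpM2l => //; exact: TN.
Qed.

Lemma opbound_id : opbound idfun 1.
Proof. by move=> f; rewrite mul1r. Qed.

Lemma opboundC S T M : opbound (S - T) M -> opbound (T - S) M.
Proof. by move=> /opboundN; rewrite opprB. Qed.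

Lemma opbound_tri S T U M N : opbound (S - T) M -> opbound (T - U) N ->
  opbound (S - U) (M + N).
Proof. by move=> h1 h2; rewrite -(subrKA T S (- U)); exact: opboundD. Qed.

Lemma opbound_opnorm T M : 0 <= M -> opbound T M -> opnorm T <= M.
Proof.
move=> M0 TM; apply: ge_sup.
  by exists (l2norm (T 0)); exists 0 => //=; rewrite l2norm0 ler01.
move=> _ [f /= f1 <-]; apply: le_trans (TM f) _.
by rewrite -[leRHS]mulr1; apply: ler_wpM2l.
Qed.

Lemma op_lin0 T : linear T -> T 0 = 0.
Proof. by move=> lT; have := lT (-1) 0 0; rewrite scaler0 addr0 scaleN1r addNr. Qed.

Lemma op_linZ T (a : C) f : linear T -> T (a *: f) = a *: T f.
Proof. by move=> lT; rewrite -[a *: f]addr0 lT op_lin0 // addr0. Qed.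

Lemma op_linD T f g : linear T -> T (f + g) = T f + T g.
Proof. by move=> lT; rewrite -{1}[f]scale1r lT scale1r. Qed.

Lemma op_linB T f g : linear T -> T (f - g) = T f - T g.
Proof.
by move=> lT; rewrite op_linD // -[- g]scaleN1r op_linZ // scaleN1r.
Qed.

Lemma opnorm_opbound T : bounded_operator T -> opbound T (opnorm T).
Proof.
move=> [lT [M TM]] f.
have [f0|fn0] := eqVneq (l2norm f) 0.
  by rewrite (l2norm_eq0 f0) op_lin0 // !l2norm0 mulr0.
have fp : 0 < l2norm f by rewrite lt_neqAle eq_sym fn0 l2norm_ge0.
rewrite -ler_pdivrMr //.
have nrm : normc (((l2norm f)^-1)%:C : C) = (l2norm f)^-1.
  by rewrite normc_real ger0_norm // invr_ge0 ltW.
have -> : l2norm (T f) / l2norm f = l2norm (T (((l2norm f)^-1)%:C *: f)).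
  by rewrite op_linZ // l2normZ nrm mulrC.
apply: ub_le_sup.
  exists `|M| => _ [g /= g1 <-]; apply: le_trans (TM g) _.
  apply: le_trans (ler_norm _) _; rewrite normrM (ger0_norm (l2norm_ge0 g)).
  by rewrite -[leRHS]mulr1; apply: ler_wpM2l.
by eexists; last by []; rewrite /= l2normZ nrm mulVf.
Qed.

Lemma lreg_linear x : linear (@lreg R Q x).
Proof. by move=> a f g; apply: ell2_eq. Qed.

Lemma lreg_norm x f : l2norm (lreg x f) = l2norm f.
Proof.
apply/eqP; rewrite -(@eqrXn2 _ 2) ?l2norm_ge0 // !l2norm_sqr; apply/eqP.
by congr fine; apply: (nsum_translate (a := sqfun f) x^-1%g); exact: sqfun_ge0.
Qed.

Lemma lreg_mul x y f : lreg x (lreg y f) = lreg (x * y)%g f.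
Proof. by apply: ell2_eq => z /=; rewrite invgM mulgA. Qed.

Lemma lreg_one f : lreg 1%g f = f.
Proof. by apply: ell2_eq => z /=; rewrite invg1 mul1g. Qed.

Lemma lreg_opbound x : opbound (@lreg R Q x) 1.
Proof. by move=> f; rewrite lreg_norm mul1r. Qed.

Lemma lreg_adjoint x : adjoint (@lreg R Q x) (@lreg R Q x^-1%g).
Proof.
move=> f g; apply/eqP; rewrite eq_complex /l2inner /=; apply/andP; split; apply/eqP.
  rewrite -(rsum_translate x (absum_prod (lreg x f) g (@Re_le_normc R))).
  by congr rsum; apply/funext => y /=; rewrite mulKg invgK.
rewrite -(rsum_translate x (absum_prod (lreg x f) g (@Im_le_normc R))).
by congr rsum; apply/funext => y /=; rewrite mulKg invgK.
Qed.

Lemma span0 : span 0. Proof. by exists [::]; rewrite big_nil. Qed.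

Lemma spanD S T : span S -> span T -> span (S + T).
Proof. by move=> [s ->] [t ->]; exists (s ++ t); rewrite big_cat. Qed.

Lemma spanZ (c : C) T : span T -> span (c *: T).
Proof.
move=> [s ->]; exists [seq (c * p.1, p.2) | p <- s]; rewrite big_map scaler_sumr.
by apply: eq_bigr => p _; rewrite scalerA.
Qed.

Lemma span_lreg x : span (@lreg R Q x).
Proof. by exists [:: (1, x)]; rewrite big_seq1 scale1r. Qed.

Lemma span_ind (P : (H -> H) -> Prop) : P 0 ->
  (forall (c : C) x T, span T -> P T -> P (c *: @lreg R Q x + T)) ->
  forall T, span T -> P T.
Proof.
move=> P0 PD _ [s ->]; elim: s => [|p s IH]; first by rewrite big_nil.
by rewrite big_cons; apply: PD => //; exists s.
Qed.

Lemma span_linear T : span T -> linear T.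
Proof.
elim/span_ind => {T} [a f g|c x T _ lT a f g]; first by rewrite /= scaler0 addr0.
rewrite -[LHS]/(c *: lreg x (a *: f + g) + T (a *: f + g)) lreg_linear lT.
rewrite -[X in _ = _ *: X + _]/(c *: lreg x f + T f).
rewrite -[X in _ = _ + X]/(c *: lreg x g + T g).
by rewrite !scalerDr !scalerA (mulrC c a) addrACA.
Qed.

Lemma span_opbound T : span T -> exists2 M, 0 <= M & opbound T M.
Proof.
elim/span_ind => {T} [|c x T _ [M M0 TM]].
  by exists 0 => // f; rewrite mul0r l2norm0.
exists (normc c * 1 + M).
  by rewrite addr_ge0 // mulr1 normc_ge0.
by apply: opboundD => //; apply: opboundZ; exact: lreg_opbound.
Qed.

Lemma span_comp S T : span S -> span T -> span (S \o T).
Proof.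
move=> sS sT; move: S sS; apply: span_ind => [|c x S _ IH].
  have -> : (0 : H -> H) \o T = 0 :> (H -> H) by [].
  exact: span0.
have -> : (c *: @lreg R Q x + S) \o T = c *: (@lreg R Q x \o T) + (S \o T) by [].
apply: spanD => //; apply: spanZ; move: T sT {IH}.
apply: span_ind => [|a y T _ IH].
  have -> : @lreg R Q x \o (0 : H -> H) = 0 :> (H -> H).
    by apply/funext => f /=; rewrite (op_lin0 (lreg_linear x)).
  exact: span0.
have -> : @lreg R Q x \o (a *: @lreg R Q y + T) =
    a *: @lreg R Q (x * y)%g + (@lreg R Q x \o T).
  apply/funext => f /=; rewrite -[(a *: _ + T) f]/(a *: lreg y f + T f).
  by rewrite lreg_linear lreg_mul.
by apply: spanD => //; apply: spanZ; exact: span_lreg.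
Qed.

Lemma cstarP T : A T <->
  linear T /\ forall e : R, 0 < e -> exists2 S, span S & opbound (T - S) e.
Proof.
split=> [[[lT bT] AT]|[lT AT]].
  split=> // e e0; have [S sS Se] := AT e e0; exists S => //.
  apply: opbound_le (ltW Se) _; apply: opnorm_opbound.
  have lS := span_linear sS; have [N N0 SN] := span_opbound sS.
  have [M TM] := bT; split; last by exists (M + N); exact: opboundB.
  move=> a f g; rewrite -[LHS]/(T (a *: f + g) - S (a *: f + g)) lT lS.
  rewrite -[X in _ = _ *: X + _]/(T f - S f) -[X in _ = _ + X]/(T g - S g).
  by rewrite scalerBr opprD addrACA.
split.
  split=> //; have [S sS Se] := AT 1 ltr01; have [N N0 SN] := span_opbound sS.
  by exists (1 + N); have := opboundD Se SN; rewrite subrK.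
move=> e e0; have e20 : 0 < e / 2 by rewrite divr_gt0.
have [S sS Se] := AT _ e20; exists S => //.
apply: le_lt_trans (opbound_opnorm (ltW e20) Se) _.
by rewrite ltr_pdivrMr // mulr_natr mulr2n ltrDl.
Qed.

Lemma cstar_linear T : A T -> linear T. Proof. by move=> /cstarP []. Qed.

Lemma cstar_approx T (e : R) : A T -> 0 < e -> exists2 S, span S & opbound (T - S) e.
Proof. by move=> /cstarP [_]; apply. Qed.

Lemma cstar_opbound T : A T -> exists2 M, 0 <= M & opbound T M.
Proof.
move=> AT; have [S sS Se] := cstar_approx AT ltr01.
have [N N0 SN] := span_opbound sS; exists (1 + N); first by rewrite addr_ge0.
by have := opboundD Se SN; rewrite subrK.
Qed.

Lemma span_cstar T : span T -> A T.
Proof.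
move=> sT; apply/cstarP; split; first exact: span_linear.
move=> e e0; exists T => // f.
by rewrite -[(T - T) f]/(T f - T f) subrr l2norm0 mulr_ge0 ?l2norm_ge0 // ltW.
Qed.

Lemma cstar_closure T : linear T ->
  (forall e : R, 0 < e -> exists2 S, A S & opbound (T - S) e) -> A T.
Proof.
move=> lT AT; apply/cstarP; split=> // e e0.
have e20 : 0 < e / 2 by rewrite divr_gt0.
have [S AS Se] := AT _ e20; have [U sU Ue] := cstar_approx AS e20.
exists U => //; apply: opbound_le (opbound_tri Se Ue).
by rewrite -splitr.
Qed.

Lemma cstar_id : A idfun.
Proof.
apply: span_cstar; have -> : idfun = @lreg R Q 1%g by apply/funext => f; rewrite lreg_one.
exact: span_lreg.
Qed.

Lemma cstarDZ (c : C) S T : A S -> A T -> A (c *: S + T).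
Proof.
move=> AS AT; have lS := cstar_linear AS; have lT := cstar_linear AT.
apply/cstarP; split.
  move=> a f g; rewrite -[LHS]/(c *: S (a *: f + g) + T (a *: f + g)) lS lT.
  rewrite -[X in _ = _ *: X + _]/(c *: S f + T f).
  rewrite -[X in _ = _ + X]/(c *: S g + T g).
  by rewrite !scalerDr !scalerA (mulrC c a) addrACA.
move=> e e0; pose d := e / (normc c + 1).
have c1 : 0 < normc c + 1 by rewrite ltr_wpDl ?normc_ge0.
have d0 : 0 < d by rewrite divr_gt0.
have [U sU Ue] := cstar_approx AS d0; have [V sV Ve] := cstar_approx AT d0.
exists (c *: U + V); first by apply: spanD => //; exact: spanZ.
have := opboundD (opboundZ c Ue) Ve.
rewrite scalerBr addrACA -opprD; apply: opbound_le.
by rewrite -{2}(mul1r d) -mulrDl mulrC divfK // gt_eqF.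
Qed.

Lemma cstarZ (c : C) T : A T -> A (c *: T).
Proof.
move=> AT; have := cstarDZ c AT (span_cstar span0).
by congr (A _); exact: addr0.
Qed.

Lemma cstarD S T : A S -> A T -> A (S + T).
Proof. by move=> AS AT; have := cstarDZ 1 AS AT; congr (A (_ + T)); exact: scale1r. Qed.

Lemma cstarB S T : A S -> A T -> A (S - T).
Proof. 
move=> AS AT; have := cstarDZ (-1) AT AS.
by congr (A _); rewrite addrC; congr (S + _); exact: scaleN1r.
 Qed.

Lemma cstar_comp S T : A S -> A T -> A (S \o T).
Proof.
move=> AS AT; have lS := cstar_linear AS; have lT := cstar_linear AT.
apply/cstarP; split; first by move=> a f g; rewrite /= lT lS.
move=> e e0; have [M M0 SM] := cstar_opbound AS; have [N N0 TN] := cstar_opbound AT.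
pose d := Num.min 1 (e / (M + N + 1)).
have mn0 : 0 < M + N + 1 by rewrite ltr_wpDl ?addr_ge0.
have d0 : 0 < d by rewrite lt_min ltr01 divr_gt0.
have d1 : d <= 1 by rewrite /d ge_min lexx.
have d2 : d * (M + N + 1) <= e by rewrite -ler_pdivlMr // /d ge_min lexx orbT.
have [U sU Ue] := cstar_approx AS d0; have [V sV Ve] := cstar_approx AT d0.
exists (U \o V); first exact: span_comp.
have -> : (S \o T) - (U \o V) = ((S - U) \o V) + (S \o (T - V)).
  apply/funext => f; rewrite -[LHS]/(S (T f) - U (V f)).
  rewrite -[RHS]/(S (V f) - U (V f) + S (T f - V f)) op_linB //.
  by rewrite [RHS]addrC subrKA.
have VN : opbound V (N + d).
  have := opboundD TN (opboundC Ve); rewrite addrC subrK //.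
have B1 := opbound_comp (ltW d0) Ue VN.
have B2 := opbound_comp M0 SM Ve.
apply: opbound_le (opboundD B1 B2).
by apply: le_trans d2; nra.
Qed.

Lemma op_eq T U : (forall e : R, 0 < e -> exists2 c, c <= e & opbound (T - U) c) -> T = U.
Proof.
move=> TU; apply/funext => f; apply/eqP; rewrite -subr_eq0; apply/eqP/l2norm_eq0.
apply/eqP; rewrite eq_le l2norm_ge0 andbT; apply/ler_addgt0Pr => e e0.
have f0 := l2norm_ge0 f.
have c1 : 0 < l2norm f + 1 by rewrite ltr_wpDl.
have [|c ce Tc] := TU (e / (l2norm f + 1)); first by rewrite divr_gt0.
rewrite add0r; apply: le_trans (Tc f) _.
have : c * l2norm f <= e / (l2norm f + 1) * l2norm f by apply: ler_wpM2r.
move=> /le_trans; apply; rewrite mulrAC ler_pdivrMr //.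
by apply: ler_wpM2l; [exact: ltW|rewrite lerDl].
Qed.

Lemma cstar_complete (T : nat -> H -> H) (eps : nat -> R) :
  (forall n, A (T n)) ->
  (forall m n, (m <= n)%N -> opbound (T m - T n) (eps m)) ->
  (forall e, 0 < e -> exists N, forall n, (N <= n)%N -> eps n <= e) ->
  exists2 U, A U & forall n, opbound (T n - U) (2 * eps n).
Proof.
move=> AT cT e0.
have pick f : exists w, forall n, l2norm (T n f - w) <= 2 * eps n * l2norm f.
  have [||w Hw] := @l2_complete R Q (fun n => T n f) (fun n => eps n * l2norm f).
  - by move=> m n mn; exact: cT.
  - move=> e ep; have c1 : 0 < l2norm f + 1 by rewrite ltr_wpDl ?l2norm_ge0.
    have [|N HN] := e0 (e / (l2norm f + 1)); first by rewrite divr_gt0.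
    exists N => n /HN h; apply: (@le_trans _ _ (e / (l2norm f + 1) * l2norm f)).
      by rewrite ler_wpM2r ?l2norm_ge0.
    rewrite mulrAC ler_pdivrMr //; apply: ler_wpM2l; [exact: ltW|by rewrite lerDl].
  by exists w => n; rewrite -mulrA.
have [U HU] := choice pick.
have lU : linear U.
  move=> a f g; apply/eqP; rewrite -subr_eq0; apply/eqP/l2norm_eq0.
  apply/eqP; rewrite eq_le l2norm_ge0 andbT; apply/ler_addgt0Pr => e ep; rewrite add0r.
  pose k := 2 * (l2norm (a *: f + g) + normc a * l2norm f + l2norm g) + 1.
  have k0 : 0 < k.
    by rewrite ltr_wpDl // mulr_ge0 // !addr_ge0 ?mulr_ge0 ?l2norm_ge0 ?normc_ge0.
  have [|N HN] := e0 (e / k); first by rewrite divr_gt0.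
  have eN := HN N (leqnn N).
  have h1 := HU (a *: f + g) N; have h2 := HU f N; have h3 := HU g N.
  have -> : U (a *: f + g) - (a *: U f + U g) =
      - (T N (a *: f + g) - U (a *: f + g)) +
      (a *: (T N f - U f) + (T N g - U g)).
    rewrite (cstar_linear (AT N)) scalerBr opprB -[RHS]addrA; congr (_ + _).
    by rewrite addrACA -opprD addrA addNr add0r.
  apply: le_trans (l2normD _ _) _; rewrite l2normN.
  apply: le_trans (lerD h1 (l2normD _ _)) _; rewrite l2normZ.
  have h4 : normc a * l2norm (T N f - U f) <= normc a * (2 * eps N * l2norm f).
    by apply: ler_wpM2l => //; exact: normc_ge0.
  apply: le_trans (lerD (lexx _) (lerD h4 h3)) _.
  have -> : 2 * eps N * l2norm (a *: f + g) +
      (normc a * (2 * eps N * l2norm f) + 2 * eps N * l2norm g) = eps N * (k - 1).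
    by rewrite /k; ring.
  have : eps N * (k - 1) <= e / k * (k - 1).
    apply: ler_wpM2r => //; rewrite /k addrK mulr_ge0 //.
    by rewrite !addr_ge0 ?mulr_ge0 ?l2norm_ge0 ?normc_ge0.
  move=> /le_trans; apply; rewrite mulrAC ler_pdivrMr //.
  by apply: ler_wpM2l; [exact: ltW|rewrite gerBl].
have TU n : opbound (T n - U) (2 * eps n) by move=> f; exact: HU.
exists U => //; apply: cstar_closure => // e ep.
have [|N HN] := e0 (e / 2); first by rewrite divr_gt0.
exists (T N) => //; apply/opboundC/(opbound_le _ (TU N)).
by have := HN N (leqnn N); rewrite ler_pdivlMr // mulrC.
Qed.

End Operators.

(** * Powers' averaging *)

Section Averaging.
Local Open Scope classical_set_scope.
Local Open Scope ring_scope.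
Local Open Scope complex_scope.
Variables (R : realType) (Q : groupType).
Local Notation H := (ell2 R Q).
Implicit Types f : H.

Lemma sqr_sum_le (I : eqType) (s : seq I) (b : I -> R) :
  (\sum_(j <- s) b j) ^+ 2 <= (size s)%:R * \sum_(j <- s) b j ^+ 2.
Proof.
elim: s => [|i s IH]; first by rewrite !big_nil mul0r expr0n.
rewrite !big_cons /= -natr1; move: IH.
set t := \sum_(j <- s) b j; set q := \sum_(j <- s) b j ^+ 2; set n := (size s)%:R : R.
have q0 : 0 <= q by rewrite sumr_ge0 // => j _; exact: sqr_ge0.
have n0 : 0 <= n by exact: ler0n.
move=> IH; suff : 2 * (b i * t) <= n * b i ^+ 2 + q by nra.
have [n00|np] := eqVneq n 0.
  have -> : t = 0.
    by apply/eqP; rewrite -sqrf_eq0 eq_le sqr_ge0 andbT -(mul0r q) -n00.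
  by rewrite !mulr0 addr_ge0 // mulr_ge0 // sqr_ge0.
have {n0}np : 0 < n by rewrite lt_neqAle eq_sym np.
rewrite -(ler_pM2l np); have := sqr_ge0 (n * b i - t); nra.
Qed.

(** Split off the at most one term that fails [c] and apply Cauchy-Schwarz to the others. The factor
    [n] then weighs only the terms satisfying [c], which is what makes the averages small. *)
Lemma sqr_sum_split (n : nat) (b : nat -> R) (c : nat -> bool) :
  (forall i j, (i < n)%N -> (j < n)%N -> ~~ c i -> ~~ c j -> i = j) ->
  (\sum_(j < n) b j) ^+ 2 <=
  \sum_(j < n) (2 * b j ^+ 2 + 2 * n%:R * (if c j then b j ^+ 2 else 0)).
Proof.
move=> c1; rewrite (bigID (fun j : 'I_n => c j)) /= big_split /= -!mulr_sumr.
have le_all : (\sum_(j < n | ~~ c j) b j) ^+ 2 <= \sum_(j < n) b j ^+ 2.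
  case: (pickP (fun j : 'I_n => ~~ c j)) => [i ci|c0]; last first.
    rewrite (eq_bigl xpred0) // big_pred0_eq expr0n /=.
    by apply: sumr_ge0 => j _; exact: sqr_ge0.
  rewrite (big_pred1 i) => [|j].
    by rewrite (bigD1 i) //= lerDl sumr_ge0 // => j _; exact: sqr_ge0.
  apply/idP/eqP => [cj|-> //]; apply: val_inj; exact: (c1 _ _ (ltn_ord j) (ltn_ord i)) cj ci.
have le_c : (\sum_(j < n | c j) b j) ^+ 2 <=
    n%:R * \sum_(j < n) (if c j then b j ^+ 2 else 0).
  have := sqr_sum_le (index_enum 'I_n) (fun j : 'I_n => if c j then b j else 0).
  rewrite -big_mkcond /= /index_enum -enumT size_enum_ord => h.
  apply: le_trans h _; apply: ler_wpM2l; first exact: ler0n.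
  by apply: ler_sum => j _; case: (c j); rewrite ?expr0n.
set u := \sum_(j < n | c j) b j in le_c *.
set v := \sum_(j < n | ~~ c j) b j in le_all *.
have := sqr_ge0 (u - v); nra.
Qed.

Lemma nsum_sum (n : nat) (a : nat -> Q -> R) : (forall j x, 0 <= a j x) ->
  (nsum (fun x => (\sum_(j < n) a j x)%R) = \sum_(j < n) nsum (a j))%E.
Proof.
move=> a0; elim: n => [|n IH].
  rewrite big_ord0 /nsum; under eq_esum => x _ do rewrite big_ord0.
  by rewrite esum1.
rewrite big_ord_recr /= -IH -nsumD //.
  by congr nsum; apply/funext => x; rewrite big_ord_recr.
by move=> x; apply: sumr_ge0.
Qed.

(* For each [x] at most one [j] has [(u j)^-1 * x] outside [D j]; the remaining
   terms of the sum only see the restrictions of [f] to the disjoint [D j]. *)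
Lemma powers_norm (n : nat) (u : nat -> Q) (D : nat -> set Q) :
  (forall i j x, (i < n)%N -> (j < n)%N -> D i x -> D j x -> i = j) ->
  (forall j x, (j < n)%N -> ~ D j x -> D j (u j * x)%g) ->
  opbound (\sum_(j < n) @lreg R Q (u j)) (2 * Num.sqrt n%:R).
Proof.
move=> Ddis uD f; have n0 : (0 : R) <= n%:R := ler0n _ _.
apply: l2norm_le; first by rewrite !mulr_ge0 ?sqrtr_ge0 ?l2norm_ge0.
pose e j y := if `[< D j y >] then sqfun f y else 0.
have e0 j y : 0 <= e j y by rewrite /e; case: ifP => // _; exact: sqfun_ge0.
have sumE x : (\sum_(j < n) @lreg R Q (u j) : H -> H) f x = \sum_(j < n) f ((u j)^-1 * x)%g.
  elim: (n) => [|k IH]; first by rewrite !big_ord0.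
  by rewrite !big_ord_recr /= -IH.
pose b x (j : nat) := 2 * sqfun f ((u j)^-1 * x)%g + 2 * n%:R * e j ((u j)^-1 * x)%g.
have le1 : (nsum (sqfun ((\sum_(j < n) @lreg R Q (u j) : H -> H)%R f)) <=
    nsum (fun x => (\sum_(j < n) b x j)%R))%E.
  apply: le_nsum => x; rewrite /sqfun sumE.
  have le_norm : normc (\sum_(j < n) f ((u j)^-1 * x)%g) <=
      \sum_(j < n) normc (f ((u j)^-1 * x)%g).
    elim: (n) => [|k IH]; first by rewrite !big_ord0 normc0.
    rewrite !big_ord_recr /=; apply: le_trans (le_normcD _ _) _.
    by rewrite lerD2r.
  apply: (@le_trans _ _ ((\sum_(j < n) normc (f ((u j)^-1 * x)%g)) ^+ 2)).
    by rewrite ler_sqr ?nnegrE ?normc_ge0 // sumr_ge0 // => j _; exact: normc_ge0.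
  apply: (@sqr_sum_split n (fun j => normc (f ((u j)^-1 * x)%g))
    (fun j => `[< D j ((u j)^-1 * x)%g >])) => i j ilt jlt /asboolPn Di /asboolPn Dj.
  have := uD _ _ ilt Di; have := uD _ _ jlt Dj; rewrite !mulVKg => Djx Dix.
  exact: Ddis Dix Djx.
apply: le_trans le1 _; rewrite (@nsum_sum n (fun j x => b x j)); last first.
  by move=> j x; apply: addr_ge0; rewrite !mulr_ge0 //; exact: normc_ge0.
have bE : forall j : 'I_n, (nsum (fun x => b x j) =
    2%:E * nsum (sqfun f) + (2 * n%:R)%:E * nsum (e j))%E.
  move=> i; have s0 := sqfun_ge0 f.
  pose B y := 2 * sqfun f y + 2 * n%:R * e i y.
  have B0 y : 0 <= B y by apply: addr_ge0; rewrite !mulr_ge0 //; exact: normc_ge0.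
  rewrite -[LHS]/(nsum (fun x => B ((u i)^-1 * x)%g)) nsum_translate // /B.
  rewrite nsumD; [|by move=> y; rewrite mulr_ge0..].
  rewrite nsumZ // nsumZ // ?mulr_ge0 //.
have ele : (\sum_(j < n) nsum (e j) <= nsum (sqfun f))%E.
  rewrite -nsum_sum //; apply: le_nsum => y.
  case: (pickP (fun j : 'I_n => `[< D j y >])) => [i Di|D0]; last first.
    rewrite big1 ?sqfun_ge0 // => j _; rewrite /e; case: ifP => //.
    by rewrite D0.
  rewrite (bigD1 i) //= big1 ?addr0 => [|j ji].
    by rewrite /e Di.
  rewrite /e; case: ifP => // /asboolP Dj; move/asboolP: Di => Di.
  case/eqP: ji; apply: val_inj; exact: Ddis (ltn_ord j) (ltn_ord i) Dj Di.
have fin_e : forall j : 'I_n, nsum (e j) = (fine (nsum (e j)))%:E.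
  move=> j; rewrite nsum_fin //; apply: le_lt_trans (sqfun_fin f); apply: le_nsum => y.
  by rewrite /e; case: ifP => // _; exact: sqfun_ge0.
have {}ele : \sum_(j < n) fine (nsum (e j)) <= l2norm f ^+ 2.
  rewrite -lee_fin l2norm_sqrE -sumEFin; apply: le_trans ele.
  by rewrite le_eqVlt; apply/orP; left; apply/eqP/eq_bigr => j _; rewrite -fin_e.
rewrite (eq_bigr (fun j : 'I_n =>
  (2 * l2norm f ^+ 2 + 2 * n%:R * fine (nsum (e j)))%:E)) => [|j _]; last first.
  by rewrite bE fin_e -l2norm_sqrE -!EFinM -EFinD.
rewrite sumEFin lee_fin big_split /= -!mulr_sumr sumr_const card_ord.
rewrite !exprMn sqr_sqrtr // -[_ *+ n]mulr_natr.
have := ler_wpM2l n0 ele; move: (l2norm f) (\sum_(j < n) _) => N E.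
nra.
Qed.

End Averaging.

(** * The canonical trace and adjoints *)

Section Trace.
Local Open Scope classical_set_scope.
Local Open Scope ring_scope.
Local Open Scope complex_scope.
Variables (R : realType) (Q : groupType).
Local Notation H := (ell2 R Q).
Local Notation C := R[i].
Local Notation A := (@reduced_cstar R Q).
Local Notation span := (@lreg_span R Q).
Implicit Types (f g : H) (S T U : H -> H).

Lemma normc_small (z : C) (K : R) : (forall e : R, 0 < e -> normc z <= e * K) -> z = 0.
Proof.
move=> zK; apply: eq0_normc; apply/eqP; rewrite eq_le normc_ge0 andbT.
apply/ler_addgt0Pr => e e0; rewrite add0r.
have K1 : 0 < `|K| + 1 by rewrite ltr_wpDl.
apply: le_trans (zK (e / (`|K| + 1)) _) _; first by rewrite divr_gt0.
rewrite mulrAC ler_pdivrMr //; apply: ler_wpM2l; first exact: ltW.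
by apply: le_trans (ler_norm _) _; rewrite lerDl.
Qed.

Lemma delta_sqsum (x : Q) : (fun y => (y == x)%:R : C) \in @sqsum R Q.
Proof.
apply/asboolP; have := @absum_single R Q (fun y => normc ((y == x)%:R : C) ^+ 2) x.
case=> [y /negPf ->|abs _]; first by rewrite normc0 expr0n.
apply: le_lt_trans abs; apply: le_nsum => y; exact: ler_norm.
Qed.

Definition delta (x : Q) : H := Ell2 (delta_sqsum x).

Lemma l2inner_delta f x : l2inner f (delta x) = f x.
Proof.
have single (P : C -> R) : P 0 = 0 ->
    rsum (fun y => P (f y * conjc (delta x y))) = P (f x).
  move=> P0; have := @absum_single R Q (fun y => P (f y * conjc (delta x y))) x.
  case=> [y /negPf /= ->|_ ->]; first by rewrite conjc0 mulr0.
  by rewrite /= eqxx conjc1 mulr1.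
apply/eqP; rewrite eq_complex /l2inner.
by rewrite -[complex.Re (f x)]single // -[complex.Im (f x)]single //= !eqxx.
Qed.

Lemma delta_norm x : l2norm (delta x) = 1.
Proof.
have : l2inner (delta x) (delta x) = 1 by rewrite l2inner_delta /= eqxx.
rewrite l2inner_norm => /(congr1 (@complex.Re R)) /= /eqP.
by rewrite sqrp_eq1 ?l2norm_ge0 // => /eqP.
Qed.

Definition tr T : C := T (delta 1%g) 1%g.

Lemma opbound_coord T M x y : opbound T M -> normc (T (delta x) y) <= M.
Proof.
move=> TM; apply: le_trans (l2norm_coord _ _) _.
by apply: le_trans (TM _) _; rewrite delta_norm mulr1.
Qed.

Lemma tr_opbound T M : opbound T M -> normc (tr T) <= M.
Proof. exact: opbound_coord. Qed.

Lemma trDZ (c : C) S T : tr (c *: S + T) = c * tr S + tr T. Proof. by []. Qed.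

Lemma trB S T : tr (S - T) = tr S - tr T. Proof. by []. Qed.

Lemma tr_id : tr idfun = 1. Proof. by rewrite /tr /= eqxx. Qed.

Lemma tr_lreg x : tr (@lreg R Q x) = (x == 1%g)%:R.
Proof. by rewrite /tr /= mulg1 -(inj_eq invg_inj) invgK invg1. Qed.

Lemma lreg_delta x y : lreg x (delta y) = delta (x * y)%g.
Proof.
apply: ell2_eq => z /=; congr (_%:R); congr nat_of_bool.
by apply/eqP/eqP => [<-|->]; rewrite ?mulKg ?mulVKg.
Qed.

(* Operators in [A] commute with right translations, since [lreg] does. *)
Lemma cstar_delta T x y : A T -> T (delta x) y = T (delta 1%g) (y * x^-1)%g.
Proof.
move=> AT; apply/eqP; rewrite -subr_eq0; apply/eqP/(@normc_small _ 2) => e e0.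
have [S sS Se] := cstar_approx AT e0.
have ES : S (delta x) y = S (delta 1%g) (y * x^-1)%g.
  move: S sS {Se}; apply: span_ind => // c g S _ IH.
  rewrite -[LHS]/(c * lreg g (delta x) y + S (delta x) y) IH.
  rewrite -[RHS]/(c * lreg g (delta 1%g) (y * x^-1)%g + S (delta 1%g) (y * x^-1)%g).
  congr (_ * _ + _); rewrite /= -(inj_eq (mulIg x^-1%g) _ x) mulgV.
  by rewrite mulgA.
have -> : T (delta x) y - T (delta 1%g) (y * x^-1)%g =
    (T - S) (delta x) y - (T - S) (delta 1%g) (y * x^-1)%g.
  rewrite -[(T - S) _ _]/(T (delta x) y - S (delta x) y) ES.
  rewrite -[(T - S) _ _]/(T (delta 1%g) (y * x^-1)%g - S (delta 1%g) (y * x^-1)%g).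
  by rewrite opprB addrA subrK.
apply: le_trans (le_normcD _ _) _; rewrite normcN mulr_natr mulr2n.
by apply: lerD; exact: opbound_coord.
Qed.

Lemma tr_comp S T : A S -> A T -> tr (S \o T) = tr (T \o S).
Proof.
move=> AS AT; apply/eqP; rewrite -subr_eq0; apply/eqP.
have [M M0 TM] := cstar_opbound AT; apply: (@normc_small _ (2 * M)) => e e0.
have lT := cstar_linear AT; have [U sU Ue] := cstar_approx AS e0.
have EU : tr (U \o T) = tr (T \o U).
  move: U sU {Ue}; apply: span_ind => [|c g U _ IH].
    by rewrite /tr /= (op_lin0 lT).
  rewrite -[LHS]/(c * lreg g (T (delta 1%g)) 1%g + tr (U \o T)) IH.
  rewrite -[RHS]/(T (c *: lreg g (delta 1%g) + U (delta 1%g)) 1%g) lT.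
  rewrite -[RHS]/(c * T (lreg g (delta 1%g)) 1%g + tr (T \o U)).
  by rewrite lreg_delta mulg1 (cstar_delta _ _ AT) /= mulg1 mul1g.
have -> : tr (S \o T) - tr (T \o S) = tr ((S - U) \o T) - tr (T \o (S - U)).
  rewrite -[tr ((S - U) \o T)]/(tr (S \o T) - tr (U \o T)) EU.
  rewrite -[tr (T \o (S - U))]/(T (S (delta 1%g) - U (delta 1%g)) 1%g) op_linB //.
  rewrite -[(T _ - T _) _]/(tr (T \o S) - tr (T \o U)).
  by rewrite opprB addrA subrK.
apply: le_trans (le_normcD _ _) _; rewrite normcN.
have -> : e * (2 * M) = e * M + M * e by ring.
by apply: lerD; apply/tr_opbound/opbound_comp => //; exact: ltW.
Qed.

Lemma adjointC T S : adjoint T S -> adjoint S T.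
Proof.
by move=> TS f g; rewrite l2inner_conj -TS -l2inner_conj.
Qed.

Lemma adjointDZ (c : C) S S' T T' : adjoint S S' -> adjoint T T' ->
  adjoint (c *: S + T) (conjc c *: S' + T').
Proof.
move=> SS TT f g; rewrite -[(c *: S + T) f]/(c *: S f + T f).
rewrite -[(conjc c *: S' + T') g]/(conjc c *: S' g + T' g).
by rewrite l2innerDl l2innerDr conjcK SS TT.
Qed.

Lemma adjoint_comp S S' T T' : adjoint S S' -> adjoint T T' ->
  adjoint (S \o T) (T' \o S').
Proof. by move=> SS TT f g; rewrite /= SS TT. Qed.

Lemma adjoint_opbound T T' M : adjoint T T' -> opbound T M -> opbound T' M.
Proof.
move=> TT TM g; have [z|n0] := eqVneq (l2norm (T' g)) 0.
  by rewrite z; have := TM g; apply: le_trans; exact: l2norm_ge0.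
have p : 0 < l2norm (T' g) by rewrite lt_neqAle eq_sym n0 l2norm_ge0.
have := cauchy_schwarz (T (T' g)) g; rewrite TT l2inner_norm normc_real.
rewrite ger0_norm ?sqr_ge0 // => h.
rewrite -(ler_pM2l p) -expr2; apply: le_trans h _.
have -> : l2norm (T' g) * (M * l2norm g) = M * l2norm (T' g) * l2norm g by ring.
by apply: ler_wpM2r; [exact: l2norm_ge0|exact: TM].
Qed.

Lemma span_adjoint T : span T -> exists2 T', span T' & adjoint T T'.
Proof.
elim/span_ind => {T} [|c x T _ [T' sT' TT]].
  by exists 0; [exact: span0|move=> f g; rewrite l2inner0l l2inner_conj l2inner0l conjc0].
exists (conjc c *: @lreg R Q x^-1%g + T').
  by apply: spanD => //; apply/spanZ/span_lreg.
by apply: adjointDZ => //; exact: lreg_adjoint.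
Qed.

(** Elements of the span have explicit adjoints with the same bounds, so the adjoints of
    approximants of [T] form a Cauchy sequence in the algebra. *)
Lemma cstar_adjoint T : A T -> exists2 T', A T' & adjoint T T'.
Proof.
move=> AT; pose d (n : nat) : R := n.+1%:R^-1.
have d0 n : 0 < d n by rewrite invr_gt0 ltr0n.
have dle m n : (m <= n)%N -> d n <= d m.
  by move=> mn; rewrite lef_pV2 ?posrE ?ltr0n // ler_nat.
have [S HS] : {S : nat -> H -> H & forall n, span (S n) /\ opbound (T - S n) (d n)}.
  by apply: (@choice _ _ (fun n S => span S /\ opbound (T - S) (d n))) => n;
    have [S ? ?] := cstar_approx AT (d0 n); exists S.
have [S' HS'] : {S' : nat -> H -> H & forall n, span (S' n) /\ adjoint (S n) (S' n)}.
  by apply: (@choice _ _ (fun n S' => span S' /\ adjoint (S n) S')) => n;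
    have [S' ? ?] := span_adjoint (HS n).1; exists S'.
have [|m n mn|e e0|U AU HU] := @cstar_complete R Q S' (fun n => 2 * d n).
- by move=> n; apply: span_cstar; exact: (HS' n).1.
- have adj : adjoint (S m - S n) (S' m - S' n).
    have := adjointDZ (-1) (HS' n).2 (HS' m).2.
    by rewrite rmorphN rmorph1 !scaleN1r ![- _ + _]addrC.
  apply: adjoint_opbound adj _.
  apply: opbound_le (opbound_tri (opboundC (HS m).2) (HS n).2).
  by rewrite mulr_natl mulr2n lerD2l dle.
- exists (Num.bound (2 / e)) => n Nn; rewrite /d ler_pdivrMr ?ltr0n //.
  have := archi_boundP (divr_ge0 (ler0n R 2) (ltW e0)); rewrite ltr_pdivrMr // => h.
  apply: le_trans (ltW h) _; rewrite mulrC ler_pM2l // ler_nat.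
  exact: leq_trans Nn _.
exists U => // f g; apply/eqP; rewrite -subr_eq0; apply/eqP.
apply: (@normc_small _ (5 * (l2norm f * l2norm g))) => e e0.
pose n := Num.bound e^-1.
have de : d n <= e.
  have := archi_boundP (ltW (_ : 0 < e^-1)); rewrite invr_gt0 => /(_ e0) h.
  rewrite /d -[leRHS]invrK lef_pV2 ?posrE ?invr_gt0 ?ltr0n //.
  by apply: le_trans (ltW h) _; rewrite ler_nat.
have -> : l2inner (T f) g - l2inner f (U g) =
    l2inner ((T - S n) f) g + l2inner f ((S' n - U) g).
  rewrite -[(T - S n) f]/(T f - S n f) -[(S' n - U) g]/(S' n g - U g).
  rewrite -[in X in _ = X + _](scaleN1r (S n f)) addrC.
  rewrite -[in X in _ = _ + X](scaleN1r (U g)).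
  rewrite [T f + _]addrC [S' n g + _]addrC l2innerDl l2innerDr (HS' n).2.
  by rewrite rmorphN rmorph1 !mulN1r; ring.
apply: le_trans (le_normcD _ _) _.
have h1 := le_trans (cauchy_schwarz _ _) (ler_wpM2r (l2norm_ge0 g) ((HS n).2 f)).
have h2 := le_trans (cauchy_schwarz _ _) (ler_wpM2l (l2norm_ge0 f) (HU n g)).
apply: le_trans (lerD h1 h2) _.
have -> : d n * l2norm f * l2norm g + l2norm f * (2 * (2 * d n) * l2norm g) =
  d n * (5 * (l2norm f * l2norm g)) by ring.
by apply: ler_wpM2r => //; rewrite !mulr_ge0 ?l2norm_ge0.
Qed.

Lemma tr_positive T T' : A T -> A T' -> adjoint T T' -> 0 <= tr (T' \o T).
Proof.
move=> _ _ TT; rewrite /tr -l2inner_delta l2inner_conj -[(T' \o T) _]/(T' (T _)) -TT l2inner_norm.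
by rewrite conjc_real lecR sqr_ge0.
Qed.

(** The vector [delta 1] is separating: right invariance recovers all matrix coefficients from its
    image, and the adjoint recovers [T] from them. *)
Lemma cstar_coord_neq0 T : A T -> T <> 0 -> exists x, T (delta 1%g) x <> 0.
Proof.
move=> AT Tn0; apply: contrapT => /forallNP T0; apply: Tn0.
have {}T0 x y : T (delta x) y = 0 by rewrite cstar_delta //; exact: contrapT.
have [T' AT' TT] := cstar_adjoint AT.
apply/funext => f; apply: ell2_eq => y; rewrite -l2inner_delta TT.
have -> : T' (delta y) = 0.
  apply: ell2_eq => x; rewrite -l2inner_delta (adjointC TT).
  by rewrite l2inner_conj l2inner_delta T0 conjc0.
by rewrite l2inner_conj l2inner0l conjc0.
Qed.

Lemma tr_normalized : normalized_trace A tr.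
Proof.
split=> [c S T _ _|||]; [exact: trDZ|exact: tr_id|exact: tr_positive|exact: tr_comp].
Qed.

End Trace.

(** * Averages of conjugates and traces under averaging *)

Section PowersAveraging.
Local Open Scope classical_set_scope.
Local Open Scope ring_scope.
Local Open Scope complex_scope.
Variables (R : realType) (Q : groupType).
Local Notation H := (ell2 R Q).
Local Notation C := R[i].
Local Notation A := (@reduced_cstar R Q).
Local Notation span := (@lreg_span R Q).
Implicit Types (f : H) (S T U : H -> H) (g : nat -> Q).

Definition conj_op (x : Q) T : H -> H := lreg x \o (T \o lreg x^-1%g).

Definition average n g T : H -> H :=
  (n%:R^-1 : C) *: (\sum_(j < n) conj_op (g j) T : H -> H).

Lemma conj_opDZ x (c : C) S T : conj_op x (c *: S + T) = c *: conj_op x S + conj_op x T.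
Proof.
apply/funext => f; rewrite -[LHS]/(lreg x (c *: S (lreg x^-1%g f) + T (lreg x^-1%g f))).
by rewrite lreg_linear.
Qed.

Lemma conj_op_opbound x T M : opbound T M -> opbound (conj_op x T) M.
Proof. by move=> TM f; rewrite lreg_norm -[l2norm f](lreg_norm x^-1%g); exact: TM. Qed.

Lemma averageDZ n g (c : C) S T :
  average n g (c *: S + T) = c *: average n g S + average n g T.
Proof.
rewrite /average scalerA mulrC -scalerA -scalerDr; congr (_ *: _).
by rewrite scaler_sumr -big_split; apply: eq_bigr => j _; exact: conj_opDZ.
Qed.

Lemma averageB n g S T : average n g (S - T) = average n g S - average n g T.
Proof.
have := averageDZ n g (-1) T S; rewrite ![_ + S]addrC ![_ + average n g S]addrC.
by rewrite (scaleN1r T) (scaleN1r (average n g T)).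
Qed.

Lemma average0 n g : average n g 0 = 0.
Proof. by have := averageB n g 0 0; rewrite !subrr. Qed.

Lemma normc_invn n : normc (n%:R^-1 : C) = n%:R^-1.
Proof.
have -> : (n%:R^-1 : C) = (n%:R^-1 : R)%:C by rewrite fmorphV rmorph_nat.
by rewrite normc_real ger0_norm // invr_ge0.
Qed.

Lemma opbound_average n g T M : (0 < n)%N -> opbound T M -> opbound (average n g T) M.
Proof.
move=> n0 TM; have -> : M = n%:R^-1 * (n%:R * M).
  by rewrite mulKf // pnatr_eq0 -lt0n.
rewrite -(normc_invn n); apply: opboundZ.
elim: n {n0} => [|n IH]; first by rewrite big_ord0 mul0r => f; rewrite mul0r l2norm0.
rewrite big_ord_recr /= -natr1 mulrDl mul1r; apply: opboundD => //.
exact: conj_op_opbound.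
Qed.

Lemma average_id n g : (0 < n)%N -> average n g idfun = idfun.
Proof.
move=> n0; have -> : average n g idfun = (n%:R^-1 : C) *: (\sum_(j < n) idfun : H -> H).
  congr (_ *: _); apply: eq_bigr => j _; apply/funext => f.
  by rewrite /conj_op /= lreg_mul mulgV lreg_one.
rewrite sumr_const card_ord -[(_ : H -> H) *+ n](@scaler_nat C) scalerA mulVf ?scale1r //.
by rewrite pnatr_eq0 -lt0n.
Qed.

Lemma lreg_cstar x : A (@lreg R Q x). Proof. exact/span_cstar/span_lreg. Qed.

Lemma conj_op_cstar x T : A T -> A (conj_op x T).
Proof. by move=> AT; apply: cstar_comp (lreg_cstar _) (cstar_comp AT (lreg_cstar _)). Qed.

Lemma sum_conj_op_cstar n g T : A T -> A (\sum_(j < n) conj_op (g j) T : H -> H).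
Proof.
move=> AT; elim: n => [|n IH]; first by rewrite big_ord0; exact/span_cstar/span0.
by rewrite big_ord_recr; exact: (cstarD IH (conj_op_cstar _ AT)).
Qed.

Lemma average_cstar n g T : A T -> A (average n g T).
Proof. by move=> AT; apply/cstarZ/sum_conj_op_cstar. Qed.

Lemma average_ideal (I : set (H -> H)) n g T : two_sided_ideal A I -> I T ->
  I (average n g T).
Proof.
move=> [_ I0 ID IZ IM] IT; apply: IZ; elim: n => [|n IH]; first by rewrite big_ord0.
have IC : I (conj_op (g n) T) by exact: (IM _ _ (lreg_cstar _) (IM _ _ (lreg_cstar _) IT).2).1.
by rewrite big_ord_recr; exact: (ID _ _ IH IC).
Qed.

Section Trace.
Variable t : (H -> H) -> C.
Hypothesis tP : normalized_trace A t.

Lemma traceDZ (c : C) S T : A S -> A T -> t (c *: S + T) = c * t S + t T.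
Proof. by case: tP => h _ _ _; exact: h. Qed.

Lemma trace_id : t idfun = 1. Proof. by case: tP. Qed.

Lemma trace_positive T T' : A T -> A T' -> adjoint T T' -> 0 <= t (T' \o T).
Proof. by case: tP => _ _ h _; exact: h. Qed.

Lemma traceC S T : A S -> A T -> t (S \o T) = t (T \o S).
Proof. by case: tP => _ _ _; exact. Qed.

Lemma trace0 : t 0 = 0.
Proof.
have A0 := span_cstar (@span0 R Q); have := traceDZ (-1) A0 A0.
by rewrite scaler0 addr0 mulN1r addNr.
Qed.

Lemma traceZ (c : C) T : A T -> t (c *: T) = c * t T.
Proof.
move=> AT; have := traceDZ c AT (span_cstar (@span0 R Q)).
by rewrite trace0 !addr0.
Qed.

Lemma traceD S T : A S -> A T -> t (S + T) = t S + t T.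
Proof. by move=> AS AT; have := traceDZ 1 AS AT; rewrite (scale1r S) mul1r. Qed.

Lemma traceB S T : A S -> A T -> t (S - T) = t S - t T.
Proof.
move=> AS AT; have := traceDZ (-1) AT AS.
by rewrite (scaleN1r T) mulN1r ![- _ + _]addrC.
Qed.

Lemma trace_average n g T : (0 < n)%N -> A T -> t (average n g T) = t T.
Proof.
move=> n0 AT; rewrite traceZ; last exact: sum_conj_op_cstar.
have -> : t (\sum_(j < n) conj_op (g j) T : H -> H) = n%:R * t T.
  elim: n {n0} => [|n IH]; first by rewrite big_ord0 trace0 mul0r.
  rewrite big_ord_recr -natr1 mulrDl mul1r -IH traceD; last 2 first.
  - exact: sum_conj_op_cstar.
  - exact: conj_op_cstar.
  congr (_ + _); rewrite /conj_op traceC; last 2 first.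
  - exact: lreg_cstar.
  - exact: cstar_comp AT (lreg_cstar _).
  by congr t; apply/funext => f /=; rewrite lreg_mul mulVg lreg_one.
by rewrite mulKf // pnatr_eq0 -lt0n.
Qed.

End Trace.

(** Averaging fixes the identity, whose coefficient is the trace. What remains is a combination of
    nontrivial translations, with [K] the sum of the absolute values of its coefficients. *)
Lemma span_average_bound S : span S -> exists F : seq Q, exists K : R,
  [/\ 0 <= K, forall x, x \in F -> x <> 1%g
    & forall n g d, (0 < n)%N -> (forall x, x \in F -> opbound (average n g (@lreg R Q x)) d) ->
      opbound (average n g S - tr S *: idfun) (K * d)].
Proof.
elim/span_ind => {S} [|c x S _ [F [K [K0 F1 FK]]]].
  exists [::], 0; split=> // n g d _ _ f.
  rewrite average0 -[(0 - _) f]/(0 - (tr 0 *: f)) /tr /= scale0r subr0.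
  by rewrite l2norm0 !mul0r.
have E n g : average n g (c *: @lreg R Q x + S) - tr (c *: @lreg R Q x + S) *: idfun =
    c *: (average n g (@lreg R Q x) - (x == 1%g)%:R *: idfun) +
    (average n g S - tr S *: idfun).
  rewrite averageDZ trDZ tr_lreg scalerBr [RHS]addrACA -opprD.
  by rewrite scalerDl -(scalerA c).
have [x1|xn1] := eqVneq x 1%g.
  exists F, K; split=> [||n g d n0 Fd]; [exact: K0|exact: F1|rewrite E].
  have -> : average n g (@lreg R Q x) - (x == 1%g)%:R *: idfun = 0.
    rewrite x1 eqxx scale1r.
    have -> : @lreg R Q 1%g = idfun by apply/funext => f; rewrite lreg_one.
    by rewrite average_id // subrr.
  rewrite scaler0 add0r.
  exact: FK.
exists (x :: F), (normc c + K); split=> [|y|n g d n0 Fd].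
- by rewrite addr_ge0 ?normc_ge0.
- by rewrite inE => /orP[/eqP ->|/F1 //]; exact/eqP.
rewrite E (negPf xn1) scale0r subr0 mulrDl; apply: opboundD.
  by apply: opboundZ; apply: Fd; rewrite inE eqxx.
by apply: FK => // y yF; apply: Fd; rewrite inE yF orbT.
Qed.

Hypothesis powQ : powers_off [set 1%g : Q].

Lemma span_average S (e : R) : span S -> 0 < e ->
  exists n g, (0 < n)%N /\ opbound (average n g S - tr S *: idfun) e.
Proof.
move=> /span_average_bound [F [K [K0 F1 FK]]] e0.
(* A square number of conjugates turns the bound [2 * Num.sqrt n / n] into [2 / m]. *)
pose m := (Num.bound (K * 2 / e)).+1; pose n := (m ^ 2)%N.
have m0 : (0 : R) < m%:R by rewrite ltr0n.
have [D [g [FD Dg]]] := powQ n F1.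
have n0 : (0 < n)%N by rewrite expn_gt0.
exists n, g; split=> //.
have le_e : K * (2 / m%:R) <= e.
  rewrite mulrA ler_pdivrMr // [leRHS]mulrC -ler_pdivrMr //.
  have := archi_boundP (_ : 0 <= K * 2 / e); rewrite !mulr_ge0 ?invr_ge0 ?(ltW e0) //.
  by move=> /(_ isT) /ltW /le_trans; apply; rewrite ler_nat.
apply: opbound_le le_e _; apply: FK => // x xF.
have -> : 2 / m%:R = n%:R^-1 * (2 * Num.sqrt n%:R) :> R.
  rewrite /n natrX sqrtr_sqr gtr0_norm //; field; exact: lt0r_neq0.
rewrite -{1}normc_invn; apply: opboundZ.
have -> : \sum_(j < n) conj_op (g j) (@lreg R Q x) =
    \sum_(j < n) @lreg R Q (g j * x * (g j)^-1)%g.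
  by apply: eq_bigr => j _; apply/funext => f; rewrite /conj_op /= !lreg_mul.
(* The disjoint sets are the translates [g j * D]: the conjugate of [x] by [g j] maps the complement
   of the [j]-th one into it. *)
apply: (@powers_norm R Q n (fun j => g j * x * (g j)^-1)%g
  (fun j => [set y | D ((g j)^-1 * y)%g])) => /= [i j y ilt jlt Di Dj|j y jlt Dj].
  apply: contrapT => ij; apply: (Dg _ _ ilt jlt ij _ _ Di Dj).
  by rewrite !mulVKg.
by rewrite !mulgA mulVg mul1g -mulgA; exact: FD.
Qed.

Lemma cstar_average T (e : R) : A T -> 0 < e ->
  exists n g, (0 < n)%N /\ opbound (average n g T - tr T *: idfun) e.
Proof.
move=> AT e0; have e30 : 0 < e / 3 by rewrite divr_gt0.
have [S sS Se] := cstar_approx AT e30.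
have [n [g [n0 Sg]]] := span_average sS e30.
exists n, g; split=> //.
have B1 := opbound_average g n0 Se; rewrite averageB in B1.
have B2 : opbound (tr S *: (idfun : H -> H) - tr T *: (idfun : H -> H)) (e / 3 * 1).
  rewrite -(scalerBl (tr S) (tr T) (idfun : H -> H)).
  apply: opbound_le (opboundZ _ (@opbound_id R Q)).
  rewrite ler_wpM2r // -trB; exact/tr_opbound/opboundC.
apply: opbound_le (opbound_tri B1 (opbound_tri Sg B2)).
by rewrite le_eqVlt; apply/orP; left; apply/eqP; field.
Qed.

End PowersAveraging.

(** * Simplicity and uniqueness of the trace *)

Section SimplicityTrace.
Local Open Scope classical_set_scope.
Local Open Scope ring_scope.
Local Open Scope complex_scope.
Variables (R : realType) (Q : groupType).
Local Notation H := (ell2 R Q).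
Local Notation C := R[i].
Local Notation A := (@reduced_cstar R Q).
Implicit Types (f : H) (S T U V W : H -> H).

(** Banach's principle on a norm-closed class [P], the common source of inverses near the identity
    and of square roots. *)
Lemma contraction_fixpoint (P : (H -> H) -> Prop) (F : (H -> H) -> (H -> H)) T0 :
  (forall T, P T -> A T) -> P T0 -> (forall T, P T -> P (F T)) ->
  (forall T U M, P T -> P U -> 0 <= M -> opbound (T - U) M -> opbound (F T - F U) (M / 2)) ->
  (forall U, A U -> (forall e : R, 0 < e -> exists2 T, P T & opbound (T - U) e) -> P U) ->
  exists2 U, P U & F U = U.
Proof.
move=> PA P0 PF cF clP; pose X n := iter n F T0.
have PX n : P (X n) by elim: n => //= n; exact: PF.
have [K K0 HK] := cstar_opbound (cstarB (PA _ P0) (PA _ (PF _ P0))).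
have p2 n : (0 : R) < 2 ^+ n by rewrite exprn_gt0.
have e0 n : 0 <= K / 2 ^+ n by rewrite divr_ge0 // ltW.
have step n : opbound (X n - X n.+1) (K / 2 ^+ n).
  elim: n => [|n IH]; first by rewrite expr0 divr1.
  have := cF _ _ _ (PX n) (PX n.+1) (e0 n) IH.
  by rewrite exprSr invfM mulrA.
pose eps n := 2 * (K / 2 ^+ n).
have cX m n : (m <= n)%N -> opbound (X m - X n) (eps m).
  move=> /subnKC <-; move: (n - m)%N => d; elim: d m => [|d IH] m.
    rewrite addn0 => f; rewrite -[(X m - X m) f]/(X m f - X m f) subrr l2norm0.
    by rewrite !mulr_ge0 ?l2norm_ge0 // invr_ge0 ltW.
  have := opbound_tri (step m) (IH m.+1); rewrite addSnnS; apply: opbound_le.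
  rewrite /eps exprS invfM; set z := (2 ^+ m)^-1.
  by rewrite le_eqVlt; apply/orP; left; apply/eqP; field.
have small e : 0 < e -> exists N, forall n, (N <= n)%N -> eps n <= e.
  move=> e1; exists (Num.bound (2 * K / e)) => n Nn.
  rewrite /eps mulrA ler_pdivrMr // [leRHS]mulrC -ler_pdivrMr //.
  have := archi_boundP (_ : 0 <= 2 * K / e); rewrite !mulr_ge0 ?invr_ge0 ?(ltW e1) //.
  move=> /(_ isT) /ltW /le_trans; apply; rewrite -natrX ler_nat.
  by apply: leq_trans Nn _; exact/ltnW/ltn_expl.
have [U AU HU] := cstar_complete (fun n => PA _ (PX n)) cX small.
have PU : P U.
  apply: clP => // e e1; have [|N HN] := small (e / 2); first by rewrite divr_gt0.
  exists (X N) => //; apply: opbound_le (HU N).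
  by have := HN N (leqnn N); rewrite ler_pdivlMr // mulrC.
exists U => //; apply: op_eq => e e1.
have [|N HN] := small (e / 3); first by rewrite divr_gt0.
have eN n : 0 <= eps n by rewrite mulr_ge0.
have h1 : opbound (F U - X N.+1) (2 * eps N / 2).
  by apply: cF => //; [rewrite mulr_ge0|exact: opboundC].
exists (2 * eps N / 2 + 2 * eps N.+1).
  have := HN N (leqnn N); have := HN N.+1 (leqnSn N); lra.
exact: opbound_tri h1 (HU _).
Qed.

Lemma neumann W : A W -> opbound W (1 / 2) -> exists2 V, A V & idfun + (W \o V) = V.
Proof.
move=> AW W2; have lW := cstar_linear AW.
have := @contraction_fixpoint A (fun V => idfun + (W \o V)) idfun.
case=> [//||V AV|S T M _ _ M0 STM|U //|V AV EV]; last by exists V.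
- exact: cstar_id.
- exact: cstarD (@cstar_id R Q) (cstar_comp AW AV).
have -> : idfun + (W \o S) - (idfun + (W \o T)) = W \o (S - T) :> (H -> H).
  apply/funext => f; rewrite -[LHS]/(f + W (S f) - (f + W (T f))).
  rewrite -[RHS]/(W (S f - T f)) op_linB //.
  by rewrite opprD addrACA subrr add0r.
have half0 : 0 <= (1 / 2 : R) by rewrite divr_ge0.
have -> : M / 2 = 1 / 2 * M by rewrite mul1r mulrC.
exact: opbound_comp half0 W2 STM.
Qed.

(** A translate and a multiple give a nonzero element of [I] trace [1]. Some average of its
    conjugates, a finite sum that stays in [I], is then within [1/2] of the identity and has a right
    inverse in the algebra. *)
Lemma simple_of_powers : powers_off [set 1%g : Q] -> simple_algebra A.
Proof.
move=> powQ I idI; have [IA I0 ID IZ IM] := idI.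
have [[T [IT Tn0]]|allz] := pselect (exists T, I T /\ T <> 0); last first.
  left; apply/seteqP; split=> [T IT|T ->] //.
  by apply: contrapT => Tn0; apply: allz; exists T.
right; have AT := IA _ IT; have [x cn0] := cstar_coord_neq0 AT Tn0.
set c := T (delta R (1%g : Q)) x in cn0.
pose S : H -> H := c^-1 *: (lreg x^-1%g \o T).
have IS : I S by exact: (IZ _ _ (IM _ _ (lreg_cstar R x^-1%g) IT).1).
have trS : tr S = 1.
  rewrite -[tr S]/(c^-1 * T (delta R (1%g : Q)) (x^-1^-1 * 1)%g) invgK mulg1 mulVf //.
  exact/eqP.
have half : 0 < (1 / 2 : R) by rewrite divr_gt0.
have [n [g [n0]]] := cstar_average powQ (IA _ IS) half.
rewrite trS (scale1r (idfun : H -> H)) => VW; set V := average n g S in VW.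
have IV : I V by exact: (average_ideal n g idI IS).
have [U AU EU] := neumann (cstarB (@cstar_id R Q) (IA _ IV)) (opboundC VW).
have VU : V \o U = idfun.
  apply/funext => f; have := congr1 (@^~ f) EU.
  rewrite -[(_ + _) f]/(f + (U f - V (U f))) => /eqP.
  by rewrite addrCA -subr_eq0 addrAC subrr add0r subr_eq0 => /eqP.
have Iid : I idfun by rewrite -VU; exact: (IM _ _ AU IV).2.
apply/seteqP; split=> // Y AY; exact: (IM _ _ AY Iid).1.
Qed.

Lemma adjointD S S' T T' : adjoint S S' -> adjoint T T' -> adjoint (S + T) (S' + T').
Proof.
move=> SS TT; have := adjointDZ 1 SS TT.
by rewrite rmorph1 (scale1r S) (scale1r S').
Qed.

Lemma adjointZ (c : C) T T' : adjoint T T' -> adjoint (c *: T) (conjc c *: T').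
Proof.
move=> TT f g; rewrite -[(c *: T) f]/(c *: T f) -[(_ *: T') g]/(conjc c *: T' g).
by rewrite l2innerZl l2innerZr conjcK TT.
Qed.

Lemma adjointB S S' T T' : adjoint S S' -> adjoint T T' -> adjoint (S - T) (S' - T').
Proof.
move=> SS TT; have := adjointD SS (adjointZ (-1) TT).
by rewrite rmorphN rmorph1 (scaleN1r T) (scaleN1r T').
Qed.

Lemma opbound_closed U M :
  (forall e : R, 0 < e -> exists2 T, opbound T M & opbound (T - U) e) -> opbound U M.
Proof.
move=> TU f; apply/ler_addgt0Pr => e e0; have f0 := l2norm_ge0 f.
have f1 : 0 < l2norm f + 1 by rewrite ltr_wpDl.
have [|T TM Te] := TU (e / (l2norm f + 1)); first by rewrite divr_gt0.
have := opboundD TM (opboundC Te); rewrite addrC subrK => /(_ f) /le_trans; apply.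
rewrite mulrDl lerD2l mulrAC ler_pdivrMr //; apply: ler_wpM2l; first exact: ltW.
by rewrite lerDl.
Qed.

Lemma selfadjoint_closed U :
  (forall e : R, 0 < e -> exists2 T, adjoint T T & opbound (T - U) e) -> adjoint U U.
Proof.
move=> TU f g; apply/eqP; rewrite -subr_eq0; apply/eqP.
apply: (@normc_small _ _ (2 * (l2norm f * l2norm g))) => e /TU [T TT Te].
have -> : l2inner (U f) g - l2inner f (U g) =
    l2inner f ((T - U) g) - l2inner ((T - U) f) g.
  rewrite -[(T - U) f]/(T f - U f) -[(T - U) g]/(T g - U g).
  rewrite -(scaleN1r (U f)) -(scaleN1r (U g)).
  rewrite [T f + _]addrC [T g + _]addrC l2innerDl l2innerDr TT.
  by rewrite rmorphN rmorph1 !mulN1r; ring.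
apply: le_trans (le_normcD _ _) _; rewrite normcN.
have h1 := le_trans (cauchy_schwarz _ _) (ler_wpM2l (l2norm_ge0 f) (Te g)).
have h2 := le_trans (cauchy_schwarz _ _) (ler_wpM2r (l2norm_ge0 g) (Te f)).
apply: le_trans (lerD h1 h2) _.
by rewrite le_eqVlt; apply/orP; left; apply/eqP; ring.
Qed.

(* The fixed point of [y = (x + y^2) / 2] is a square root
   [1 - x = (1 - y)^2]. *)
Lemma selfadjoint_sqrt T : A T -> adjoint T T -> opbound T (1 / 2) ->
  exists U, [/\ A U, adjoint U U & (idfun - U) \o (idfun - U) = idfun - T].
Proof.
move=> AT TT T2; pose h : C := 2^-1.
have hE : h = (2^-1 : R)%:C by rewrite /h fmorphV rmorph_nat.
have h_conj : conjc h = h by rewrite hE conjc_real.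
have h_norm : normc h = 2^-1 by rewrite hE normc_real ger0_norm // invr_ge0.
have half0 : 0 <= (1 / 2 : R) by rewrite divr_ge0.
pose P U := [/\ A U, adjoint U U & opbound U (1 / 2 : R)].
have [||U [AU UU U2]|S U M [AS _ S2] [_ _ U2] M0 SUM|U AU cU|U [AU UU _] EU] :=
  @contraction_fixpoint P (fun U => h *: (T + (U \o U))) T.
- by move=> U [].
- by [].
- split.
  + exact: cstarZ (cstarD AT (cstar_comp AU AU)).
  + by have := adjointZ h (adjointD TT (adjoint_comp UU UU)); rewrite h_conj.
  + apply: opbound_le (opboundZ h (opboundD T2 (opbound_comp half0 U2 U2))).
    by rewrite h_norm; lra.
- have lS := cstar_linear AS.
  have -> : h *: (T + (S \o S)) - h *: (T + (U \o U)) =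
      h *: ((S \o (S - U)) + ((S - U) \o U)).
    rewrite -scalerBr; congr (_ *: _); apply/funext => f.
    rewrite -[LHS]/(T f + S (S f) - (T f + U (U f))).
    rewrite -[RHS]/(S (S f - U f) + (S (U f) - U (U f))).
    by rewrite (op_linB _ _ lS) subrKA opprD addrACA subrr add0r.
  apply: opbound_le (opboundZ h (opboundD (opbound_comp half0 S2 SUM)
    (opbound_comp M0 SUM U2))).
  by rewrite h_norm; lra.
- split=> //.
  + by apply: selfadjoint_closed => e /cU [S [_ ? _] ?]; exists S.
  + by apply: opbound_closed => e /cU [S [_ _ ?] ?]; exists S.
exists U; split=> //; have lU := cstar_linear AU.
apply/funext => f; rewrite -[LHS]/(f - U f - U (f - U f)) -[RHS]/(f - T f).
rewrite (op_linB _ _ lU); have E : U f = h *: (T f + U (U f)) by rewrite -{1}EU.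
have : U f + U f = T f + U (U f).
  by rewrite {1 2}E -scalerDl -[h + h]mulr2n -mulr_natl mulfV ?scale1r // pnatr_eq0.
move=> /(congr1 (fun v => f - v + U (U f))).
by rewrite !opprD opprK !addrA subrK => <-.
Qed.

Lemma normc_le1 (z : C) : 0 <= 1 - z -> 0 <= 1 + z -> normc z <= 1.
Proof.
move=> h1 h2; apply: le_trans (normc_le_ReIm z) _.
case: z h1 h2 => a b; rewrite !lecE /= => /andP[/eqP b0 a1] /andP[_ a2].
have -> : b = 0 by lra.
by rewrite normr0 addr0 ler_norml; apply/andP; split; lra.
Qed.

Section TraceBound.
Variable t : (H -> H) -> C.
Hypothesis tP : normalized_trace A t.

Lemma trace_le1 T : A T -> adjoint T T -> opbound T (1 / 2) -> 0 <= 1 - t T.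
Proof.
move=> AT TT T2; have [U [AU UU E]] := selfadjoint_sqrt AT TT T2.
have Aid := @cstar_id R Q; have AW := cstarB Aid AU.
have WW : adjoint (idfun - U) (idfun - U) by exact: adjointB.
have := trace_positive tP AW AW WW.
by rewrite E (traceB tP Aid AT) (trace_id tP).
Qed.

Lemma trace_selfadjoint_bound T (e : R) : A T -> adjoint T T -> 0 < e -> opbound T e ->
  normc (t T) <= 2 * e.
Proof.
(* This scaling brings [T] to norm [1/2], where the square root is available; positivity for both
   signs encloses the trace. *)
move=> AT TT e0 Te; pose c : R := (2 * e)^-1.
have c0 : 0 < c by rewrite invr_gt0 mulr_gt0.
have bnd (s : R) : `|s| = c -> 0 <= 1 - s%:C * t T.
  move=> sc; rewrite -(traceZ tP) //; apply: trace_le1; first exact: cstarZ.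
    by have := adjointZ (s%:C) TT; rewrite conjc_real.
  apply: opbound_le (opboundZ _ Te); rewrite normc_real sc /c.
  by rewrite le_eqVlt; apply/orP; left; apply/eqP; field; exact: lt0r_neq0.
have := normc_le1 (bnd c (gtr0_norm c0)); rewrite -[_ * t T]opprK -mulNr -rmorphN.
move=> /(_ (bnd (- c) _)); rewrite normrN => /(_ (gtr0_norm c0)).
rewrite normcN normcM normc_real normrN gtr0_norm // /c ler_pdivrMl ?mulr_gt0 //.
by rewrite mulr1.
Qed.

(** Continuity of a trace, extracted from positivity: the self-adjoint and skew parts of [T]
    contribute [2 * e] each. *)
Lemma trace_bound T (e : R) : A T -> 0 < e -> opbound T e -> normc (t T) <= 4 * e.
Proof.
move=> AT e0 Te; have [T' AT' TT] := cstar_adjoint AT.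
have T'e := adjoint_opbound TT Te; have T'T := adjointC TT.
pose h : C := (2^-1 : R)%:C; pose k : C := h * - 'i.
have h_norm : normc h = 2^-1 by rewrite normc_real ger0_norm // invr_ge0.
have k_norm : normc k = 2^-1.
  by rewrite normcM h_norm normcN /= expr0n expr1n add0r sqrtr1 mulr1.
have hh : h + h = 1.
  have -> : h = 2^-1 by rewrite /h fmorphV rmorph_nat.
  by rewrite -[LHS]mulr2n -[LHS]mulr_natl mulfV // pnatr_eq0.
have ki : 'i * k = h by rewrite /k mulrCA mulrN -expr2 sqr_i opprK mulr1.
have Aa := cstarZ h (cstarD AT AT'); have Ab := cstarZ k (cstarB AT AT').
have a_adj : adjoint (h *: (T + T')) (h *: (T + T')).
  by have := adjointZ h (adjointD TT T'T); rewrite conjc_real [T' + T]addrC.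
have b_adj : adjoint (k *: (T - T')) (k *: (T - T')).
  have := adjointZ k (adjointB TT T'T).
  have -> : conjc k = - k 
    by apply/eqP; rewrite eq_complex /=; apply/andP; split; apply/eqP; ring.
  by rewrite scaleNr -scalerN opprB.
have E : T = h *: (T + T') + 'i *: (k *: (T - T')).
  by rewrite scalerA ki -scalerDr addrACA subrr addr0 scalerDr -scalerDl hh scale1r.
have ha : opbound (h *: (T + T')) e.
  by apply: opbound_le (opboundZ h (opboundD Te T'e)); rewrite h_norm; lra.
have hb : opbound (k *: (T - T')) e.
  by apply: opbound_le (opboundZ k (opboundB Te T'e)); rewrite k_norm; lra.
rewrite {1}E (traceD tP Aa (cstarZ _ Ab)) (traceZ tP _ Ab).
apply: le_trans (le_normcD _ _) _; rewrite normcM.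
have -> : normc ('i : C) = 1 by rewrite /= expr0n expr1n add0r sqrtr1.
have := trace_selfadjoint_bound Aa a_adj e0 ha.
have := trace_selfadjoint_bound Ab b_adj e0 hb.
lra.
Qed.

End TraceBound.

(** A trace does not change under averaging and is continuous, while the averages approach the
    scalar [tr T]. *)
Lemma unique_trace_of_powers : powers_off [set 1%g : Q] -> has_unique_trace A.
Proof.
move=> powQ; exists (@tr R Q); first exact: tr_normalized.
move=> t tP T AT; apply/eqP; rewrite -subr_eq0; apply/eqP.
apply: (@normc_small _ _ 4) => e e0.
have [n [g [n0 ge]]] := cstar_average powQ AT e0.
have Aid := @cstar_id R Q; have AV := average_cstar n g AT.
have -> : t T - tr T = t (average n g T - tr T *: idfun).
  rewrite (traceB tP AV (cstarZ _ Aid)) (trace_average tP _ n0 AT).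
  by rewrite (traceZ tP _ Aid) (trace_id tP) mulr1.
rewrite mulrC; exact: trace_bound tP _ _ (cstarB AV (cstarZ _ Aid)) e0 ge.
Qed.

End SimplicityTrace.

(** * Relatively hyperbolic groups *)

Section Assembly.
Local Open Scope classical_set_scope.

Lemma nprh_powers (R : realType) (G : groupType) : NPRH R G ->
  exists E : subgroup G, max_finite_normal E /\ powers_off (sg_set E).
Proof.
move=> [nonel [L [H [properH [X [finX symX genX [rels [finrels relsP isoP]]]]]]]].
have [delta hyp] := rel_four_point symX genX finrels relsP isoP.
have [h hh] := rel_loxodromic finX finrels relsP isoP properH nonel hyp.
have lenP : is_length (rel_len symX genX) := word_len_length (rel_letters_sym symX) genX.
have hB := loxodromic_growing lenP hyp hh.
have W := rel_wpd finX finrels relsP isoP hyp hB.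
exact (axis_max_finite_normal lenP hyp hB W nonel).
Qed.

(* The relevant set in the quotient is the complement of the image of the
   complement of [D]. *)
Lemma powers_off_quotient (G : groupType) (E : subgroup G) (nE : normal E) :
  finite_set (sg_set E) -> powers_off (sg_set E) ->
  powers_off [set 1%g : quotient nE].
Proof.
move=> /finite_seqP [s Es] pow F n F1.
have inE_ x : sg_set E x = (x \in s) :> Prop by rewrite Es.
pose pi (x : G) : quotient nE := @qpi (quotient_pre nE) x.
have piM x y : pi (x * y)%g = (pi x * pi y)%g by exact: (@qpiM (quotient_pre nE)).
have piP x y : pi x = pi y <-> exists2 e, sg_set E e & y = (x * e)%g.
  split=> [/(@qpi_inj (quotient_pre nE)) h|[e Ee ->]].
    by exists (x^-1 * y)%g => //; rewrite mulVKg.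
  by apply: (@qpi_eq (quotient_pre nE)); rewrite /= /coset_eq mulKg.
have pi1 : pi 1%g = 1%g by apply: (mulgI (pi 1%g)); rewrite -piM !mulg1.
have nE' x e : sg_set E e -> sg_set E (x * e * x^-1)%g.
  by move=> /(nE x^-1%g); rewrite /conjg invgK mulgA.
(* All lifts [f * e] are listed because [f * x * e = f * (x * e * x^-1) * x]: changing the
   representative on the right amounts to changing the lift on the left. *)
have [|D [g [FD Dg]]] :=
  pow [seq (@qrepr (quotient_pre nE) f * e)%g | f <- F, e <- s] n.
  move=> _ /allpairsP[[f e] /= [fF es ->]] Efe; apply: (F1 f fF).
  have -> : f = pi (@qrepr (quotient_pre nE) f) by rewrite /pi qreprK.
  rewrite /= -pi1; apply/esym/piP; exists (@qrepr (quotient_pre nE) f).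
    have /sgV Ee : sg_set E e by rewrite inE_.
    by have := sgM Efe Ee; rewrite mulgK.
  by rewrite mul1g.
exists [set q | forall x, pi x = q -> D x], (fun i => pi (g i)).
split=> [f fF q|i j ilt jlt ij a b aD bD].
  move=> /existsNP[x /not_implyP[xq nDx]] y yE.
  pose f' := @qrepr (quotient_pre nE) f.
  have : pi (f' * x)%g = pi y by rewrite piM xq yE /pi qreprK.
  move=> /piP[e Ee ->].
  have -> : (f' * x * e = f' * (x * e * x^-1) * x)%g by rewrite !mulgA mulgVK.
  apply: FD nDx; apply/allpairsP; exists (f, x * e * x^-1)%g; split=> //.
  by rewrite -inE_; exact: nE'.
have [x xa] : exists x, pi x = a by exists (@qrepr (quotient_pre nE) a); exact: qreprK.
have [y yb] : exists y, pi y = b by exists (@qrepr (quotient_pre nE) b); exact: qreprK.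
rewrite -xa -yb -!piM => /piP[e Ee E2].
(* The discrepancy [e] is absorbed into [x], as the set in the quotient asks every representative to
   lie in [D]. *)
apply: (Dg i j ilt jlt ij (x * e)%g y); first 2 last.
- by rewrite mulgA.
- by apply: aD; rewrite -xa; apply/esym/piP; exists e.
- exact: bD.
Qed.

Lemma finite_amenable (R : realType) (G : groupType) (E : subgroup G) :
  finite_set (sg_set E) -> amenable R (sgType E).
Proof.
move=> /finite_seqP [s0 Es].
pose s : seq (sgType E) := undup (pmap insub s0).
have us : uniq s by exact: undup_uniq.
have sP (x : sgType E) : x \in s.
  rewrite mem_undup mem_pmap_sub /=.
  by have := set_mem (sg_valP x); rewrite Es.
have s0' : (0 < size s)%N by case: (s) (sP 1%g).
pose p (B : set (sgType E)) := [pred x | `[< B x >]].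
exists (fun B => (count (p B) s)%:R / (size s)%:R)%R; split.
- by move=> B; rewrite divr_ge0.
- rewrite (@eq_count _ _ predT) ?count_predT ?mulfV // ?pnatr_eq0 -?lt0n //.
  by move=> x /=; exact/asboolP.
- move=> A B AB; rewrite -mulrDl -natrD -count_predUI; congr (_%:R / _)%R.
  rewrite -[LHS]addn0; congr (_ + _).
    by apply: eq_count => x /=; rewrite asbool_or.
  apply/esym/eqP; rewrite -leqn0 leqNgt -has_count; apply/negP => /hasP[x _ /=].
  move=> /andP[/asboolP Ax /asboolP Bx].
  by have : (A `&` B) x by []; rewrite AB.
move=> g B; congr (_%:R / _)%R.
have pm : perm_eq s [seq (g * x)%g | x <- s].
  apply: uniq_perm => //; first by rewrite map_inj_uniq //; exact: mulgI.
  by move=> x; rewrite sP -(mulVKg g x) map_f.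
rewrite (permP pm) count_map; apply: eq_count => x /=.
apply/asboolP/asboolP => [[y By /mulgI <-] //|Bx]; by exists x.
Qed.

(* Three disjoint translates of [D] each have measure at least [1/2]: the
   conjugate [g i * f * (g i)^-1] maps the complement of [g i * D] into
   [g i * D]. *)
Lemma powers_off_amenable (R : realType) (G : groupType) (E M : subgroup G) :
  powers_off (sg_set E) -> normal M -> amenable R (sgType M) -> sg_set M `<=` sg_set E.
Proof.
move=> pow nM [m [m0 m1 mU mg]] f Mf; apply: contrapT => nEf.
have [|D [g [FD Dg]]] := pow [:: f] 3%N; first by move=> _ /[!inE] /eqP ->.
have {}FD x : ~ D x -> D (f * x)%g by apply: FD; rewrite inE.
pose mu (B : set G) := m [set k | B (sg_val k)].
pose Di i := [set x | D ((g i)^-1 * x)%g].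
have mono (B B' : set (sgType M)) : B `<=` B' -> (m B <= m B')%R.
  move=> BB; have -> : B' = B `|` (B' `\` B).
    by apply/seteqP; split=> k /=; [have := pselect (B k)|have := BB k]; tauto.
  by rewrite mU ?lerDl //; apply/seteqP; split=> k //= -[Bk []].
have muU B B' : B `&` B' = set0 -> mu (B `|` B') = (mu B + mu B')%R.
  move=> BB; rewrite /mu -mU //; apply/seteqP; split=> k //= -[Bk B'k].
  by have : (B `&` B') (sg_val k) by []; rewrite BB.
have half i : (1 <= mu (Di i) + mu (Di i))%R.
  have fiM : (g i * f * (g i)^-1)%g \in sg_set M.
    by apply: mem_set; have := nM (g i)^-1%g f Mf; rewrite /conjg invgK mulgA.
  have -> : 1%R = (mu (Di i) + mu (~` Di i))%R.
    by rewrite -muU ?setICr // setUCr -m1; congr m; apply/seteqP.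
  rewrite lerD2l /mu -(mg (SgElt fiM)); apply: mono => _ [k nDk <-].
  change (D ((g i)^-1 * (g i * f * (g i)^-1 * sg_val k))%g).
  rewrite !mulgA mulVg mul1g.
  by rewrite -mulgA; exact: FD.
have disj i j : (i < 3)%N -> (j < 3)%N -> i <> j -> Di i `&` Di j = set0.
  move=> ilt jlt ij; apply/seteqP; split=> x //= -[Dx Dx'].
  by apply: (Dg _ _ ilt jlt ij _ _ Dx Dx'); rewrite !mulVKg.
have : (mu (Di 0%N) + mu (Di 1%N) + mu (Di 2%N) <= 1)%R.
  rewrite -muU ?disj // -muU.
    by rewrite -m1; exact: mono.
  by rewrite setIUl !disj // setU0.
have := half 0%N; have := half 1%N; have := half 2%N; lra.
Qed.

End Assembly.

Local Open Scope classical_set_scope.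

Theorem corollary3 (R : realType) (G : groupType)
    (Gcount : countable [set: G]) (GNPRH : NPRH R G) :
  exists (A E : subgroup G) (nE : normal E),
    [/\ amenable_radical R A, max_finite_normal E, A = E,
        cstar_simple R (quotient nE) & unique_trace R (quotient nE)].
Proof.
have [E [[nE finE maxE] powE]] := nprh_powers GNPRH.
have powQ := powers_off_quotient (nE := nE) finE powE.
exists E, E, nE; split=> //.
- split=> //; first exact: finite_amenable.
  by move=> M nM amM; exact: powers_off_amenable powE nM amM.
- exact: simple_of_powers.
- exact: unique_trace_of_powers.
Qed.
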